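(* (a) For any $K\in\mathrm{SL}(2,\mathbb R)$, let $\psi_n$ be a real eigenfunction of $\lambda_n(K)$, $n\in\mathbb N_0$. Then the number of zeros of $\psi_n$ on the interval $[a,b)$ is $0$ or $1$ if $n=0$, and is $n-1$, $n$ or $n+1$ if $n\ge1$. (b) For any $K\in\mathrm{SL}(2,\mathbb R)$ and $0<\gamma<\pi$ or $-\pi<\gamma<0$, let $\psi_n$ be an eigenfunction of $\lambda_n(\gamma,K)$, $n\in\mathbb N_0$. Then the number of zeros of $\mathrm{Re}\,\psi_n$ on the interval $[a,b)$ is $0$ or $1$ if $n=0$, and is $n-1$, $n$ or $n+1$ if $n\ge1$. The same claim holds for $\mathrm{Im}\,\psi_n$. Moreover, $\psi_n$ has no zeros on $[a,b]$.
   Context: Let $J=(a,b)$ with $-\infty<a<b<\infty$, and let $p,q,r,s$ be real-valued functions on $J$ with $1/p,q,r,s\in L^1(J,\mathbb R)$, $p>0$ and $r>0$ a.e. on $J$. Put $y^{[1]}=p(y'+sy)$ and $Y=(y,y^{[1]})^T$. The equation is $-(y^{[1]})'+sy^{[1]}+qy=\lambda ry$ on $J$, with solutions $y$ such that $y,y^{[1]}$ are absolutely continuous on $[a,b]$. Let $\lambda_n(K)$ denote the $n$-th eigenvalue of this equation with the boundary condition $Y(b)=KY(a)$ and $\lambda_n(\gamma,K)$ the $n$-th eigenvalue with $Y(b)=e^{i\gamma}KY(a)$; an eigenfunction is a nontrivial solution satisfying the boundary condition. In each case the eigenvalues are real and, counted with multiplicity, are ordered as a non-decreasing sequence indexed by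 $n\in\mathbb N_0=\{0,1,2,\ldots\}$ tending to $+\infty$. *)

(* Defs.v *)
From HB Require Import structures.
From mathcomp Require Import all_boot all_order all_algebra.
From mathcomp Require Export complex.
From mathcomp Require Import all_classical all_reals all_analysis.

Set Implicit Arguments.
Unset Strict Implicit.
Unset Printing Implicit Defensive.

Import Order.TTheory GRing.Theory Num.Theory.
Import numFieldNormedType.Exports.

Local Open Scope classical_set_scope.
Local Open Scope ring_scope.
Local Open Scope complex_scope.

(* Membership of [f] in L^1(D, R), [f] being taken up to null sets: it agrees
   almost everywhere on [D] with a Borel-measurable integrable function, so
   that [f] itself need only be Lebesgue measurable. *)
Definition in_L1 (R : realType) (D : set R) (f : R -> R) : Prop :=
  exists2 g : R -> R,
    (@lebesgue_measure R).-integrable D (EFin \o g) &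
    {ae @lebesgue_measure R, forall x, D x -> f x = g x}.

Definition abs_continuous (R : realType) (a b : R) (f : R -> R) : Prop :=
  forall e : R, 0 < e -> exists2 d : R, 0 < d &
    forall (n : nat) (u v : 'I_n -> R),
      (forall i, [/\ a <= u i, u i <= v i & v i <= b]) ->
      trivIset setT (fun i => `]u i, v i[%classic) ->
      \sum_(i < n) (v i - u i) < d ->
      \sum_(i < n) `|f (v i) - f (u i)| < e.

Definition cabs_continuous (R : realType) (a b : R) (f : R -> R[i]) : Prop :=
  abs_continuous a b (fun x => complex.Re (f x)) /\
  abs_continuous a b (fun x => complex.Im (f x)).

(* Differentiability, with derivative [df], of a complex-valued function of a
   real variable. *)
Definition is_cderive (R : realType) (x : R) (f : R -> R[i]) (df : R[i]) :
    Prop :=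
  is_derive x (1 : R) (fun t => complex.Re (f t) : R) (complex.Re df) /\
  is_derive x (1 : R) (fun t => complex.Im (f t) : R) (complex.Im df).

Definition cexpi (R : realType) (t : R) : R[i] := cos t +i* sin t.

Section SturmLiouville.
Context (R : realType) (a b : R) (p q r s : R -> R).

(* [y1] is y^[1] = p (y' + s y), which is determined almost everywhere only:
   the absolutely continuous representative has to be carried along, as its
   values at [a] and [b] enter the boundary condition. *)
Definition sl_solution (z : R[i]) (y y1 : R -> R[i]) : Prop :=
  [/\ cabs_continuous a b y,
      cabs_continuous a b y1,
      {ae @lebesgue_measure R, forall x, `]a, b[%classic x ->
        exists2 dy, is_cderive x y dy &
          y1 x = (p x)%:C * (dy + (s x)%:C * y x)} &
      {ae @lebesgue_measure R, forall x, `]a, b[%classic x ->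
        exists2 dy1, is_cderive x y1 dy1 &
          - dy1 + (s x)%:C * y1 x + (q x)%:C * y x = z * (r x)%:C * y x}].

Definition sl_vec (y y1 : R -> R[i]) (x : R) : 'cV[R[i]]_2 :=
  \col_(i < 2) (if i == 0 then y x else y1 x).

(* The zero function is included; functions on [R] matter through their values
   on [[a, b]] only. *)
Definition sl_eigenspace (M : 'M[R[i]]_2) (z : R[i]) (y : R -> R[i]) : Prop :=
  exists2 y1, sl_solution z y y1 & sl_vec y y1 b = M *m sl_vec y y1 a.

Definition eigenfunction (M : 'M[R[i]]_2) (z : R[i]) (y : R -> R[i]) : Prop :=
  sl_eigenspace M z y /\ exists2 x, `[a, b]%classic x & y x != 0.

(* The eigenspace, as a complex vector space of functions on [[a, b]], has
   dimension [k]. *)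
Definition multiplicity (M : 'M[R[i]]_2) (z : R[i]) (k : nat) : Prop :=
  exists e : 'I_k -> R -> R[i],
  [/\ forall i, sl_eigenspace M z (e i),
      forall c : 'I_k -> R[i],
        (forall x, `[a, b]%classic x -> \sum_(i < k) c i * e i x = 0) ->
        forall i, c i = 0 &
      forall y, sl_eigenspace M z y -> exists c : 'I_k -> R[i],
        forall x, `[a, b]%classic x -> y x = \sum_(i < k) c i * e i x].

(* [lam] lists all eigenvalues of the problem Y(b) = M Y(a) in non-decreasing
   order, each one as many times as its multiplicity. Letting [z] range over
   the complex numbers says in particular that all eigenvalues are real. These
   conditions determine [lam n], the n-th eigenvalue. *)
Definition eigenvalue_sequence (M : 'M[R[i]]_2) (lam : nat -> R) : Prop :=
  [/\ nondecreasing_seq lam,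
      lam n @[n --> \oo] --> +oo &
      forall z : R[i], exists2 k, multiplicity M z k &
        ([set n | (lam n)%:C = z] #= `I_k)%card].

End SturmLiouville.

Definition cmatrix (R : realType) (K : 'M[R]_2) : 'M[R[i]]_2 :=
  map_mx (fun x : R => x%:C) K.

Definition zeros_number (R : realType) (D : set R) (f : R -> R) (m : nat) :
    Prop :=
  ([set x | D x /\ f x = 0] #= `I_m)%card.

Definition zeros_count_claim (R : realType) (a b : R) (f : R -> R) (n : nat) :
    Prop :=
  exists2 m, zeros_number `[a, b[%classic f m &
    (n = 0%N -> m = 0%N \/ m = 1%N) /\
    ((1 <= n)%N -> [\/ m = n.-1, m = n | m = n.+1]).

(* Main.v *)
(* In Prüfer coordinates y = rho sin theta, y^[1] = rho cos theta the angle obeys a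
   scalar Carathéodory equation, theta' = cos^2 theta / p - 2 s sin theta cos theta
   - (q - lam r) sin^2 theta. Let F(lam, al) be its value at b when it starts
   from al at a. It increases strictly with al and with lam, and since theta can
   cross multiples of pi only upwards, F determines the number of zeros of every
   real solution. The matrix K moves the direction al to an angle kap(al); put
   Delta(lam, al) = F(lam, al) - kap(al). If Phi is the fundamental matrix at b,
   sin Delta has the sign of a quadratic form of discriminant D(lam)^2 - 4, where
   D = tr (K^-1 Phi). At an eigenvalue D = 2 cos gamma, so the form is
   semidefinite and Delta(lam, .) stays within one interval [n pi, (n + 1) pi].
   Call lam of class n in this case; it is of two classes n and n + 1 exactly when
   Phi is a multiple of K, i.e. when the eigenvalue is double.
   For eigenvalues lam < mu, the matrix Phi(lam)^-1 Phi(mu) up to conjugation has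
   trace at least 2, hence a positive eigenvalue, and strict monotonicity of F
   then puts mu in a higher class. Conversely, every class below an occupied one is
   occupied, by two applications of the intermediate value theorem, to the minimum
   of Delta and to D. So lam_n has class n, which confines F to
   (n pi - pi, n pi + 2 pi] and leaves n - 1, n or n + 1 zeros.
   Part (a) is the case gamma = 0. If gamma is not a multiple of pi, no nonzero
   multiple of a real vector satisfies the boundary condition, which makes Re psi
   and Im psi nontrivial and, by constancy of the Wronskian, excludes a common
   zero. *)

Require Import Defs.
From HB Require Import structures.
From mathcomp Require Import all_boot all_order all_algebra.
From mathcomp Require Import ring lra zify.
From mathcomp Require Import all_classical all_reals all_analysis.
From mathcomp Require Import measurable_realfun.

Set Implicit Arguments.
Unset Strict Implicit.
Unset Printing Implicit Defensive.

Import Order.TTheory GRing.Theory Num.Theory.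
Import numFieldNormedType.Exports.

Local Open Scope classical_set_scope.
Local Open Scope ring_scope.
Local Open Scope complex_scope.

(** * Absolute continuity and almost everywhere derivatives *)

(** The coefficients are merely integrable, so every differential relation holds only almost
    everywhere. Comparison arguments survive because an absolutely continuous function with
    nonnegative derivative almost everywhere is nondecreasing; this is applied after multiplication
    by the exponential of plus or minus a primitive of the Lipschitz constant of the Prüfer
    equation. The numbering of the classes rests on one normalization: the lift [kap] of the action
    of [K] on directions has [kap 0] in (-pi, 0], hence stays in (-pi, pi] on [0, pi]. Then
    [Delta lam 0] is always positive, so classes are natural numbers, and for some very negative
    [lam] the function [Delta lam] dips below 0 while staying below pi, so that the descent reaches
    class 0. The lift sees [K] only up to sign; the sign is kept in the factor [k], which decides
    whether a contact of [Delta] with [n pi] forces trace at least 2 or at most -2. Two parameters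
    cannot share a class because a positive eigenvalue provides a direction along which the two
    angles at [b] differ by a nonzero multiple of 2 pi, whereas a class has width pi. *)

Section absolute_continuity.
Context {R : realType}.
Implicit Types (c d x y e : R) (f g u v : R -> R).

Lemma ac_subitv a b c d f : a <= c -> d <= b ->
  abs_continuous a b f -> abs_continuous c d f.
Proof.
move=> ac db acf e /acf[dl dl0 h]; exists dl => // n u v uv tr s.
by apply: h => // i; case: (uv i) => cu uvi vd; split=> //; lra.
Qed.

(** Common source of the closure properties below. Two dominating functions are allowed because the
    increment of a product involves the increments of both factors. *)
Lemma ac_dom c d f u v (C : R) :
  abs_continuous c d u -> abs_continuous c d v ->
  (forall x y, c <= x -> x <= y -> y <= d ->
    `|f y - f x| <= C * (`|u y - u x| + `|v y - v x|)) ->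
  abs_continuous c d f.
Proof.
move=> acu acv H e e0.
pose B := `|C| + 1; have B0 : 0 < B by rewrite /B; have := normr_ge0 C; lra.
have eB0 : 0 < e / 2 / B by rewrite !divr_gt0.
have [d1 d10 h1] := acu _ eB0; have [d2 d20 h2] := acv _ eB0.
exists (Num.min d1 d2); first by rewrite lt_min d10.
move=> n p q pq tr; rewrite lt_min => /andP[s1 s2].
have {}h1 := h1 _ _ _ pq tr s1; have {}h2 := h2 _ _ _ pq tr s2.
apply: (@le_lt_trans _ _ (\sum_(i < n) B * (`|u (q i) - u (p i)| +
    `|v (q i) - v (p i)|))).
  apply: ler_sum => i _; case: (pq i) => ? ? ?.
  apply: (le_trans (H _ _ _ _ _)) => //; apply: ler_wpM2r.
    by rewrite addr_ge0.
  by rewrite /B; have := ler_norm C; lra.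
rewrite -mulr_sumr big_split/=.
have -> : e = B * (e / 2 / B + e / 2 / B).
  by field; rewrite gt_eqF.
by rewrite ltr_pM2l// ltrD.
Qed.

Lemma ac_id c d : abs_continuous c d (@id R).
Proof.
move=> e e0; exists e => // n u v uv _ s.
rewrite (eq_bigr (fun i => v i - u i))// => i _.
by case: (uv i) => ? ? ?; rewrite ger0_norm// subr_ge0.
Qed.

Lemma ac_cst c d k : abs_continuous c d (fun=> k : R).
Proof.
apply: (@ac_dom _ _ _ id id 0); [exact: ac_id|exact: ac_id|].
by move=> x y _ _ _; rewrite subrr normr0 mul0r.
Qed.

Lemma acD c d f g : abs_continuous c d f -> abs_continuous c d g ->
  abs_continuous c d (fun x => f x + g x).
Proof.
move=> acf acg; apply: (ac_dom (C := 1) acf acg) => x y _ _ _.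
rewrite mul1r; have -> : f y + g y - (f x + g x) = f y - f x + (g y - g x) by ring.
exact: ler_normD.
Qed.

Lemma acZ c d f k : abs_continuous c d f -> abs_continuous c d (fun x => k * f x).
Proof.
move=> acf; apply: (ac_dom (C := `|k|) acf acf) => x y _ _ _.
by rewrite -mulrBr normrM ler_wpM2l// lerDl.
Qed.

Lemma ac_unif c d f : abs_continuous c d f -> forall e, 0 < e ->
  exists2 dl : R, 0 < dl & forall x y, c <= x <= d -> c <= y <= d ->
    `|y - x| < dl -> `|f y - f x| < e.
Proof.
move=> acf e e0; have [dl dl0 h] := acf _ e0; exists dl => // x y cxd cyd.
wlog xy : x y cxd cyd / x <= y => [W|].
  have [xy|/ltW yx] := leP x y; first exact: W.
  by rewrite (distrC y) (distrC (f y)); apply: W.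
rewrite ger0_norm ?subr_ge0// => yx.
have := h 1%N (fun=> x) (fun=> y); rewrite !big_ord1; apply => //.
- by move=> _; split=> //; lra.
- by apply/trivIsetP => i j _ _; rewrite (ord1 i) (ord1 j) eqxx.
Qed.

Lemma ac_continuous c d f : abs_continuous c d f ->
  {within `[c, d], continuous f}.
Proof.
move=> acf; apply/subspace_continuousP => x /=; rewrite in_itv/= => cxd.
apply/cvgrPdist_lt => e e0; have [dl dl0 h] := ac_unif acf e0.
rewrite near_withinE; near=> y; rewrite /= in_itv/= => cyd.
apply: h => //.
Unshelve. all: by end_near. Qed.

Lemma ac_bounded c d f : abs_continuous c d f ->
  exists2 M, 0 <= M & forall x, c <= x <= d -> `|f x| <= M.
Proof.
move=> acf; have [cd|dc] := leP c d; last first.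
  by exists 0 => // x cxd; exfalso; lra.
have [x1 _ h1] := EVT_max cd (ac_continuous acf).
have [x2 _ h2] := EVT_min cd (ac_continuous acf).
exists (`|f x1| + `|f x2|); first by rewrite addr_ge0.
move=> x cxd.
have := h1 x; rewrite in_itv/= => /(_ cxd).
have := h2 x; rewrite in_itv/= => /(_ cxd).
have := ler_norm (f x1); have := ler_norm (- f x2); rewrite normrN.
have := normr_ge0 (f x1); have := normr_ge0 (f x2).
by rewrite ler_norml; lra.
Qed.

Lemma acM c d f g : abs_continuous c d f -> abs_continuous c d g ->
  abs_continuous c d (fun x => f x * g x).
Proof.
move=> acf acg.
have [M M0 hM] := ac_bounded acf; have [N N0 hN] := ac_bounded acg.
apply: (ac_dom (C := M + N) acf acg) => x y cx xy yd.
have -> : f y * g y - f x * g x = (f y - f x) * g y + f x * (g y - g x) by ring.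
apply: (le_trans (ler_normD _ _)); rewrite !normrM.
have gy : `|g y| <= N by apply: hN; lra.
have fx : `|f x| <= M by apply: hM; lra.
have := normr_ge0 (f y - f x); have := normr_ge0 (g y - g x).
nra.
Qed.

(** The range of [f] is bounded, so the bound on [phi'] makes [phi] Lipschitz there by the mean
    value theorem. *)
Lemma ac_comp c d f (phi phi' : R -> R) : abs_continuous c d f ->
  (forall x, is_derive x 1 phi (phi' x)) ->
  (forall M : R, exists C : R, forall x, `|x| <= M -> `|phi' x| <= C) ->
  abs_continuous c d (fun x => phi (f x)).
Proof.
move=> acf dphi bphi.
have [M M0 hM] := ac_bounded acf; have [C hC] := bphi M.
have lip s t : `|s| <= M -> `|t| <= M -> `|phi t - phi s| <= C * `|t - s|.
  wlog st : s t / s <= t => [W hs ht|hs ht].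
    have [/W|/ltW /W h] := leP s t; first exact.
    by rewrite (distrC (phi t)) (distrC t); apply: h.
  have dd z : z \in `]s, t[ -> is_derive z 1 phi (phi' z) by [].
  have cc : {within `[s, t], continuous phi}.
    apply: continuous_subspaceT => x; apply: differentiable_continuous.
    by apply/derivable1_diffP; case: (dphi x).
  have [z] := MVT_segment st dd cc.
  rewrite in_itv/= => szt ->; rewrite normrM ler_wpM2r//; apply: hC.
  by move: hs ht; rewrite !ler_norml; lra.
apply: (ac_dom (C := C) acf acf) => x y cx xy yd.
have fx : `|f x| <= M by apply: hM; lra.
have fy : `|f y| <= M by apply: hM; lra.
apply: (le_trans (lip _ _ fx fy)).
have C0 : 0 <= C by apply: le_trans (hC 0 _) => //; rewrite normr0.
by rewrite ler_wpM2l// lerDl.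
Qed.

End absolute_continuity.

(** * Monotonicity from the sign of the derivative *)

Section monotonicity.
Context {R : realType}.
Implicit Types (c d x y e : R) (f g u v : R -> R).

Local Notation mu := (@lebesgue_measure R).

Let le_mu (A B : set R) : measurable A -> measurable B -> A `<=` B ->
  (mu A <= mu B)%E.
Proof. by move=> mA mB AB; exact: (le_measure mu (mem_set mA) (mem_set mB)). Qed.

Lemma is_derive_approx f x (l : R) : is_derive x 1 f l -> forall e, 0 < e ->
  exists2 eta, 0 < eta &
    forall y, `|y - x| < eta -> `|f y - f x - l * (y - x)| <= e * `|y - x|.
Proof.
move=> [df fl] e e0.
have : h^-1 *: ((f \o shift x) (h *: (1 : R)) - f x) @[h --> 0^'] --> l.
  by rewrite -fl; exact: df.
move/cvgrPdist_lt/(_ _ e0); rewrite near_withinE.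
case/nbhs_ballP => eta /= eta0 H; exists eta => // y yx.
have [->|yNx] := eqVneq y x; first by rewrite !subrr mulr0 subrr normr0 mulr0.
have h0 : y - x != 0 by rewrite subr_eq0.
have := H (y - x); rewrite /ball/= sub0r normrN => /(_ yx h0).
rewrite [_ *: 1]mulr1 subrK => H1.
have -> : f y - f x - l * (y - x) = - (l - (y - x)^-1 *: (f y - f x)) * (y - x).
  by rewrite /GRing.scale/=; field.
by rewrite normrM normrN ler_wpM2r// ltW.
Qed.

(* Cousin's lemma: a chain of small intervals leads from [c] to [d]; those around
   a point with [f' >= 0] cost [- e * length], the others lie in an open set of
   small measure, where absolute continuity bounds their total cost. *)
Lemma ac_le c d f : c <= d -> abs_continuous c d f ->
  {ae mu, forall x, c < x < d -> exists2 l, 0 <= l & is_derive x 1 f l} ->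
  f c <= f d.
Proof.
move=> cd acf [A [mA A0 sA]].
apply/ler_addgt0Pr => e' e'0.
(* The loss is [e] per unit length on good intervals plus [e] in total on the exceptional set, which
   adds up to [e']. *)
pose e := e' / (d - c + 1).
have dc1 : 0 < d - c + 1 by lra.
have e0 : 0 < e by rewrite divr_gt0.
have ee : e * (d - c) + e = e' by rewrite /e; field; rewrite gt_eqF.
have [dl dl0 H] := acf _ e0.
(* The end points join the exceptional set, since no derivative is assumed there. *)
pose B := A `|` ([set c] `|` [set d]).
have mB : measurable B by apply: measurableU => //; apply: measurableU.
have B0 : mu B = 0%E.
  apply: null_set_setU => //; first exact: measurableU.
  by apply: null_set_setU => //; exact: lebesgue_measure_set1.
have [|U [oU BU]] := lebesgue_regularity_outer mB _ dl0; first by rewrite [X in (X < _)%E]B0 ltry.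
have mU : measurable U by exact: open_measurable.
move=> UB; have {UB}Udl : (mu U < dl%:E)%E.
  apply: le_lt_trans UB.
  have mUB : measurable (U `\` B) by exact: measurableD.
  rewrite -[X in (mu X <= _)%E](setDUK BU).
  apply: (le_trans (measureU2 mu mB mUB)).
  by rewrite [X in (X + _)%E](_ : _ = 0%E) ?add0e.
pose m x := fine (mu (U `&` `]c, x])).
have mUi x : measurable (U `&` `]c, x]) by exact: measurableI.
have mfin x : mu (U `&` `]c, x]) \is a fin_num.
  rewrite ge0_fin_numE//; apply: le_lt_trans (lt_trans Udl (ltry _)).
  by apply: le_mu => //; apply: subIsetl.
have m_mono x y : x <= y -> m x <= m y.
  move=> xy; rewrite fine_le//; apply: le_mu => //.
  apply: setIS => z/=; rewrite !in_itv/= => /andP[->/=] zx; lra.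
have m_step x y : c <= x -> x <= y -> `]x, y] `<=` U -> m x + (y - x) <= m y.
  move=> cx xy sU; rewrite -lee_fin EFinD !fineK//.
  have -> : (y - x)%:E = mu `]x, y].
    by rewrite lebesgue_measure_itv/= lte_fin; case: ltP => // ?; congr _%:E; lra.
  rewrite -(measureU mu (mUi x) (measurable_itv `]x, y])); last first.
    rewrite -subset0 => z/= [[_]]; rewrite !in_itv/=; lra.
  apply: le_mu => //; first exact: measurableU.
  move=> z/= [[Uz]|]; rewrite !in_itv/= => zx.
    by split=> //; lra.
  by split; [apply: sU; rewrite /= in_itv|lra].
(* The finite family collects the intervals of the chain that lie in [U]; bounding its total length
   by [m x] keeps it below [dl]. *)
pose Good x := c <= x <= d /\ exists n (u v : 'I_n -> R),
  [/\ forall i, [/\ c <= u i, u i <= v i & v i <= x],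
      trivIset setT (fun i => `]u i, v i[%classic),
      \sum_(i < n) (v i - u i) <= m x &
      f c - e * (x - c) - \sum_(i < n) `|f (v i) - f (u i)| <= f x].
have step x y : Good x -> x <= y -> y <= d ->
    `]x, y] `<=` U \/ f x - e * (y - x) <= f y -> Good y.
  move=> [cxd [n [u [v [uv tr sm fx]]]]] xy yd [sU|fxy]; split; try by lra.
    exists n.+1, (fun i => if unlift ord_max i is Some j then u j else x),
                 (fun i => if unlift ord_max i is Some j then v j else y).
    split.
    - move=> i; case: unliftP => [j _|_]; last by split; lra.
      by have [? ? ?] := uv j; split; lra.
    - apply/trivIsetP => i j _ _ ij.
      move/trivIsetP : tr => tr.
      case: unliftP => [i'|] Ei; case: unliftP => [j'|] Ej.
      + by apply: tr => //; apply: contra ij; rewrite Ei Ej => /eqP ->.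
      + rewrite -subset0 => z/=; rewrite !in_itv/=.
        by have [? ? ?] := uv i'; lra.
      + rewrite -subset0 => z/=; rewrite !in_itv/=.
        by have [? ? ?] := uv j'; lra.
      + by rewrite Ei Ej eqxx in ij.
    - rewrite big_ord_recr/= unlift_none.
      under eq_bigr => i _.
        have -> : widen_ord (leqnSn n) i = lift ord_max i.
          by apply: val_inj; rewrite /= /bump leqNgt ltn_ord.
        rewrite liftK; over.
      by have := m_step x y; case/andP: cxd => cx _ /(_ cx xy sU); lra.
    - rewrite big_ord_recr/= unlift_none.
      under eq_bigr => i _.
        have -> : widen_ord (leqnSn n) i = lift ord_max i.
          by apply: val_inj; rewrite /= /bump leqNgt ltn_ord.
        rewrite liftK; over.
      have := ler_norm (- (f y - f x)); rewrite normrN.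
      have : 0 <= e * (y - x) by rewrite mulr_ge0 ?subr_ge0// ltW.
      move: fx; rewrite !mulrBr; lra.
  exists n, u, v; split=> //.
  - by move=> i; have [? ? ?] := uv i; split; lra.
  - exact: le_trans (m_mono _ _ xy).
  - move: fx fxy; rewrite !mulrBr; lra.
have Gc : Good c.
  split; first by rewrite lexx.
  exists 0%N, (fun=> 0), (fun=> 0); split.
  - by case.
  - by apply/trivIsetP => -[].
  - by rewrite big_ord0 fine_ge0.
  - by rewrite big_ord0 subrr mulr0 !subr0.
have supG : has_sup [set x | Good x].
  by split; [exists c|exists d => x [/andP[]]].
pose t := sup [set x | Good x].
have ct : c <= t by apply: sup_upper_bound.
have td : t <= d by apply: ge_sup; [exists c|move=> x [/andP[]]].
have [eta eta0 loc] : exists2 eta, 0 < eta & forall x y, t - eta < x -> x <= t ->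
    t <= y -> y < t + eta -> c <= x -> y <= d ->
    `]x, y] `<=` U \/ f x - e * (y - x) <= f y.
  have [Ut|NUt] := pselect (U t).
    move: oU; rewrite openE => /(_ _ Ut)/nbhs_ballP[eta/= eta0 Ueta].
    exists eta => // x y tx xt ty yt _ _; left => z/=; rewrite in_itv/= => xzy.
    by apply: Ueta; rewrite /ball/= ltr_norml; lra.
  have tc : t != c by apply: contra_notN NUt => /eqP ->; apply: BU; right; left.
  have tNd : t != d by apply: contra_notN NUt => /eqP ->; apply: BU; right; right.
  have ctd : c < t < d by rewrite !lt_neqAle eq_sym tc ct tNd td.
  have [l l0 dfl] : exists2 l, 0 <= l & is_derive t 1 f l.
    apply: contrapT => abs; apply: NUt; apply: BU; left; apply: sA => /= /(_ ctd).
    exact: abs.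
  have [eta eta0 H1] := is_derive_approx dfl e0.
  exists eta => // x y tx xt ty yt _ _; right.
  have := H1 x; rewrite distrC ger0_norm ?subr_ge0// => /(_ ltac:(lra)).
  have := H1 y; rewrite [`|y - t|]ger0_norm ?subr_ge0// => /(_ ltac:(lra)).
  rewrite !ler_norml => /andP[+ _] /andP[_].
  have : 0 <= l * (y - t) by rewrite mulr_ge0 ?subr_ge0.
  have : 0 <= l * (t - x) by rewrite mulr_ge0 ?subr_ge0.
  by rewrite !mulrBr; lra.
have [_ /(_ _ eta0)] := conj supG (fun eps h => @sup_adherent R _ eps h supG).
case=> x /= Gx; rewrite -/t => tx.
have xt : x <= t by apply: sup_upper_bound.
have cx : c <= x by case: Gx => /andP[].
pose y := Num.min d (t + eta / 2).
have yd : y <= d by rewrite ge_min lexx.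
have ty : t <= y by rewrite le_min td; lra.
have yt : y < t + eta by rewrite gt_min; apply/orP; right; lra.
have Gy : Good y by apply: (step x) => //; [lra|exact: loc].
have yt' : y <= t by apply: sup_upper_bound.
have yE : y = d by move: ty yt'; rewrite /y /Num.min; case: ifPn => // _; lra.
move: Gy; rewrite yE => -[_ [n [u [v [uv tr sm fx]]]]].
have {}H : \sum_(i < n) `|f (v i) - f (u i)| < e.
  apply: H => //; apply: le_lt_trans sm _.
  rewrite -lte_fin fineK//; apply: le_lt_trans Udl.
  by apply: le_mu => //; apply: subIsetl.
lra.
Qed.

End monotonicity.

(** * Calculus of absolutely continuous primitives *)

Section derivative_calculus.
Context {R : realType}.
Implicit Types (a b c d x y e : R) (f g h u v : R -> R) (P Q S : R -> Prop).

Local Notation mu := (@lebesgue_measure R).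

Definition ae P : Prop := {ae mu, forall x, P x}.

Definition acd c d f g := abs_continuous c d f /\
  ae (fun x => c < x < d -> is_derive x 1 f (g x)).

Definition L1 c d g := mu.-integrable `]c, d[ (EFin \o g).

Lemma ae1 P Q : (forall x, P x -> Q x) -> ae P -> ae Q.
Proof. by exact: (@filterS _ _ (ae_filter_ringOfSetsType mu)). Qed.

Lemma ae2 P Q S : (forall x, P x -> Q x -> S x) -> ae P -> ae Q -> ae S.
Proof.
move=> PQS; exact: (@filterS2 _ _ (ae_filter_ringOfSetsType mu) _ _ _ PQS).
Qed.

Lemma ae_and P Q : ae P -> ae Q ->
  ae (fun x => P x /\ Q x).
Proof. exact: ae2. Qed.

Lemma ae_true P : (forall x, P x) -> ae P.
Proof.
move=> aP; have := @filterT _ _ (ae_filter_ringOfSetsType mu).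
by apply: (@filterS _ _ (ae_filter_ringOfSetsType mu)) => x _; exact: aP.
Qed.

Lemma ae_itv_ex c d P : c < d -> ae (fun x => c < x < d -> P x) ->
  exists2 x, c < x < d & P x.
Proof.
move=> cd [N [mN N0 sN]]; apply: contrapT => nP.
have : (mu `]c, d[ <= mu N)%E.
  apply: (le_measure mu (mem_set (measurable_itv `]c, d[)) (mem_set mN)) => x/=.
  rewrite in_itv/= => cxd; apply: sN => /= H; apply: nP.
  by exists x => //; exact: H.
rewrite [X in (_ <= X)%E]N0 lebesgue_measure_itv/= lte_fin cd -EFinB lee_fin.
lra.
Qed.

Lemma acd_sub a b c d f g : a <= c -> d <= b -> acd a b f g -> acd c d f g.
Proof.
move=> ac db [acf df]; split; first exact: ac_subitv acf.
by apply: ae1 df => x H cxd; apply: H; lra.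
Qed.

Lemma acd_eq c d f g h : acd c d f g ->
  ae (fun x => c < x < d -> g x = h x) -> acd c d f h.
Proof.
move=> [acf df] gh; split => //.
by apply: ae2 df gh => x H E cxd; rewrite -E//; exact: H.
Qed.

Lemma acd_cst c d k : acd c d (fun=> k) (fun=> 0).
Proof. by split; [exact: ac_cst|apply: ae_true => x _; exact: is_derive_cst]. Qed.

Lemma acd_id c d : acd c d id (fun=> 1).
Proof. by split; [exact: ac_id|apply: ae_true => x _; exact: is_derive_id]. Qed.

Lemma acdD c d f g u v : acd c d f u -> acd c d g v ->
  acd c d (fun x => f x + g x) (fun x => u x + v x).
Proof.
move=> [acf df] [acg dg]; split; first exact: acD.
by apply: ae2 df dg => x Hf Hg cxd; apply: is_deriveD; [exact: Hf|exact: Hg].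
Qed.

Lemma acdZ c d f u k : acd c d f u ->
  acd c d (fun x => k * f x) (fun x => k * u x).
Proof.
move=> [acf df]; split; first exact: acZ.
by apply: ae1 df => x Hf cxd; apply: is_deriveZ; exact: Hf.
Qed.

Lemma acdN c d f u : acd c d f u -> acd c d (fun x => - f x) (fun x => - u x).
Proof.
move=> /(acdZ (-1)) H.
have E (w : R -> R) : (fun x => - w x) = (fun x => -1 * w x).
  by apply: funext => x; rewrite mulN1r.
by rewrite (E f) (E u).
Qed.

Lemma acdB c d f g u v : acd c d f u -> acd c d g v ->
  acd c d (fun x => f x - g x) (fun x => u x - v x).
Proof. by move=> Hf /acdN; exact: acdD. Qed.

Lemma acdM c d f g u v : acd c d f u -> acd c d g v ->
  acd c d (fun x => f x * g x) (fun x => f x * v x + u x * g x).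
Proof.
move=> [acf df] [acg dg]; split; first exact: acM.
apply: ae2 df dg => x Hf Hg cxd.
rewrite (mulrC (u x)).
by have := is_deriveM (Hf cxd) (Hg cxd).
Qed.

Lemma acd_comp c d f u (phi phi' : R -> R) : acd c d f u ->
  (forall x, is_derive x 1 phi (phi' x)) ->
  (forall M : R, exists C : R, forall x, `|x| <= M -> `|phi' x| <= C) ->
  acd c d (fun x => phi (f x)) (fun x => phi' (f x) * u x).
Proof.
move=> [acf df] dphi bphi; split; first exact: ac_comp bphi.
apply: ae1 df => x Hf cxd.
exact: (is_derive1_comp (dphi _) (Hf cxd)).
Qed.

Lemma acd_sin c d f u : acd c d f u ->
  acd c d (fun x => sin (f x)) (fun x => cos (f x) * u x).
Proof.
move=> H; apply: (acd_comp H) => M; exists 1 => x _.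
by rewrite ler_norml cos_geN1 cos_le1.
Qed.

Lemma acd_cos c d f u : acd c d f u ->
  acd c d (fun x => cos (f x)) (fun x => - sin (f x) * u x).
Proof.
move=> H; apply: (acd_comp (phi' := fun x => - sin x) H) => M; exists 1 => x _.
by rewrite normrN ler_norml sin_geN1 sin_le1.
Qed.

Lemma acd_exp c d f u : acd c d f u ->
  acd c d (fun x => expR (f x)) (fun x => expR (f x) * u x).
Proof.
move=> H; apply: (acd_comp H) => M; exists (expR M) => x xM.
by rewrite gtr0_norm ?expR_gt0// ler_expR (le_trans (ler_norm _)).
Qed.

Lemma acd_le c d f g : acd c d f g ->
  ae (fun x => c < x < d -> 0 <= g x) ->
  forall x y, c <= x -> x <= y -> y <= d -> f x <= f y.
Proof.
move=> fg g0 x y cx xy yd; have [acf df] := acd_sub cx yd fg.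
apply: (ac_le xy acf); apply: ae2 df g0 => z H1 H2 xzy.
by exists (g z); [apply: H2; lra|exact: H1].
Qed.

(** Equality would make [f] constant between [x] and [y], yet an interval of positive length
    contains a point with positive derivative. *)
Lemma acd_lt c d f g : acd c d f g ->
  ae (fun x => c < x < d -> 0 < g x) ->
  forall x y, c <= x -> x < y -> y <= d -> f x < f y.
Proof.
move=> fg g0 x y cx xy yd.
have g0' : ae (fun x => c < x < d -> 0 <= g x).
  by apply: ae1 g0 => z H /H/ltW.
have f_le := acd_le fg g0'.
rewrite lt_neqAle f_le ?(ltW xy)// andbT; apply/eqP => fxy.
have [_ df] := acd_sub cx yd fg.
have [z xzy [dz gz]] : exists2 z, x < z < y & is_derive z 1 f (g z) /\ 0 < g z.
  apply: ae_itv_ex => //; apply: ae2 df g0 => z H1 H2 xzy.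
  by split; [exact: H1|apply: H2; lra].
have fcst t : x <= t <= y -> f t = f x.
  move=> /andP[xt ty]; apply/eqP; rewrite eq_le [X in _ && X]f_le//; last lra.
  by rewrite andbT fxy f_le//; lra.
have gz2 : 0 < g z / 2 by lra.
have [eta eta0 H] := is_derive_approx dz gz2.
pose t := Num.min y (z + eta / 2).
have zt : z < t by rewrite lt_min; apply/andP; split; lra.
have ty : t <= y by rewrite ge_min lexx.
have te : t < z + eta by rewrite gt_min; apply/orP; right; lra.
have := H t; rewrite [`|t - z|]gtr0_norm ?subr_gt0// => /(_ ltac:(lra)).
rewrite !fcst; [|lra|lra].
rewrite subrr sub0r normrN gtr0_norm ?mulr_gt0 ?subr_gt0//.
by rewrite ler_pM2r ?subr_gt0//; lra.
Qed.

Lemma acd_eq0 c d f g : acd c d f g ->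
  ae (fun x => c < x < d -> g x = 0) ->
  forall x, c <= x <= d -> f x = f c.
Proof.
move=> fg g0 x /andP[cx xd]; apply: le_anti; apply/andP; split.
  rewrite -lerN2; apply: (acd_le (acdN fg)) => //.
  by apply: ae1 g0 => z H /H ->; rewrite oppr0.
by apply: (acd_le fg) => //; apply: ae1 g0 => z H /H ->.
Qed.

Lemma acd_norm_le c d f g u v : acd c d f g -> acd c d u v ->
  ae (fun x => c < x < d -> `|g x| <= v x) ->
  forall x y, c <= x -> x <= y -> y <= d -> `|f y - f x| <= u y - u x.
Proof.
move=> fg uv gv x y cx xy yd; rewrite ler_norml; apply/andP; split.
  have := @acd_le c d _ _ (acdD uv fg) _ x y cx xy yd.
  suff H : ae (fun x => c < x < d -> 0 <= v x + g x) by move=> /(_ H); lra.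
  by apply: ae1 gv => z + czd => /(_ czd); rewrite ler_norml; lra.
have := @acd_le c d _ _ (acdB uv fg) _ x y cx xy yd.
suff H : ae (fun x => c < x < d -> 0 <= v x - g x) by move=> /(_ H); lra.
by apply: ae1 gv => z + czd => /(_ czd); rewrite ler_norml; lra.
Qed.

Lemma L1D c d f g : L1 c d f -> L1 c d g -> L1 c d (fun x => f x + g x).
Proof.
by move=> If Ig; exact: (@integrableD _ _ _ mu _ (measurable_itv _) _ _ If Ig).
Qed.

Lemma L1Z c d k f : L1 c d f -> L1 c d (fun x => k * f x).
Proof. by move=> If; exact: (@integrableZl _ _ _ mu _ (measurable_itv _) k _ If). Qed.

Lemma L1B c d f g : L1 c d f -> L1 c d g -> L1 c d (fun x => f x - g x).
Proof. by move=> If Ig; exact: (@integrableB _ _ _ mu _ (measurable_itv _) _ _ If Ig). Qed.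

Lemma L1_norm c d f : L1 c d f -> L1 c d (fun x => `|f x|).
Proof. by move=> If; exact: integrable_norm. Qed.

Lemma L1M c d f g : L1 c d f -> {within `[c, d], continuous g} ->
  L1 c d (fun x => f x * g x).
Proof.
move=> If cg; have [cd|dc] := leP c d; last first.
  by rewrite /L1 set_itv_ge ?bnd_simp -?leNgt ?ltW//; exact: integrable_set0.
have [x1 _ h1] := EVT_max cd cg; have [x2 _ h2] := EVT_min cd cg.
have sub : `]c, d[%classic `<=` `[c, d]%classic by apply: subset_itv_oo_cc.
apply: (@integrableMl _ _ _ mu _ (measurable_itv _) _ g If).
  apply: measurable_funS (measurable_itv `[c, d]) sub _.
  exact: subspace_continuous_measurable_fun.
exists (`|g x1| + `|g x2|); split; first exact: num_real.
move=> M gM x /sub /= cxd.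
have := h1 x cxd; have := h2 x cxd.
have := ler_norm (g x1); have := ler_norm (- g x2); rewrite normrN.
have := normr_ge0 (g x1); have := normr_ge0 (g x2).
by rewrite ler_norml; lra.
Qed.

(** The derivative comes from Lebesgue differentiation, absolute continuity of [G] from that of the
    integral of [|g|]. *)
Lemma acd_prim_int c d g : L1 c d g ->
  exists G, [/\ acd c d G g, G c = 0 & G d = \int[mu]_(t in `]c, d[) g t].
Proof.
move=> Ig.
(* Extension by zero makes the integrand integrable on the whole line, as the differentiation
   theorem wants it. *)
pose g' := g \_ `]c, d[.
have Ig' : mu.-integrable setT (EFin \o g').
  by rewrite -restrict_EFin -integrable_mkcond.
have IgS (A : set R) : measurable A -> mu.-integrable A (EFin \o g').
  by move=> mA; exact: integrableS Ig'.
pose G x := (\int[mu]_(t in `[c, x]) g' t)%R.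
exists G; split; last 2 first.
- by rewrite /G set_itv1 Rintegral_set1.
- transitivity (\int[mu]_(t in `]c, d[) g' t).
    rewrite /G -Rintegral_itv_bndo_bndc; last exact: IgS.
    by rewrite -Rintegral_itv_obnd_cbnd//; exact: IgS.
  by apply: eq_Rintegral => x xcd; rewrite /g' patchE xcd.
split; last first.
  have := @FTC1 R g' (BLeft c) (fun y => IgS _ (measurable_itv _)).
  have lg' : locally_integrable setT g' by exact: integrable_locally.
  move=> /(_ lg'); apply: ae1 => x H cxd.
  have [|dG GE] := H; first by rewrite lte_fin; lra.
  apply: DeriveDef => //; rewrite -derive1E GE /g' patchE mem_set//= in_itv.
move=> e e0.
have [dl [dl0 H]] := integral_normr_continuous Ig' e0.
exists dl => // n u v uv tr s.
pose D := \big[setU/set0]_(i < n) `]u i, v i[%classic.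
have mD : measurable D by apply: bigsetU_measurable => i _.
have muD : (mu D < dl%:E)%E.
  rewrite /D measure_bigsetU_ord//.
  rewrite (eq_bigr (fun i => (v i - u i)%:E)); last first.
    move=> i _; have [_ ui _] := uv i.
    suff : mu `]u i, v i[ = (v i - u i)%:E by [].
    by rewrite lebesgue_measure_itv/= lte_fin; case: ltP => // ?; congr _%:E; lra.
  by rewrite sumEFin lte_fin.
apply: le_lt_trans (H D mD muD).
have -> : \int[mu]_(x in D) `|g' x| =
    \sum_(i < n) \int[mu]_(x in `]u i, v i[) `|g' x|.
  rewrite /Rintegral /D integral_bigsetU_EFin//=.
  - rewrite sum_fine// => i _; apply: integrable_fin_num => //.
    by apply: integrable_norm; exact: IgS.
  - exact: index_enum_uniq.
  - exact: sub_trivIset tr.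
  - by apply: measurable_int; apply: integrable_norm; exact: IgS.
apply: ler_sum => i _; have [cu uvi vd] := uv i.
have -> : G (v i) - G (u i) = \int[mu]_(x in `]u i, v i[) g' x.
  rewrite /G Rintegral_itvB ?bnd_simp//; last exact: IgS.
  by rewrite Rintegral_itv_bndo_bndc//; exact: IgS.
by apply: le_normr_Rintegral => //; exact: IgS.
Qed.

Lemma acd_prim c d g : L1 c d g -> exists2 G, acd c d G g & G c = 0.
Proof. by case/acd_prim_int => G [? ? _]; exists G. Qed.

End derivative_calculus.

(** * The Prüfer equation *)

Section scalar_ode.
Context {R : realType}.
Implicit Types (a b c d x y e : R) (f g h u v w : R -> R).

Lemma unif_within_continuous c d f :
  (forall e, 0 < e -> exists2 dl : R, 0 < dl & forall x y,
    c <= x <= d -> c <= y <= d -> `|y - x| < dl -> `|f y - f x| < e) ->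
  {within `[c, d], continuous f}.
Proof.
move=> H; apply/subspace_continuousP => x /=; rewrite in_itv/= => cxd.
apply/cvgrPdist_lt => e e0; have [dl dl0 h] := H _ e0.
rewrite near_withinE; near=> y; rewrite /= in_itv/= => cyd.
by apply: h => //.
Unshelve. all: by end_near. Qed.

Lemma last_ge0 c d f : c <= d -> abs_continuous c d f -> 0 <= f c -> f d < 0 ->
  exists x0, [/\ c <= x0, x0 < d, 0 <= f x0 & forall x, x0 < x <= d -> f x < 0].
Proof.
move=> cd acf fc fd.
pose S := [set x | c <= x <= d /\ 0 <= f x].
have Sc : S c by rewrite /S/= lexx cd.
have supS : has_sup S by split; [exists c|exists d => x [/andP[]]].
pose t := sup S.
have ct : c <= t by apply: sup_upper_bound.
have td : t <= d by apply: ge_sup; [exists c|move=> x [/andP[]]].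
have ft : 0 <= f t.
  rewrite leNgt; apply/negP => ft.
  have [dl dl0 H] := ac_unif acf (ltac:(lra) : 0 < - f t).
  have [x [/andP[cx xd] fx] tx] := sup_adherent dl0 supS.
  have xt : x <= t by apply: (sup_upper_bound supS); split=> //; lra.
  have := H t x; rewrite ct td cx xd distrC ger0_norm ?subr_ge0//.
  by move=> /(_ isT isT ltac:(rewrite -/t in tx; lra)); rewrite ltr_norml; lra.
exists t; split=> //.
  by rewrite lt_neqAle td andbT; apply/eqP => E; move: ft; rewrite E; lra.
move=> x /andP[tx xd]; rewrite ltNge; apply/negP => fx.
have : x <= t by apply: (sup_upper_bound supS); split=> //; lra.
lra.
Qed.

(* Backward Gronwall: [delta] cannot cross zero downwards, because where it is
   negative [delta * expR (- P)] is nondecreasing. *)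
Lemma ac_ge0 c d f g (P L : R -> R) : acd c d f g -> acd c d P L ->
  ae (fun x => c < x < d -> - (L x * `|f x|) <= g x) -> 0 <= f c ->
  forall x, c <= x <= d -> 0 <= f x.
Proof.
move=> fg PL H fc x1 /andP[cx1 x1d]; rewrite leNgt; apply/negP => fx1.
have fg1 := acd_sub (lexx c) x1d fg.
have [x0 [cx0 x01 fx0 neg]] := last_ge0 cx1 fg1.1 fc fx1.
have fg' := acd_sub cx0 x1d fg; have PL' := acd_sub cx0 x1d PL.
have D := acdM fg' (acd_exp (acdN PL')).
have : f x0 * expR (- P x0) <= f x1 * expR (- P x1).
  apply: (acd_le D _ (lexx _) (ltW x01) (lexx _)).
  apply: ae1 H => z H xz.
  have fz : f z < 0 by apply: neg; lra.
  have := H ltac:(lra); rewrite ltr0_norm// => gz.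
  have -> : f z * (expR (- P z) * - L z) + g z * expR (- P z) =
    expR (- P z) * (g z - L z * f z) by ring.
  by rewrite mulr_ge0 ?expR_ge0//; lra.
have : 0 <= f x0 * expR (- P x0) by rewrite mulr_ge0 ?expR_ge0.
have : f x1 * expR (- P x1) < 0 by rewrite pmulr_llt0 ?expR_gt0.
lra.
Qed.

Lemma sin_lip x y : `|sin y - sin x| <= `|y - x|.
Proof.
wlog xy : x y / x <= y => [W|].
  by have [/W//|/ltW/W] := leP x y; rewrite (distrC y) (distrC (sin y)).
rewrite (ger0_norm (_ : 0 <= y - x)) ?subr_ge0//.
have D : acd x y sin (fun z => cos z * 1) by exact: acd_sin (acd_id _ _).
have := acd_norm_le D (acd_id x y) _ (lexx x) xy (lexx y); apply.
by apply: ae_true => z _; rewrite mulr1 ler_norml cos_geN1 cos_le1.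
Qed.

Lemma normr_sin_le x : `|sin x| <= `|x|.
Proof. by have := sin_lip 0 x; rewrite sin0 !subr0. Qed.

(* Right-hand side of the Prüfer equation of [-(y1)' + s y1 + Q y = 0],
   [y' = ip y1 - s y], for [y = rho sin th] and [y1 = rho cos th]. *)
Definition prf (ip s Q : R -> R) x (t : R) :=
  ip x * cos t ^+ 2 - 2 * s x * (sin t * cos t) - Q x * sin t ^+ 2.

(** Serves twice: as Lipschitz constant of [prf] in the angle and as a bound for its size. For
    integrable coefficients its primitive supplies the integrating factors. *)
Definition plip (ip s Q : R -> R) x := `|ip x| + 2 * `|s x| + `|Q x|.

Lemma plip_ge0 ip s Q x : 0 <= plip ip s Q x.
Proof. by rewrite !addr_ge0// mulr_ge0. Qed.

Lemma normr_cos_le1 x : `|cos x| <= 1.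
Proof. by rewrite ler_norml cos_geN1 cos_le1. Qed.

Lemma normr_sin_le1 x : `|sin x| <= 1.
Proof. by rewrite ler_norml sin_geN1 sin_le1. Qed.

Let lin3 (A B C p q r k : R) : 0 <= k -> `|p| <= k -> `|q| <= k -> `|r| <= k ->
  `|A * p - 2 * B * q - C * r| <= (`|A| + 2 * `|B| + `|C|) * k.
Proof.
move=> k0 pk qk rk.
apply: (le_trans (ler_normB _ _)); apply: (le_trans (lerD (ler_normB _ _) (lexx _))).
rewrite !normrM (ger0_norm (_ : 0 <= 2))// !mulrDl.
by rewrite !lerD// ler_wpM2l// mulr_ge0.
Qed.

(** The differences factor through one sine: [sin t ^+ 2 - sin u ^+ 2 = sin (t + u) * sin (t - u)]
    and [sin t * cos t - sin u * cos u = cos (t + u) * sin (t - u)]. *)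
Lemma prf_lip ip s Q x (t u : R) :
  `|prf ip s Q x t - prf ip s Q x u| <= plip ip s Q x * `|t - u|.
Proof.
have tr k : `|k| <= 1 -> `|k * sin (t - u)| <= `|t - u|.
  move=> k1; rewrite normrM (le_trans _ (normr_sin_le _))//.
  by rewrite ler_piMl.
have -> : prf ip s Q x t - prf ip s Q x u =
   ip x * (- sin (t + u) * sin (t - u)) - 2 * s x * (cos (t + u) * sin (t - u))
   - Q x * (sin (t + u) * sin (t - u)).
  rewrite (mulNr (sin (t + u))).
  have E1 : sin t ^+ 2 = 1 - cos t ^+ 2 by rewrite sin2cos2.
  have E2 : sin u ^+ 2 = 1 - cos u ^+ 2 by rewrite sin2cos2.
  have -> : sin (t + u) * sin (t - u) = sin t ^+ 2 - sin u ^+ 2.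
    rewrite sinB sinD.
    transitivity (sin t ^+ 2 * cos u ^+ 2 - cos t ^+ 2 * sin u ^+ 2); first ring.
    by rewrite E1 E2; ring.
  have -> : cos (t + u) * sin (t - u) = sin t * cos t - sin u * cos u.
    rewrite sinB cosD.
    transitivity (sin t * cos t * (sin u ^+ 2 + cos u ^+ 2)
      - sin u * cos u * (sin t ^+ 2 + cos t ^+ 2)); first ring.
    by rewrite E1 E2; ring.
  by rewrite /prf E1 E2; ring.
apply: lin3 => //; apply: tr; rewrite ?normrN;
  by [exact: normr_sin_le1|exact: normr_cos_le1].
Qed.

Lemma prf_norm ip s Q x t : `|prf ip s Q x t| <= plip ip s Q x.
Proof.
rewrite /prf /plip -[leRHS]mulr1; apply: lin3 => //.
- by rewrite normrX expr_le1// normr_cos_le1.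
- by rewrite normrM mulr_ile1 ?normr_sin_le1 ?normr_cos_le1.
- by rewrite normrX expr_le1// normr_sin_le1.
Qed.

Lemma within_continuous_comp_all c d f (phi : R -> R) :
  {within `[c, d], continuous f} -> continuous phi ->
  {within `[c, d], continuous (fun x => phi (f x))}.
Proof. by move=> cf cphi x; apply: continuous_comp; [exact: cf|exact: cphi]. Qed.

Lemma within_continuousM c d f g :
  {within `[c, d], continuous f} -> {within `[c, d], continuous g} ->
  {within `[c, d], continuous (fun x => f x * g x)}.
Proof. by move=> cf cg x; apply: continuousM; [exact: cf|exact: cg]. Qed.

Lemma L1_prf c d ip s Q (th : R -> R) : L1 c d ip -> L1 c d s -> L1 c d Q ->
  {within `[c, d], continuous th} -> L1 c d (fun x => prf ip s Q x (th x)).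
Proof.
move=> I1 I2 I3 cth.
have cs := within_continuous_comp_all cth (@continuous_sin R).
have cc := within_continuous_comp_all cth (@continuous_cos R).
apply: L1B; last first.
  by apply: (L1M I3); exact: (within_continuousM cs cs).
apply: L1B; first by apply: (L1M I1); exact: (within_continuousM cc cc).
by apply: L1M; [exact: L1Z|exact: within_continuousM cs cc].
Qed.

Lemma L1_plip c d ip s Q : L1 c d ip -> L1 c d s -> L1 c d Q ->
  L1 c d (plip ip s Q).
Proof.
move=> I1 I2 I3; apply: L1D; last exact: L1_norm.
by apply: L1D; [exact: L1_norm|apply: L1Z; exact: L1_norm].
Qed.

Lemma geometric_small (C e : R) : 0 < e -> exists n, C / 2 ^+ n < e.
Proof.
move=> e0; exists (Num.bound (C / e)).
have := upper_nthrootP (leqnn (Num.bound (C / e))).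
by rewrite !ltr_pdivrMr// ?exprn_gt0// mulrC.
Qed.

(** Picard iteration measured against the weight [expR (2 * P x)], where [P] is a primitive of the
    Lipschitz constant: the 2 in the exponent makes every iteration halve the weighted distance, so
    the scheme converges on the whole interval at once. *)
Lemma prf_exists c d ip s Q (al : R) : c <= d ->
  L1 c d ip -> L1 c d s -> L1 c d Q ->
  exists2 th, acd c d th (fun x => prf ip s Q x (th x)) & th c = al.
Proof.
move=> cd I1 I2 I3.
have [P PL Pc] := acd_prim (L1_plip I1 I2 I3).
have P_ge0 x : c <= x <= d -> 0 <= P x.
  move=> /andP[cx xd]; rewrite -Pc; apply: (acd_le PL) => //.
  by apply: ae_true => z _; exact: plip_ge0.
have P_le x : c <= x <= d -> P x <= P d.
  move=> /andP[cx xd]; apply: (acd_le PL) => //.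
  by apply: ae_true => z _; exact: plip_ge0.
pose T (th : R -> R) := xget (fun=> 0 : R) [set G : R -> R |
  acd c d G (fun x => prf ip s Q x (th x)) /\ G c = al].
have T_spec (th : R -> R) : {within `[c, d], continuous th} ->
    acd c d (T th) (fun x => prf ip s Q x (th x)) /\ T th c = al.
  move=> cth; have [G GP Gc] := acd_prim (L1_prf I1 I2 I3 cth).
  have : [set G : R -> R | acd c d G (fun x => prf ip s Q x (th x)) /\ G c = al]
      (fun x => G x + al).
    split; last by rewrite Gc add0r.
    by have := acdD GP (acd_cst c d al); under [X in acd _ _ _ X]funext do rewrite addr0.
  by move=> H; exact: (xgetI (fun=> 0 : R) H).
pose th_ n := iter n T (fun=> al).
have th_cont n : {within `[c, d], continuous (th_ n)}.
  elim: n => [|n IH]; first exact: ac_continuous (ac_cst _ _ _).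
  by have [[H _] _] := T_spec _ IH; exact: ac_continuous.
have th_acd n : acd c d (th_ n.+1) (fun x => prf ip s Q x (th_ n x)).
  by have [] := T_spec _ (th_cont n).
have thc n : th_ n.+1 c = al by have [] := T_spec _ (th_cont n).
pose E x := expR (2 * P x).
have E_acd k : acd c d (fun x => k * E x) (fun x => k * (E x * (2 * plip ip s Q x))).
  by apply: acdZ; apply: acd_exp; exact: acdZ.
have bound n x : c <= x <= d -> `|th_ n.+1 x - th_ n x| <= (2 ^+ n)^-1 * E x.
  elim: n x => [|n IH] x cxd; have /andP[cx xd] := cxd.
    rewrite expr0 invr1 mul1r.
    have := acd_norm_le (th_acd 0%N) PL _ (lexx c) cx xd.
    rewrite thc Pc subr0 => H; apply: le_trans (H _) _.
      by apply: ae_true => z _; exact: prf_norm.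
    have := expR_ge1Dx (2 * P x); have := P_ge0 _ cxd; rewrite /E; lra.
  have := acd_norm_le (acdB (th_acd n.+1) (th_acd n)) (E_acd (2 ^+ n.+1)^-1) _
     (lexx c) cx xd.
  rewrite !thc subrr subr0 => H; apply: le_trans (H _) _; last first.
    by rewrite lerBlDr lerDl mulr_ge0 ?expR_ge0 ?invr_ge0 ?exprn_ge0.
  apply: ae_true => z czd; apply: (le_trans (prf_lip _ _ _ _ _ _)).
  have -> : (2 ^+ n.+1)^-1 * (E z * (2 * plip ip s Q z)) =
      plip ip s Q z * ((2 ^+ n)^-1 * E z).
    by rewrite exprS; field; rewrite expf_neq0.
  by rewrite ler_wpM2l ?plip_ge0// IH// !ltW//; lra.
pose M := E d.
have M0 : 0 < M by exact: expR_gt0.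
have boundM n x : c <= x <= d -> `|th_ n.+1 x - th_ n x| <= M / 2 ^+ n.
  move=> cxd; apply: (le_trans (bound n x cxd)); rewrite mulrC.
  rewrite ler_wpM2r ?invr_ge0 ?exprn_ge0// ler_expR; have := P_le _ cxd; lra.
(* Subtracting and adding the geometric tail gives nested bounds, so the pointwise limit is the
   supremum of the lower ones. *)
pose lo x n := th_ n x - 2 * M / 2 ^+ n.
pose hi x n := th_ n x + 2 * M / 2 ^+ n.
have half n : 2 * M / 2 ^+ n.+1 = M / 2 ^+ n.
  by rewrite exprS; field; rewrite expf_neq0.
have lo_hi x m n : c <= x <= d -> lo x m <= hi x n.
  move=> cxd.
  have lo_S k : lo x k <= lo x k.+1.
    have := boundM k x cxd; rewrite /lo half ler_norml.
    have : 2 * M / 2 ^+ k = 2 * (M / 2 ^+ k) by rewrite mulrA.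
    lra.
  have hi_S k : hi x k.+1 <= hi x k.
    have := boundM k x cxd; rewrite /hi half ler_norml.
    have : 2 * M / 2 ^+ k = 2 * (M / 2 ^+ k) by rewrite mulrA.
    lra.
  have lo_m : {homo lo x : i j / (i <= j)%N >-> i <= j}.
    exact: (homo_leq (@lexx _ R) (@le_trans _ R)).
  have hi_m : {homo hi x : i j / (i <= j)%N >-> j <= i}.
    by apply: (homo_leq (r := fun u v : R => v <= u)) => // u v w vu wv; exact: le_trans wv _.
  apply: (le_trans (lo_m m (maxn m n) (leq_maxl _ _))).
  apply: le_trans (hi_m n (maxn m n) (leq_maxr _ _)).
  rewrite /lo /hi; have : 0 <= 2 * M / 2 ^+ (maxn m n).
    by rewrite divr_ge0 ?exprn_ge0// mulr_ge0// ltW.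
  lra.
pose th x := sup (range (lo x)).
have th_near n x : c <= x <= d -> `|th x - th_ n x| <= 2 * M / 2 ^+ n.
  move=> cxd.
  have supR : has_sup (range (lo x)).
    by split; [exists (lo x 0%N), 0%N|exists (hi x 0%N) => _ [m _ <-]; exact: lo_hi].
  have h1 : lo x n <= th x by apply: (sup_upper_bound supR); exists n.
  have h2 : th x <= hi x n.
    by apply: ge_sup; [exists (lo x 0%N), 0%N|move=> _ [m _ <-]; exact: lo_hi].
  by move: h1 h2; rewrite /lo /hi ler_norml; lra.
have th_cts : {within `[c, d], continuous th}.
  apply: unif_within_continuous => e e0.
  have [n ne] := geometric_small (2 * M) (ltac:(lra) : 0 < e / 3).
  have acn : abs_continuous c d (th_ n).
    by case: n {ne} => [|n]; [exact: ac_cst|case: (th_acd n)].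
  have [dl dl0 H] := ac_unif acn (ltac:(lra) : 0 < e / 3).
  exists dl => // x y cxd cyd yx.
  have := th_near n x cxd; have := th_near n y cyd; have := H x y cxd cyd yx.
  by rewrite !ler_norml !ltr_norml; lra.
have [Z_acd Zc] := T_spec _ th_cts.
(* For large [n] both [T th] and [th] are close to [th_ n.+1]: the limit is a fixed point. *)
have ZE x : c <= x <= d -> T th x = th x.
  move=> cxd; have /andP[cx xd] := cxd.
  apply/eqP; rewrite -subr_eq0 -normr_le0; apply/ler_addgt0Pr => e e0; rewrite add0r.
  have [n ne] := geometric_small (2 * M * P d + 2 * M) e0.
  have := acd_norm_le (acdB Z_acd (th_acd n)) (acdZ (2 * M / 2 ^+ n) PL) _
    (lexx c) cx xd.
  rewrite Zc thc Pc subrr mulr0 !subr0 => H.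
  have {}H : `|T th x - th_ n.+1 x| <= 2 * M / 2 ^+ n * P x.
    apply: H; apply: ae_true => z czd; apply: (le_trans (prf_lip _ _ _ _ _ _)).
    by rewrite mulrC ler_wpM2r ?plip_ge0// th_near//; lra.
  have h1 := th_near n.+1 x cxd.
  have h2 : 2 * M / 2 ^+ n * P x <= 2 * M / 2 ^+ n * P d.
    by rewrite ler_wpM2l ?P_le// divr_ge0 ?exprn_ge0// mulr_ge0// ltW.
  have h3 : 0 <= M / 2 ^+ n by rewrite divr_ge0 ?exprn_ge0// ltW.
  have h4 : (2 * M * P d + 2 * M) / 2 ^+ n =
    2 * M / 2 ^+ n * P d + 2 * (M / 2 ^+ n) by ring.
  move: h1 H ne; rewrite half !ler_norml h4; lra.
exists (T th) => //; apply: (acd_eq Z_acd); apply: ae_true => x cxd.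
by rewrite ZE//; lra.
Qed.

End scalar_ode.

(** * Differential inequalities for the Prüfer equation *)

Section comparison.
Context {R : realType} (c d : R) (ip s Q P : R -> R).
Hypotheses (PL : acd c d P (plip ip s Q)) (Pc : P c = 0).
Implicit Types (x y : R) (u v w h : R -> R).

Lemma plip_prim_ge0 x : c <= x <= d -> 0 <= P x.
Proof.
move=> /andP[cx xd]; rewrite -Pc; apply: (acd_le PL) => //.
by apply: ae_true => z _; exact: plip_ge0.
Qed.

Section lower.
Variables (u u' w w' h : R -> R).
Hypotheses (au : acd c d u u') (aw : acd c d w w')
  (h0 : ae (fun x => c < x < d -> 0 <= h x))
  (uw' : ae (fun x => c < x < d ->
    h x + (prf ip s Q x (w x) - prf ip s Q x (u x)) <= w' x - u' x))
  (uwc : u c <= w c).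

(** Relative to [u], the function [w] is driven with a surplus of at least [h]; by the Lipschitz
    bound [w - u] falls at a rate of at most [plip] times its size, which cannot take it below
    zero. *)
Lemma prf_cmp_le x : c <= x <= d -> u x <= w x.
Proof.
move=> cxd; rewrite -subr_ge0.
apply: (ac_ge0 (acdB aw au) PL) cxd; last by rewrite subr_ge0.
apply: ae2 h0 uw' => z + + czd => /(_ czd) hz /(_ czd) H.
have := prf_lip ip s Q z (w z) (u z); rewrite ler_norml => /andP[H1 _].
by rewrite -mulNr; move: H1; rewrite -mulNr; lra.
Qed.

(** Integrating factor: a gap present at one point persists to its right. *)
Lemma prf_cmp_grow x y : c <= x -> x <= y -> y <= d ->
  (w x - u x) * expR (P x) <= (w y - u y) * expR (P y).
Proof.
apply: (acd_le (acdM (acdB aw au) (acd_exp PL))).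
apply: ae2 h0 uw' => z + + czd => /(_ czd) hz /(_ czd) H.
have uwz : u z <= w z by apply: prf_cmp_le; lra.
have := prf_lip ip s Q z (w z) (u z).
rewrite [`|w z - u z|]ger0_norm ?subr_ge0// ler_norml => /andP[H1 _].
have -> : (w z - u z) * (expR (P z) * plip ip s Q z) + (w' z - u' z) * expR (P z) =
  expR (P z) * ((w' z - u' z) + plip ip s Q z * (w z - u z)) by ring.
by rewrite mulr_ge0 ?expR_ge0//; lra.
Qed.

Lemma prf_cmp_lt x : u c < w c -> c <= x <= d -> u x < w x.
Proof.
move=> ltc /andP[cx xd]; rewrite -subr_gt0.
rewrite -(pmulr_lgt0 _ (expR_gt0 (P x))).
apply: lt_le_trans (prf_cmp_grow (lexx c) cx xd).
by rewrite mulr_gt0 ?expR_gt0 ?subr_gt0.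
Qed.

Lemma prf_cmp_lt_src x : ae (fun x => c < x < d -> 0 < h x) ->
  c < x <= d -> u x < w x.
Proof.
move=> hp /andP[cx xd]; rewrite -subr_gt0.
rewrite -(pmulr_lgt0 _ (expR_gt0 (P x))).
have: (w c - u c) * expR (P c) < (w x - u x) * expR (P x).
  apply: (acd_lt (acdM (acdB aw au) (acd_exp PL))) => //.
  apply: ae2 hp uw' => z + + czd => /(_ czd) hz /(_ czd) H.
  have uwz : u z <= w z by apply: prf_cmp_le; lra.
  have := prf_lip ip s Q z (w z) (u z).
  rewrite [`|w z - u z|]ger0_norm ?subr_ge0// ler_norml => /andP[H1 _].
  have -> : (w z - u z) * (expR (P z) * plip ip s Q z) + (w' z - u' z) * expR (P z) =
    expR (P z) * ((w' z - u' z) + plip ip s Q z * (w z - u z)) by ring.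
  by rewrite mulr_gt0 ?expR_gt0//; lra.
apply: le_lt_trans.
by rewrite mulr_ge0 ?expR_ge0 ?subr_ge0.
Qed.

End lower.

(** Gronwall in the other direction, for continuity in the parameters: the gap at [c] and the
    accumulated source [K] are amplified at most by [expR (P x)]. *)
Lemma prf_cmp_upper (u u' w w' k K : R -> R) :
  acd c d u u' -> acd c d w w' -> acd c d K k -> K c = 0 ->
  (forall x, c <= x <= d -> u x <= w x) ->
  ae (fun x => c < x < d -> 0 <= k x) ->
  ae (fun x => c < x < d ->
    w' x - u' x <= k x + (prf ip s Q x (w x) - prf ip s Q x (u x))) ->
  forall x, c <= x <= d -> w x - u x <= (w c - u c + K x) * expR (P x).
Proof.
move=> au aw aK Kc uw k0 H x cxd; have /andP[cx xd] := cxd.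
have D := acdB aK (acdM (acdB aw au) (acd_exp (acdN PL))).
have : K c - (w c - u c) * expR (- P c) <= K x - (w x - u x) * expR (- P x).
  apply: (acd_le D) => //; apply: ae2 k0 H => z + + czd => /(_ czd) kz /(_ czd) Hz.
  have uwz : u z <= w z by apply: uw; lra.
  have Pz : 0 <= P z by apply: plip_prim_ge0; lra.
  have := prf_lip ip s Q z (w z) (u z).
  rewrite [`|w z - u z|]ger0_norm ?subr_ge0// ler_norml => /andP[_ H1].
  (* A weight of at most 1 lets the source enter unweighted. *)
  have e1 : expR (- P z) <= 1 by rewrite -expR0 ler_expR; lra.
  rewrite -subr_ge0.
  have -> : k z - ((w z - u z) * (expR (- P z) * - plip ip s Q z) +
      (w' z - u' z) * expR (- P z)) =
    k z * (1 - expR (- P z)) + expR (- P z) *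
      (k z - (w' z - u' z) + plip ip s Q z * (w z - u z)) by ring.
  by rewrite addr_ge0// mulr_ge0 ?expR_ge0//; lra.
rewrite Pc oppr0 expR0 mulr1 Kc sub0r => h.
rewrite -[leLHS](mulr1) -[1](expRxMexpNx_1 (P x)) [expR _ * _]mulrC mulrA.
by rewrite ler_wpM2r ?expR_ge0//; lra.
Qed.

End comparison.

(** * The linear system in polar coordinates *)

Section linear_system.
Context {R : realType} (c d : R) (ip s Q : R -> R).
Hypotheses (cd : c <= d) (I1 : L1 c d ip) (I2 : L1 c d s) (I3 : L1 c d Q).
Implicit Types (x y : R) (u v th : R -> R).

Definition lsol u (u1 : R -> R) :=
  acd c d u (fun x => ip x * u1 x - s x * u x) /\
  acd c d u1 (fun x => s x * u1 x + Q x * u x).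

Lemma lsolD u u1 v v1 : lsol u u1 -> lsol v v1 ->
  lsol (fun x => u x + v x) (fun x => u1 x + v1 x).
Proof.
move=> [hu hu1] [hv hv1]; split.
  by apply: (acd_eq (acdD hu hv)); apply: ae_true => x _; ring.
by apply: (acd_eq (acdD hu1 hv1)); apply: ae_true => x _; ring.
Qed.

Lemma lsolZ k u u1 : lsol u u1 -> lsol (fun x => k * u x) (fun x => k * u1 x).
Proof.
move=> [hu hu1]; split.
  by apply: (acd_eq (acdZ k hu)); apply: ae_true => x _; ring.
by apply: (acd_eq (acdZ k hu1)); apply: ae_true => x _; ring.
Qed.

(** Energy estimate: the derivative of the sum of squares of [u] and [u1] is at most [2 * plip]
    times that sum, so the sum times [expR (- (2 * P x))] is nonincreasing. *)
Lemma lsol_uniq0 u u1 : lsol u u1 -> u c = 0 -> u1 c = 0 ->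
  forall x, c <= x <= d -> u x = 0 /\ u1 x = 0.
Proof.
move=> [hu hu1] uc u1c x /andP[cx xd].
have [P PL Pc] := acd_prim (L1_plip I1 I2 I3).
have D := acdM (acdD (acdM hu hu) (acdM hu1 hu1)) (acd_exp (acdN (acdZ 2 PL))).
have : (u x * u x + u1 x * u1 x) * expR (- (2 * P x)) <= 0.
  have -> : 0 = (u c * u c + u1 c * u1 c) * expR (- (2 * P c)).
    by rewrite uc u1c !mul0r addr0 mul0r.
  rewrite -lerN2; apply: (acd_le (acdN D)) => //.
  apply: ae_true => z _.
  set E := expR _.
  have -> : - ((u z * u z + u1 z * u1 z) * (E * - (2 * plip ip s Q z)) +
    (u z * (ip z * u1 z - s z * u z) + (ip z * u1 z - s z * u z) * u z +
    (u1 z * (s z * u1 z + Q z * u z) + (s z * u1 z + Q z * u z) * u1 z)) * E) =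
    2 * E * (plip ip s Q z * (u z * u z + u1 z * u1 z) -
      (ip z * (u z * u1 z) + s z * (u1 z * u1 z - u z * u z) + Q z * (u z * u1 z))).
    ring.
  apply: mulr_ge0; first by rewrite mulr_ge0 ?expR_ge0.
  rewrite subr_ge0 /plip.
  have N1 : `|u z * u1 z| <= u z * u z + u1 z * u1 z.
    by rewrite ler_norml; apply/andP; split; nra.
  have N2 : `|u1 z * u1 z - u z * u z| <= u z * u z + u1 z * u1 z.
    by rewrite ler_norml; apply/andP; split; nra.
  have B k t : `|t| <= u z * u z + u1 z * u1 z ->
      k * t <= `|k| * (u z * u z + u1 z * u1 z).
    by move=> ht; rewrite (le_trans (ler_norm _))// normrM ler_wpM2l.
  have := B (ip z) _ N1; have := B (s z) _ N2; have := B (Q z) _ N1.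
  have : 0 <= `|s z| * (u z * u z + u1 z * u1 z) by rewrite mulr_ge0//; nra.
  by rewrite !mulrDl; lra.
rewrite pmulr_lle0 ?expR_gt0// => h.
have /eqP := le_anti (introT andP (conj h (addr_ge0 (sqr_ge0 (u x)) (sqr_ge0 (u1 x))))).
by rewrite paddr_eq0 ?sqr_ge0// -!expr2 !sqrf_eq0 => /andP[/eqP -> /eqP ->].
Qed.

Lemma lsol_uniq u u1 v v1 : lsol u u1 -> lsol v v1 -> u c = v c -> u1 c = v1 c ->
  forall x, c <= x <= d -> u x = v x /\ u1 x = v1 x.
Proof.
move=> hu /(lsolZ (-1)) hv uc u1c x cxd.
have [] := lsol_uniq0 (lsolD hu hv) _ _ cxd.
- by rewrite uc mulN1r subrr.
- by rewrite u1c mulN1r subrr.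
by rewrite !mulN1r => /subr0_eq -> /subr0_eq ->.
Qed.

Lemma lsol_wronskian u u1 v v1 : lsol u u1 -> lsol v v1 ->
  forall x, c <= x <= d -> u1 x * v x - u x * v1 x = u1 c * v c - u c * v1 c.
Proof.
move=> [hu hu1] [hv hv1] x cxd.
apply: (acd_eq0 (acdB (acdM hu1 hv) (acdM hu hv1))) cxd.
by apply: ae_true => z _; ring.
Qed.

(** [xget] turns the existence of solutions into a function of [al]; by [prf_exists] the default
    value does not occur. *)
Definition theta (al : R) : R -> R := xget (fun=> 0 : R)
  [set th : R -> R | acd c d th (fun x => prf ip s Q x (th x)) /\ th c = al].

Lemma theta_acd al : acd c d (theta al) (fun x => prf ip s Q x (theta al x)).
Proof.
have [th h1 h2] := prf_exists al cd I1 I2 I3.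
by case: (@xgetI _ (fun=> 0 : R) [set th : R -> R |
  acd c d th (fun x => prf ip s Q x (th x)) /\ th c = al] th (conj h1 h2)).
Qed.

Lemma theta_c al : theta al c = al.
Proof.
have [th h1 h2] := prf_exists al cd I1 I2 I3.
by case: (@xgetI _ (fun=> 0 : R) [set th : R -> R |
  acd c d th (fun x => prf ip s Q x (th x)) /\ th c = al] th (conj h1 h2)).
Qed.

(* Logarithmic derivative of the Prüfer radius. *)
Definition lrad (th : R -> R) x :=
  (ip x + Q x) * (sin (th x) * cos (th x)) +
  s x * (cos (th x) * cos (th x) - sin (th x) * sin (th x)).

Lemma L1_lrad th : {within `[c, d], continuous th} -> L1 c d (lrad th).
Proof.
move=> cth.
have cs := within_continuous_comp_all cth (@continuous_sin R).
have cc := within_continuous_comp_all cth (@continuous_cos R).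
apply: L1D.
  by apply: L1M; [exact: L1D|exact: (within_continuousM cs cc)].
apply: L1M => //.
have h1 := within_continuousM cc cc; have h2 := within_continuousM cs cs.
exact: (within_continuousB h1 h2).
Qed.

Definition logr (al : R) : R -> R := xget (fun=> 0 : R)
  [set l : R -> R | acd c d l (lrad (theta al)) /\ l c = 0].

Lemma logr_acd al : acd c d (logr al) (lrad (theta al)).
Proof.
have [l h1 h2] := acd_prim (L1_lrad (ac_continuous (theta_acd al).1)).
by case: (@xgetI _ (fun=> 0 : R) [set l : R -> R |
  acd c d l (lrad (theta al)) /\ l c = 0] l (conj h1 h2)).
Qed.

Lemma logr_c al : logr al c = 0.
Proof.
have [l h1 h2] := acd_prim (L1_lrad (ac_continuous (theta_acd al).1)).
by case: (@xgetI _ (fun=> 0 : R) [set l : R -> R |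
  acd c d l (lrad (theta al)) /\ l c = 0] l (conj h1 h2)).
Qed.

Definition psin al x := expR (logr al x) * sin (theta al x).
Definition pcos al x := expR (logr al x) * cos (theta al x).

Lemma psin_c al : psin al c = sin al.
Proof. by rewrite /psin logr_c theta_c expR0 mul1r. Qed.

Lemma pcos_c al : pcos al c = cos al.
Proof. by rewrite /pcos logr_c theta_c expR0 mul1r. Qed.

Lemma lsol_pruefer al : lsol (psin al) (pcos al).
Proof.
have hE := acd_exp (logr_acd al); have ht := theta_acd al.
split.
  apply: (acd_eq (acdM hE (acd_sin ht))); apply: ae_true => x _.
  rewrite /lrad /prf /psin /pcos.
  set E := expR _; set S := sin _; set C := cos _.
  transitivity ((ip x * (E * C) - s x * (E * S)) * (C ^+ 2 + S ^+ 2)); first ring.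
  by rewrite cos2Dsin2 mulr1.
apply: (acd_eq (acdM hE (acd_cos ht))); apply: ae_true => x _.
rewrite /lrad /prf /psin /pcos.
set E := expR _; set S := sin _; set C := cos _.
transitivity ((s x * (E * C) + Q x * (E * S)) * (C ^+ 2 + S ^+ 2)); first ring.
by rewrite cos2Dsin2 mulr1.
Qed.

Lemma lsol_polar u u1 k al : lsol u u1 -> u c = k * sin al -> u1 c = k * cos al ->
  forall x, c <= x <= d -> u x = k * psin al x /\ u1 x = k * pcos al x.
Proof.
move=> hu uc u1c; apply: (lsol_uniq hu (lsolZ k (lsol_pruefer al))).
- by rewrite psin_c.
- by rewrite pcos_c.
Qed.

End linear_system.

(** * Integrals of positive parts *)

Section small_positive_part.
Context {R : realType}.
Local Notation mu := (@lebesgue_measure R).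

(** Written with the absolute value so that integrability follows from that of norms and linear
    combinations. *)
Definition pospart (x : R) := 2^-1 * (`|x| + x).

Lemma pospart_ge0 (x : R) : 0 <= pospart x.
Proof. by rewrite mulr_ge0//; have := ler_norm (- x); rewrite normrN; lra. Qed.

Lemma pospart_ge (x : R) : x <= pospart x.
Proof. by rewrite /pospart; have := ler_norm x; lra. Qed.

(** As [r] is positive almost everywhere, the positive part of [g - n r] tends to 0 pointwise and is
    dominated by [|g|]. This takes the place of a uniform lower bound on [r] when the parameter is
    sent to minus infinity. *)
Lemma pospart_small c d (g r : R -> R) (e : R) : c <= d -> L1 c d g -> L1 c d r ->
  ae (fun x => c < x < d -> 0 < r x) -> 0 < e ->
  exists (n : nat) G, [/\ acd c d G (fun x => pospart (g x - n%:R * r x)), G c = 0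
    & G d <= e].
Proof.
move=> cd Ig Ir r0 e0.
pose f n x := pospart (g x - n%:R * r x).
have If n : L1 c d (f n).
  by apply: L1Z; apply: L1D; [apply: L1_norm|]; apply: L1B => //; exact: L1Z.
have mf n : measurable_fun `]c, d[ (EFin \o f n).
  by have := measurable_int mu (If n).
have f_cvg : {ae mu, forall x, `]c, d[%classic x ->
    (EFin \o f n) x @[n --> \oo] --> (cst 0 x : \bar R)}.
  suff H : ae (fun x => `]c, d[%classic x ->
    (EFin \o f n) x @[n --> \oo] --> (cst 0 x : \bar R)) by [].
  apply: ae1 r0 => x rx; rewrite /= in_itv/= => /rx {}rx.
  apply: cvg_near_cst.
  exists (Num.bound (`|g x| / r x)) => // m /= hm.
  have := archi_boundP (ltac:(by rewrite divr_ge0// ltW) : 0 <= `|g x| / r x).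
  rewrite ltr_pdivrMr// => hg.
  have gm : g x - m%:R * r x <= 0.
    have : (Num.bound (`|g x| / r x))%:R * r x <= m%:R * r x.
      by rewrite ler_pM2r// ler_nat.
    by have := ler_norm (g x); lra.
  by rewrite /f /pospart ler0_norm// addNr mulr0.
have f_dom : {ae mu, forall x n, `]c, d[%classic x ->
    (`|(EFin \o f n) x| <= (EFin \o (fun x => `|g x|)%R) x)%E}.
  suff H : ae (fun x => forall n, `]c, d[%classic x ->
    (`|(EFin \o f n) x| <= (EFin \o (fun x => `|g x|)%R) x)%E) by [].
  apply: ae1 r0 => x rx n; rewrite /= in_itv/= => /rx {}rx.
  rewrite lee_fin /f ger0_norm ?pospart_ge0// /pospart.
  have : 0 <= n%:R * r x by rewrite mulr_ge0// ltW.
  have := ler_norm (g x); have := normr_ge0 (g x).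
  have [h|h] := leP 0 (g x - n%:R * r x).
    by rewrite [`|g x - _|]ger0_norm//; lra.
  by rewrite [`|g x - _|]ltr0_norm//; lra.
have [_ _] := @dominated_convergence _ _ _ mu `]c, d[ (measurable_itv _)
  (fun n => EFin \o f n) (cst 0%E) (EFin \o (fun x => `|g x|)) mf
  (measurable_cst _) f_cvg (L1_norm Ig) f_dom.
rewrite integral0 => /fine_cvgP[_ /cvgrPdist_lt /(_ _ e0)[n _ /(_ n (leqnn n)) /= small]].
have [G [aG Gc Gd]] := acd_prim_int (If n).
exists n, G; split => //; rewrite Gd.
by move: small; rewrite /= sub0r normrN => /ltW; apply: le_trans; exact: ler_norm.
Qed.

End small_positive_part.

Section trigonometry.
Context {R : realType}.
Implicit Types (x t : R) (k : int).

Lemma sinDnpi (n : nat) x : sin (x + n%:R * pi) = (-1) ^+ n * sin x.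
Proof.
elim: n => [|n IH]; first by rewrite mul0r addr0 expr0 mul1r.
have -> : x + n.+1%:R * pi = x + n%:R * pi + pi by rewrite -natr1; ring.
by rewrite sinDpi IH exprS mulN1r mulNr.
Qed.

Lemma cosDnpi (n : nat) x : cos (x + n%:R * pi) = (-1) ^+ n * cos x.
Proof. by rewrite -[in RHS]sinDpihalf -sinDnpi -sinDpihalf; congr sin; ring. Qed.

Lemma sinDkpi k x : sin (x + k%:~R * pi) = (-1) ^+ `|k|%N * sin x.
Proof.
case: (intP k) => [|n|n]; first by rewrite mul0r addr0 expr0 mul1r.
  by rewrite -sinDnpi.
rewrite abszN absz_nat.
have -> : sin x = sin (x + (- (n.+1)%:Z)%:~R * pi + (n.+1)%:R * pi).
  by congr sin; rewrite mulrNz; ring.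
by rewrite sinDnpi signrMK.
Qed.

Lemma floor_pi t : (Num.floor (t / pi))%:~R * pi <= t <
  (Num.floor (t / pi))%:~R * pi + pi.
Proof.
have := floor_itv (t / pi); rewrite ler_pdivlMr ?pi_gt0// ltr_pdivrMr ?pi_gt0//.
by rewrite intrD mulrDl mul1r.
Qed.

Lemma sin_eq0 t : sin t = 0 -> t = (Num.floor (t / pi))%:~R * pi.
Proof.
move=> st; have /andP[h1 h2] := floor_pi t; set k := Num.floor _ in h1 h2 *.
apply/eqP; rewrite eq_le h1 andbT leNgt; apply/negP => h3.
have : 0 < sin (t - k%:~R * pi) by apply: sin_gt0_pi; lra.
rewrite -mulNr -mulrNz sinDkpi st mulr0; lra.
Qed.

End trigonometry.

(** * The Prüfer angle at [b] as a function of the spectral parameter *)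

Section angle_map.
Context {R : realType} (a b : R) (ip q r s : R -> R).
Hypotheses (ab : a < b) (Lip : L1 a b ip) (Lq : L1 a b q) (Lr : L1 a b r)
  (Ls : L1 a b s)
  (ip0 : ae (fun x => a < x < b -> 0 < ip x))
  (r0 : ae (fun x => a < x < b -> 0 < r x)).
Implicit Types (x y lam al t : R).

Let ableq : a <= b := ltW ab.

Definition pot lam x := q x - lam * r x.

Lemma L1_pot lam : L1 a b (pot lam).
Proof. by apply: L1B => //; exact: L1Z. Qed.

Definition Th lam al := theta a b ip s (pot lam) al.
Definition F lam al := Th lam al b.

Lemma Th_acd lam al :
  acd a b (Th lam al) (fun x => prf ip s (pot lam) x (Th lam al x)).
Proof. exact: theta_acd (L1_pot lam) al. Qed.

Lemma Th_a lam al : Th lam al a = al.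
Proof. exact: theta_c (L1_pot lam) al. Qed.

Let Pex lam : exists2 P, acd a b P (plip ip s (pot lam)) & P a = 0.
Proof. by apply: acd_prim; apply: L1_plip => //; exact: L1_pot. Qed.

Lemma Th_le lam al be x : al <= be -> a <= x <= b -> Th lam al x <= Th lam be x.
Proof.
move=> albe axb; have [P PL Pa] := Pex lam.
apply: (prf_cmp_le PL (h := fun=> 0) (Th_acd lam al) (Th_acd lam be)) => //.
- by apply: ae_true.
- by apply: ae_true => z _; rewrite add0r.
- by rewrite !Th_a.
Qed.

Lemma Th_lt lam al be x : al < be -> a <= x <= b -> Th lam al x < Th lam be x.
Proof.
move=> albe axb; have [P PL Pa] := Pex lam.
apply: (prf_cmp_lt PL (h := fun=> 0) (Th_acd lam al) (Th_acd lam be)) => //.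
- by apply: ae_true.
- by apply: ae_true => z _; rewrite add0r.
- by rewrite !Th_a ltW.
- by rewrite !Th_a.
Qed.

Lemma Th_uniq lam al th x : acd a b th (fun x => prf ip s (pot lam) x (th x)) ->
  th a = al -> a <= x <= b -> th x = Th lam al x.
Proof.
move=> hth tha axb; have [P PL Pa] := Pex lam.
apply: le_anti; apply/andP; split.
  apply: (prf_cmp_le PL (h := fun=> 0) hth (Th_acd lam al)) => //.
  - by apply: ae_true.
  - by apply: ae_true => z _; rewrite add0r.
  - by rewrite Th_a tha.
apply: (prf_cmp_le PL (h := fun=> 0) (Th_acd lam al) hth) => //.
- by apply: ae_true.
- by apply: ae_true => z _; rewrite add0r.
- by rewrite Th_a tha.
Qed.

Lemma Th_pi lam al x : a <= x <= b -> Th lam (al + pi) x = Th lam al x + pi.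
Proof.
move=> axb; symmetry; apply: (Th_uniq (th := fun x => Th lam al x + pi)) => //.
  apply: (acd_eq (acdD (Th_acd lam al) (acd_cst a b pi))); apply: ae_true => z _.
  by rewrite addr0 /prf sinDpi cosDpi !sqrrN mulrNN.
by rewrite Th_a.
Qed.

(** At a multiple of [pi] the right-hand side of the angle equation equals [ip], which is positive,
    so the constant [t] is a strict subsolution. *)
Lemma Th_cross lam al t x0 x : sin t = 0 -> a <= x0 -> t <= Th lam al x0 ->
  x0 < x <= b -> t < Th lam al x.
Proof.
move=> st ax0 tx0 /andP[x0x xb]; have [P PL Pa] := Pex lam.
have c1 : cos t ^+ 2 = 1 by rewrite cos2sin2 st expr0n subr0.
have ip0' : ae (fun z => x0 < z < b -> 0 < ip z).
  by apply: ae1 ip0 => z h zb; apply: h; lra.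
apply: (prf_cmp_lt_src (acd_sub ax0 (lexx b) PL) (h := ip) (acd_cst x0 b t)
  (acd_sub ax0 (lexx b) (Th_acd lam al))) => //.
- by apply: ae1 ip0' => z h /h/ltW.
- apply: ae_true => z _.
  have -> : prf ip s (pot lam) z t = ip z by rewrite /prf st c1; ring.
  lra.
- by rewrite x0x.
Qed.

Lemma F_gt0 lam al : 0 <= al -> 0 < F lam al.
Proof.
move=> al0; apply: (Th_cross (x0 := a)) => //; first exact: sin0.
- by rewrite Th_a.
- by rewrite ab lexx.
Qed.

Lemma prf_pot lam mu x t :
  prf ip s (pot mu) x t = prf ip s (pot lam) x t + (mu - lam) * r x * sin t ^+ 2.
Proof. by rewrite /prf /pot; ring. Qed.

Lemma Th_lam_le lam mu al x : lam <= mu -> a <= x <= b ->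
  Th lam al x <= Th mu al x.
Proof.
move=> lm axb; have [P PL Pa] := Pex lam.
apply: (prf_cmp_le PL (h := fun x => (mu - lam) * r x * sin (Th mu al x) ^+ 2)
  (Th_acd lam al) (Th_acd mu al)) => //.
- apply: ae1 r0 => z + azb => /(_ azb) rz.
  by rewrite mulr_ge0 ?sqr_ge0// mulr_ge0 ?subr_ge0// ltW.
- by apply: ae_true => z _; rewrite (prf_pot lam mu); lra.
- by rewrite !Th_a.
Qed.

(** By [Th_cross] each multiple of [pi] is attained at most once, so the exceptional set injects
    into the integers. Hence the source [(mu - lam) * r * sin ^ 2] in [F_lam_lt] is positive almost
    everywhere. *)
Lemma Th_sin_neq0 lam al : ae (fun x => a < x < b -> sin (Th lam al x) != 0).
Proof.
pose N := [set x | a < x < b /\ sin (Th lam al x) = 0].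
have cN : countable N.
  apply/countable_injP; exists (fun x => pickle (Num.floor (Th lam al x / pi))).
  have inj x y : N x -> N y -> x < y -> Num.floor (Th lam al x / pi) =
      Num.floor (Th lam al y / pi) -> False.
    move=> [axb sx] [ayb sy] xy E.
    have := @Th_cross lam al (Th lam al x) x y sx ltac:(lra) (lexx _) ltac:(lra).
    by rewrite {1}(sin_eq0 sx) {1}(sin_eq0 sy) E ltxx.
  move=> x y /set_mem Nx /set_mem Ny /(pcan_inj pickleK) E.
  by have [xy|yx|//] := ltgtP x y; [case: (inj x y)|case: (inj y x)].
have N0 : lebesgue_measure N = 0%E by exact: countable_lebesgue_measure0.
exists N; split=> //; first exact: countable_measurable.
move=> x /= H; apply: contrapT => Nx; apply: H => axb.
by apply/eqP => sx; apply: Nx.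
Qed.

Lemma F_lam_lt lam mu al : lam < mu -> F lam al < F mu al.
Proof.
move=> lm; have [P PL Pa] := Pex lam.
apply: (prf_cmp_lt_src PL (h := fun x => (mu - lam) * r x * sin (Th mu al x) ^+ 2)
  (Th_acd lam al) (Th_acd mu al)) => //.
- apply: ae1 r0 => z + azb => /(_ azb) rz.
  by rewrite mulr_ge0 ?sqr_ge0// mulr_ge0 ?subr_ge0// ltW.
- by apply: ae_true => z _; rewrite (prf_pot lam mu); lra.
- by rewrite !Th_a.
- apply: ae2 r0 (Th_sin_neq0 mu al) => z + + azb => /(_ azb) rz /(_ azb) sz.
  by rewrite mulr_gt0 ?exprn_even_gt0// mulr_gt0// subr_gt0.
- by rewrite ab lexx.
Qed.

(** Gronwall with the primitive [P] taken at the reference [lam], so that the constant depends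
    neither on [mu] nor on [al]. Uniformity in [al] later gives continuity of extrema over [al]. *)
Lemma Th_lam_lip lam : exists2 C, 0 <= C & forall mu al x, a <= x <= b ->
  `|Th mu al x - Th lam al x| <= C * `|mu - lam|.
Proof.
have [P PL Pa] := Pex lam; have [K aK Ka] := acd_prim Lr.
have r0' : ae (fun x => a < x < b -> 0 <= r x) by apply: ae1 r0 => z h /h/ltW.
have K_ge0 x : a <= x <= b -> 0 <= K x.
  by move=> /andP[ax xb]; rewrite -Ka; exact: (acd_le aK r0').
have K_le x : a <= x <= b -> K x <= K b.
  by move=> /andP[ax xb]; exact: (acd_le aK r0').
have P_le x : a <= x <= b -> P x <= P b.
  move=> /andP[ax xb]; apply: (acd_le PL) => //.
  by apply: ae_true => z _; exact: plip_ge0.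
have Kb : 0 <= K b by apply: K_ge0; rewrite ableq lexx.
exists (K b * expR (P b)); first by rewrite mulr_ge0 ?expR_ge0.
move=> mu al x axb.
have fin D : 0 <= D -> (0 + D * K x) * expR (P x) <= K b * expR (P b) * D.
  move=> D0; rewrite add0r -mulrA mulrC ler_wpM2r//.
  by rewrite ler_pM ?K_ge0 ?expR_ge0 ?K_le// ler_expR P_le.
have rs z t : 0 <= r z -> r z * sin t ^+ 2 <= r z.
  by move=> rz; rewrite ler_piMr// sqr_le1 ?normr_sin_le1// ler_norml sin_geN1 sin_le1.
have [lm|/ltW ml] := leP lam mu.
  rewrite !ger0_norm ?subr_ge0// ?Th_lam_le//.
  have D0 : 0 <= mu - lam by rewrite subr_ge0.
  apply: le_trans (fin _ D0); have := prf_cmp_upper PL Pa (Th_acd lam al)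
    (Th_acd mu al) (acdZ (mu - lam) aK) _ _ _ _ axb.
  rewrite !Th_a subrr; apply.
  - by rewrite Ka mulr0.
  - by move=> z azb; exact: Th_lam_le.
  - by apply: ae1 r0' => z + azb => /(_ azb) rz; rewrite mulr_ge0.
  - apply: ae1 r0' => z + azb => /(_ azb) rz; rewrite (prf_pot lam mu).
    have := ler_wpM2l D0 (rs z (Th mu al z) rz); rewrite mulrA; lra.
have D0 : 0 <= lam - mu by rewrite subr_ge0.
rewrite distrC (distrC mu) !ger0_norm ?subr_ge0// ?Th_lam_le//.
apply: le_trans (fin _ D0); have := prf_cmp_upper PL Pa (Th_acd mu al)
  (Th_acd lam al) (acdZ (lam - mu) aK) _ _ _ _ axb.
rewrite !Th_a subrr; apply.
- by rewrite Ka mulr0.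
- by move=> z azb; exact: Th_lam_le.
- by apply: ae1 r0' => z + azb => /(_ azb) rz; rewrite mulr_ge0.
- apply: ae1 r0' => z + azb => /(_ azb) rz; rewrite (prf_pot lam mu).
  have := ler_wpM2l D0 (rs z (Th mu al z) rz); rewrite mulrA.
  have : (lam - mu) * r z * sin (Th mu al z) ^+ 2 = - ((mu - lam) * r z * sin (Th mu al z) ^+ 2).
    by ring.
  lra.
Qed.

Lemma F_al_lip lam : exists C, forall al be, al <= be ->
  F lam be - F lam al <= C * (be - al).
Proof.
have [P PL Pa] := Pex lam.
exists (expR (P b)) => al be albe.
have := prf_cmp_upper PL Pa (Th_acd lam al) (Th_acd lam be) (acd_cst a b 0)
  erefl _ _ _ (ltac:(by rewrite ableq lexx) : a <= b <= b).
rewrite !Th_a addr0 mulrC; apply.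
- by move=> z azb; exact: Th_le.
- by apply: ae_true.
- by apply: ae_true => z _; rewrite add0r.
Qed.

Definition lr lam al := logr a b ip s (pot lam) al b.

Lemma lr_lip lam al : exists C, forall mu, `|lr mu al - lr lam al| <= C * `|mu - lam|.
Proof.
have [P PL Pa] := Pex lam; have [K aK Ka] := acd_prim Lr.
have [C C0 HC] := Th_lam_lip lam.
have hl l := logr_acd ableq Lip Ls (L1_pot l) al.
have hl0 l : logr a b ip s (pot l) al a = 0 by exact: (logr_c ableq Lip Ls (L1_pot l)).
exists (C * P b + K b) => mu.
have := acd_norm_le (acdB (hl mu) (hl lam))
  (acdZ `|mu - lam| (acdD (acdZ C PL) aK)) _ (lexx a) ableq (lexx b).
rewrite !hl0 Pa Ka !subr0 mulr0 addr0 mulr0 subr0 mulrC; apply.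
apply: ae1 r0 => z + azb => /(_ azb) rz.
(* The derivative of the logarithmic radius has the shape of [prf] with permuted coefficients, so
   [prf_lip] applies to it as well. *)
have lradE l t : (ip z + pot l z) * (sin t * cos t) +
    s z * (cos t * cos t - sin t * sin t) =
    prf s (fun x => - (ip x + pot l x) / 2) s z t by rewrite /prf; field.
rewrite /lrad -!/(Th _ _) lradE.
set t := Th mu al z; set u := Th lam al z.
have -> : (ip z + pot lam z) * (sin u * cos u) +
    s z * (cos u * cos u - sin u * sin u) =
    prf s (fun x => - (ip x + pot lam x) / 2) s z u by rewrite /prf; field.
have -> : prf s (fun x => - (ip x + pot mu x) / 2) s z t =
   prf s (fun x => - (ip x + pot lam x) / 2) s z t
    - (mu - lam) * (r z * (sin t * cos t)) by rewrite /prf /pot; field.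
have tu : `|t - u| <= C * `|mu - lam| by apply: HC; lra.
have H1 := prf_lip s (fun x => - (ip x + pot lam x) / 2) s z t u.
have H2 : plip s (fun x => - (ip x + pot lam x) / 2) s z <= plip ip s (pot lam) z.
  rewrite /plip normrM normrN (ger0_norm (_ : 0 <= 2^-1))// ?invr_ge0//.
  have := ler_normD (ip z) (pot lam z); lra.
have H3 : `|(mu - lam) * (r z * (sin t * cos t))| <= `|mu - lam| * r z.
  rewrite normrM ler_wpM2l// normrM gtr0_norm// ler_piMr//.
    exact: ltW.
  by rewrite normrM mulr_ile1 ?normr_sin_le1 ?normr_cos_le1.
have H4 : plip s (fun x => - (ip x + pot lam x) / 2) s z * `|t - u| <=
   plip ip s (pot lam) z * (C * `|mu - lam|).
  by apply: ler_pM => //; exact: plip_ge0.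
rewrite addrAC; apply: (le_trans (ler_normB _ _)).
apply: (le_trans (lerD (le_trans H1 H4) H3)).
by rewrite le_eqVlt; apply/orP; left; apply/eqP; ring.
Qed.

End angle_map.

(** * The angle for very negative parameters *)

Section low_parameter.
Context {R : realType} (a b : R) (ip q r s : R -> R).
Hypotheses (ab : a < b) (Lip : L1 a b ip) (Lq : L1 a b q) (Lr : L1 a b r)
  (Ls : L1 a b s)
  (ip0 : ae (fun x => a < x < b -> 0 < ip x))
  (r0 : ae (fun x => a < x < b -> 0 < r x)).

Lemma sqr_sin_ge (e w : R) : 0 <= e -> e <= w -> w <= pi - e -> sin e ^+ 2 <= sin w ^+ 2.
Proof.
move=> e0 ew we.
have ein : e \in `[0, pi] by rewrite in_itv/=; lra.
have win : w \in `[0, pi] by rewrite in_itv/=; lra.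
have pin : pi - e \in `[0, pi] by rewrite in_itv/=; lra.
have h1 : cos w <= cos e by rewrite leNgt ltr_cos// -leNgt.
have h2 : - cos e <= cos w.
  have -> : - cos e = cos (pi - e) by rewrite addrC cosDpi cosN.
  by rewrite leNgt ltr_cos// -leNgt.
have h3 : cos w ^+ 2 <= cos e ^+ 2 by rewrite !expr2; nra.
by rewrite !sin2cos2; lra.
Qed.

(** Barrier: [w = pi - e + W - c K] descends from [pi - e] at [a] to at most [2 * e] at [b] and
    stays between [e / 2] and [pi - e / 2]. There the squared sine is bounded below, so a very
    negative [lam] makes [w] a supersolution. *)
Lemma F_low (e : R) : 0 < e -> e < pi / 2 ->
  exists lam, F a b ip q r s lam (pi - e) <= 2 * e.
Proof.
move=> e0 epi.
have [K aK Ka] := acd_prim Lr.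
have r0' : ae (fun x => a < x < b -> 0 <= r x) by apply: ae1 r0 => z h /h/ltW.
have Kb : 0 < K b by rewrite -Ka; apply: (acd_lt aK r0).
have K_in x : a <= x <= b -> 0 <= K x <= K b.
  by move=> /andP[ax xb]; rewrite -{1}Ka !(acd_le aK r0').
have Lg : L1 a b (plip ip s (pot q r 0)).
  by apply: L1_plip => //; exact: L1_pot.
have e2 : 0 < e / 2 by lra.
have [n [W [aW Wa Wb]]] := pospart_small (ltW ab) Lg Lr r0 e2.
have W_in x : a <= x <= b -> 0 <= W x <= e / 2.
  have W0 : ae (fun x => a < x < b ->
     0 <= pospart (plip ip s (pot q r 0) x - n%:R * r x)).
    by apply: ae_true => z _; exact: pospart_ge0.
  move=> /andP[ax xb]; rewrite -{1}Wa (acd_le aW W0)//=.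
  by apply: le_trans Wb; exact: (acd_le aW W0).
pose c := (pi - 2 * e) / K b.
have cK : c * K b = pi - 2 * e by rewrite /c divfK// gt_eqF.
have c0 : 0 <= c by rewrite divr_ge0 ?ltW//; lra.
have sin2 : 0 < sin (e / 2) ^+ 2 by rewrite exprn_even_gt0//= gt_eqF// sin_gt0_pi; lra.
pose kap := sin (e / 2) ^+ 2.
(* The part [n] absorbs the other coefficients up to the small excess [W], the part [c] pays for the
   descent [- c K], and [kap] is the lower bound of the squared sine along the barrier. *)
pose lam := - (n%:R + c) / kap.
exists lam.
have [P PL Pa] := acd_prim (L1_plip Lip Ls (L1_pot Lq Lr lam)).
pose w x := (pi - e) + W x - c * K x.
have aw : acd a b w (fun x =>
    0 + pospart (plip ip s (pot q r 0) x - n%:R * r x) - c * r x).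
  by apply: acdB (acdZ _ aK); apply: acdD aW; exact: acd_cst.
have := prf_cmp_le PL (h := fun=> 0) (Th_acd ab Lip Lq Lr Ls lam (pi - e)) aw _ _ _
  (ltac:(by rewrite lexx ltW) : a <= b <= b).
rewrite -/(F _ _ _ _ _ _ _ _) => H.
have {}H : F a b ip q r s lam (pi - e) <= w b.
  apply: H.
  - by apply: ae_true.
  - apply: ae1 r0 => z + azb => /(_ azb) rz.
    rewrite add0r lerD2r (prf_pot ip q r s 0 lam) subr0.
    have az : a <= z <= b by lra.
    have /andP[Wz0 Wze] := W_in z az; have /andP[Kz0 KzK] := K_in z az.
    have cKz : c * K z <= pi - 2 * e by rewrite -cK ler_wpM2l.
    have cKz0 : 0 <= c * K z by rewrite mulr_ge0.
    have hs : kap <= sin (w z) ^+ 2.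
      by apply: sqr_sin_ge; rewrite /w; lra.
    have h1 := ler_norm (prf ip s (pot q r 0) z (w z)).
    have h2 := prf_norm ip s (pot q r 0) z (w z).
    have h3 : lam * r z * sin (w z) ^+ 2 <= - (n%:R + c) * r z.
      have -> : - (n%:R + c) * r z = lam * r z * kap.
        by rewrite mulrAC /lam divfK// gt_eqF.
      rewrite -subr_ge0 -mulrBr mulr_le0 ?subr_le0//.
      rewrite pmulr_lle0// /lam mulNr oppr_le0 divr_ge0// ?addr_ge0//.
      exact: ltW.
    have h4 := pospart_ge (plip ip s (pot q r 0) z - n%:R * r z).
    lra.
  - by rewrite Th_a// /w Wa Ka mulr0 addr0 subr0.
by apply: (le_trans H); rewrite /w cK; lra.
Qed.

End low_parameter.

Section polar.
Context {R : realType}.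

(** With [0 < t <= pi] a zero at the left end point appears as the angle [pi], one of the counted
    levels, and never as 0. *)
Lemma polar (x y : R) : (x != 0) || (y != 0) ->
  exists k t, [/\ k != 0, 0 < t <= pi, x = k * sin t & y = k * cos t].
Proof.
wlog x0 : x y / 0 <= x => [W|xy].
  have [x0|x0] := leP 0 x; first exact: W.
  move=> xy; have [||k [t [k0 tpi ex ey]]] := W (- x) (- y).
  - by rewrite oppr_ge0 ltW.
  - by rewrite !oppr_eq0.
  by exists (- k), t; split; rewrite ?oppr_eq0// mulNr -?ex -?ey opprK.
pose n := x ^+ 2 + y ^+ 2.
have n0 : 0 < n.
  rewrite lt_neqAle addr_ge0 ?sqr_ge0// andbT eq_sym paddr_eq0 ?sqr_ge0//.
  by rewrite !sqrf_eq0 negb_and.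
pose k := Num.sqrt n; have k0 : 0 < k by rewrite sqrtr_gt0.
have k2 : k ^+ 2 = n by rewrite sqr_sqrtr// ltW.
have yk : -1 <= y / k <= 1.
  rewrite -ler_norml normrM normfV (gtr0_norm k0) ler_pdivrMr// mul1r.
  by rewrite -sqrtr_sqr ler_wsqrtr// lerDr sqr_ge0.
pose t := acos (y / k).
have ct : cos t = y / k by rewrite acosK.
have st : sin t = x / k.
  rewrite /t sin_acos//.
  have -> : 1 - (y / k) ^+ 2 = (x / k) ^+ 2.
    rewrite !expr_div_n k2 -[1](@divff _ n) ?gt_eqF// -mulrBl /n; ring.
  by rewrite sqrtr_sqr ger0_norm// divr_ge0// ltW.
(* [acos] ranges over [0, pi]; the angle 0 is replaced by [pi] at the cost of the sign of [k]. *)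
have [t0|t0] := eqVneq t 0.
  exists (- k), pi; split.
  - by rewrite oppr_eq0 gt_eqF.
  - by rewrite pi_gt0 lexx.
  - rewrite sinpi mulr0; move: st; rewrite t0 sin0 => /esym/eqP.
    by rewrite mulf_eq0 invr_eq0 [k == 0]gt_eqF// orbF => /eqP.
  - by rewrite cospi mulrN1 opprK; move: ct; rewrite t0 cos0 => h;
      rewrite -[LHS](divfK (lt0r_neq0 k0)) -h mul1r.
exists k, t; split.
- by rewrite gt_eqF.
- by rewrite lt_neqAle eq_sym t0 acos_ge0// acos_lepi.
- by rewrite st mulrC divfK// gt_eqF.
- by rewrite ct mulrC divfK// gt_eqF.
Qed.

End polar.

(** * The angle of the boundary matrix *)

Section boundary_angle.
Context {R : realType} (k11 k12 k21 k22 : R).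
Hypothesis detK : k11 * k22 - k12 * k21 = 1.

Lemma L1_cst c d (k : R) : L1 c d (fun=> k).
Proof.
apply: measurable_bounded_integrable => //.
- by rewrite [X in (X < _)%E]lebesgue_measure_itv/=; case: ifP => _; rewrite ?ltry.
- by exists `|k|; split; [exact: num_real|move=> M kM x _ /=; exact: ltW].
Qed.

Let ip0 := k11 ^+ 2 + k12 ^+ 2.
Let s0 := k12 * k22 + k11 * k21.
Let q0 := - (k21 ^+ 2 + k22 ^+ 2).

(* The curve [al |-> K (sin al, cos al)] solves the linear system whose
   coefficient matrix is the constant [K J K^-1], [J] generating the rotations,
   so its angle is a Prüfer angle. *)
Lemma boundary_angle : exists k E kap, [/\ k != 0,
  -pi < kap 0 <= 0, abs_continuous 0 pi kap, kap pi = kap 0 + pi &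
  (forall x y, 0 <= x -> x < y -> y <= pi -> kap x < kap y) /\
  forall al, 0 <= al <= pi -> [/\ 0 < E al,
    k11 * sin al + k12 * cos al = k * E al * sin (kap al) &
    k21 * sin al + k22 * cos al = k * E al * cos (kap al)]].
Proof.
have [k [t0 [k0 t0pi ek12 ek22]]] : exists k t, [/\ k != 0, 0 < t <= pi,
    k12 = k * sin t & k22 = k * cos t].
  apply: polar; apply: contraT; rewrite negb_or !negbK => /andP[/eqP e1 /eqP e2].
  by move: detK; rewrite e1 e2 mulr0 mul0r subr0 => /eqP; rewrite eq_sym oner_eq0.
have pi0 := @pi_gt0 R; have ple := ltW pi0.
have in0 : 0 <= (0 : R) <= pi by rewrite lexx ple.
have inpi : 0 <= (pi : R) <= pi by rewrite lexx ple.
(* Subtracting [pi] puts the initial angle into (-pi, 0]; the half-turn is compensated by the final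
   factor [- k]. *)
pose kap := theta 0 pi (fun=> ip0) (fun=> s0) (fun=> q0) (t0 - pi).
have Li := L1_cst 0 pi ip0; have Ls := L1_cst 0 pi s0; have Lq := L1_cst 0 pi q0.
have kap_acd : acd 0 pi kap (fun x => prf (fun=> ip0) (fun=> s0) (fun=> q0) x (kap x)).
  exact: (theta_acd ple Li Ls Lq).
have kap_c : kap 0 = t0 - pi by exact: (theta_c ple Li Ls Lq).
pose E x := expR (logr 0 pi (fun=> ip0) (fun=> s0) (fun=> q0) (t0 - pi) x).
pose u x : R := k11 * sin x + k12 * cos x.
pose u1 x : R := k21 * sin x + k22 * cos x.
have asin := acd_sin (acd_id 0 (@pi R)); have acos := acd_cos (acd_id 0 (@pi R)).
have hu : lsol 0 pi (fun=> ip0) (fun=> s0) (fun=> q0) u u1.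
  split.
    apply: (acd_eq (acdD (acdZ k11 asin) (acdZ k12 acos))).
    apply: ae_true => z _; rewrite /u /u1 /ip0 /s0.
    transitivity ((k11 * cos z - k12 * sin z) * (k11 * k22 - k12 * k21)).
      by rewrite detK; ring.
    by ring.
  apply: (acd_eq (acdD (acdZ k21 asin) (acdZ k22 acos))).
  apply: ae_true => z _; rewrite /u /u1 /q0 /s0.
  transitivity ((k21 * cos z - k22 * sin z) * (k11 * k22 - k12 * k21)).
    by rewrite detK; ring.
  by ring.
have rep x : 0 <= x <= pi -> u x = - k * (E x * sin (kap x)) /\
    u1 x = - k * (E x * cos (kap x)).
  apply: (lsol_polar ple Li Ls Lq (al := t0 - pi) hu).
  - rewrite /u sin0 cos0 mulr0 add0r mulr1 ek12.
    by rewrite -(opprK pi) opprK -[in LHS](subrK pi t0) sinDpi; ring.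
  - rewrite /u1 sin0 cos0 mulr0 add0r mulr1 ek22.
    by rewrite -[in LHS](subrK pi t0) cosDpi; ring.
have kap_lt x y : 0 <= x -> x < y -> y <= pi -> kap x < kap y.
  apply: (acd_lt kap_acd); apply: ae_true => z _.
  set S := sin (kap z); set C := cos (kap z).
  have SC : C ^+ 2 + S ^+ 2 = 1 by exact: cos2Dsin2.
  (* The right-hand side is the squared length of the transpose of [K] applied to [(C, - S)],
     nonzero because [K] is invertible. *)
  have -> : prf (fun=> ip0) (fun=> s0) (fun=> q0) z (kap z) =
     (k11 * C - k21 * S) ^+ 2 + (k12 * C - k22 * S) ^+ 2.
    by rewrite /prf -/S -/C /ip0 /s0 /q0; ring.
  rewrite lt_neqAle addr_ge0 ?sqr_ge0// andbT eq_sym paddr_eq0 ?sqr_ge0//.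
  rewrite !sqrf_eq0; apply/negP => /andP[/eqP h1 /eqP h2].
  have hC : C = 0.
    transitivity (k22 * (k11 * C - k21 * S) - k21 * (k12 * C - k22 * S)).
      by transitivity (C * (k11 * k22 - k12 * k21)); [rewrite detK mulr1|ring].
    by rewrite h1 h2 !mulr0 subr0.
  have hS : S = 0.
    transitivity (k12 * (k11 * C - k21 * S) - k11 * (k12 * C - k22 * S)).
      by transitivity (S * (k11 * k22 - k12 * k21)); [rewrite detK mulr1|ring].
    by rewrite h1 h2 !mulr0 subr0.
  by move: SC; rewrite hC hS expr0n addr0 => /eqP; rewrite eq_sym oner_eq0.
(* [K] preserves the area spanned by the directions 0 and [x]. As [sin x] is positive inside (0, pi)
   and vanishes at [pi], the lift gains [pi] exactly at the end. *)
have wr x : 0 <= x <= pi -> k ^+ 2 * (E 0 * E x) * sin (kap x - kap 0) = sin x.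
  move=> xpi; have [e1 e2] := rep x xpi.
  have [f1 f2] := rep 0 in0.
  transitivity (u1 0 * u x - u 0 * u1 x).
    by rewrite f1 f2 e1 e2 sinB; ring.
  rewrite /u /u1 sin0 cos0.
  transitivity (sin x * (k11 * k22 - k12 * k21)); last by rewrite detK mulr1.
  by ring.
exists (- k), E, kap; split.
- by rewrite oppr_eq0.
- by rewrite kap_c; lra.
- by case: kap_acd.
- have k0pi : kap 0 < kap pi by exact: kap_lt.
  have sk0 : sin (kap pi - kap 0) = 0.
    have := wr pi inpi; rewrite sinpi => h.
    have nz : k ^+ 2 * (E 0 * E pi) != 0.
      by rewrite mulf_neq0 ?expf_neq0// mulf_neq0// gt_eqF// expR_gt0.
    by apply: (mulfI nz); rewrite h mulr0.
  have kple : kap pi <= kap 0 + pi.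
    rewrite leNgt; apply/negP => h.
    have mid : Num.min (kap 0) (kap pi) <= kap 0 + pi <= Num.max (kap 0) (kap pi).
      by rewrite ge_min le_max; lra.
    have [z] := IVT ple (ac_continuous kap_acd.1) mid.
    rewrite in_itv/= => zpi ez.
    have z0 : 0 < z.
      rewrite lt_neqAle; case/andP: (zpi) => -> _; rewrite andbT.
      by apply/eqP => z0; move: ez; rewrite -z0; lra.
    have zp : z < pi.
      rewrite lt_neqAle; case/andP: (zpi) => _ ->; rewrite andbT.
      by apply/eqP => zp; move: ez; rewrite zp; lra.
    have := wr z zpi; rewrite ez addrAC subrr add0r sinpi mulr0 => /esym/eqP.
    by rewrite gt_eqF// sin_gt0_pi// z0.
  apply/eqP; rewrite eq_le kple/= leNgt; apply/negP => h.
  have : 0 < sin (kap pi - kap 0) by apply: sin_gt0_pi; lra.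
  by rewrite sk0 ltxx.
- split=> // al /rep[e1 e2]; split; first exact: expR_gt0.
  + by rewrite -mulrA.
  + by rewrite -mulrA.
Qed.

End boundary_angle.

(** * Plane quadratic forms and matrices of determinant one *)

Section quadratic_forms.
Context {R : realType}.

Lemma semidefinite (A B C : R) : B ^+ 2 <= 4 * A * C ->
  (forall x y, 0 <= A * x ^+ 2 + B * (x * y) + C * y ^+ 2) \/
  (forall x y, A * x ^+ 2 + B * (x * y) + C * y ^+ 2 <= 0).
Proof.
move=> disc.
have key x y : 0 <= 4 * A * (A * x ^+ 2 + B * (x * y) + C * y ^+ 2).
  have -> : 4 * A * (A * x ^+ 2 + B * (x * y) + C * y ^+ 2) =
    (2 * A * x + B * y) ^+ 2 + (4 * A * C - B ^+ 2) * y ^+ 2 by ring.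
  by rewrite addr_ge0 ?sqr_ge0// mulr_ge0 ?sqr_ge0// subr_ge0.
have [A0|A0|A0] := ltgtP A 0.
- by right => x y; have := key x y; rewrite nmulr_rge0//; lra.
- by left => x y; have := key x y; rewrite pmulr_rge0//; lra.
have B0 : B = 0.
  apply/eqP; rewrite -sqrf_eq0 eq_le sqr_ge0 andbT.
  by move: disc; rewrite A0 mulr0 mul0r.
rewrite A0 B0; have [C0|C0] := leP 0 C; [left|right] => x y.
  by rewrite !mul0r !add0r mulr_ge0 ?sqr_ge0.
by rewrite !mul0r !add0r mulr_le0_ge0 ?sqr_ge0// ltW.
Qed.

(* Two elements of SL(2) with equal trace [2 C], [|C| <= 1], which rotate the
   plane in the same sense: the reverse Cauchy-Schwarz inequality for the
   traceless parts gives [tr (M^-1 M') >= 2]. *)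
Lemma trace_ratio_ge2 (C m11 m12 m21 m22 n11 n12 n21 n22 : R) : C ^+ 2 <= 1 ->
  m11 + m22 = 2 * C -> n11 + n22 = 2 * C ->
  m11 * m22 - m12 * m21 = 1 -> n11 * n22 - n12 * n21 = 1 ->
  (0 <= m12 /\ m21 <= 0 /\ 0 <= n12 /\ n21 <= 0) \/
  (m12 <= 0 /\ 0 <= m21 /\ n12 <= 0 /\ 0 <= n21) ->
  2 <= m22 * n11 - m12 * n21 - m21 * n12 + m11 * n22.
Proof.
move=> C1 trm trn dm dn sgn.
pose x := m11 - C; pose y := n11 - C; pose S := 1 - C ^+ 2.
have S0 : 0 <= S by rewrite subr_ge0.
pose w := - (m12 * n21) - m21 * n12.
have w0 : 0 <= w.
  rewrite /w; case: sgn => [[h1 [h2 [h3 h4]]]|[h1 [h2 [h3 h4]]]].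
    have := mulr_ge0_le0 h1 h4; have := mulr_le0_ge0 h2 h3; lra.
  have := mulr_le0_ge0 h1 h4; have := mulr_ge0_le0 h2 h3; lra.
have em22 : m22 = 2 * C - m11 by lra.
have en22 : n22 = 2 * C - n11 by lra.
have em : - (m12 * m21) = S + x ^+ 2.
  by move: dm; rewrite em22 /S /x; lra.
have en : - (n12 * n21) = S + y ^+ 2.
  by move: dn; rewrite en22 /S /y; lra.
(* First the arithmetic-geometric mean for the two terms of [w], then Cauchy-Schwarz for the vectors
   with entries [sqrt S, x] and [sqrt S, y]. *)
have w2 : (2 * (S + x * y)) ^+ 2 <= w ^+ 2.
  have e4 : 4 * ((S + x ^+ 2) * (S + y ^+ 2)) <= w ^+ 2.
    rewrite -em -en -subr_ge0.
    have -> : w ^+ 2 - 4 * (- (m12 * m21) * - (n12 * n21)) =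
      (m12 * n21 - m21 * n12) ^+ 2 by rewrite /w; ring.
    exact: sqr_ge0.
  apply: le_trans e4; rewrite -subr_ge0.
  have -> : 4 * ((S + x ^+ 2) * (S + y ^+ 2)) - (2 * (S + x * y)) ^+ 2 =
    4 * (S * (x - y) ^+ 2) by ring.
  by rewrite mulr_ge0// mulr_ge0// sqr_ge0.
have : 2 * (S + x * y) <= w.
  have [h|h] := leP (S + x * y) 0; first lra.
  rewrite -(@ler_pXn2r _ 2)// nnegrE; lra.
have -> : m22 * n11 - m12 * n21 - m21 * n12 + m11 * n22 =
  w + (2 * C ^+ 2 - 2 * (x * y)).
  by rewrite /w /x /y em22 en22; ring.
by rewrite /S; lra.
Qed.

Lemma kernel2 (K : fieldType) (a b c d : K) : a * d - b * c = 0 ->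
  exists x y, [/\ (x != 0) || (y != 0), a * x + b * y = 0 & c * x + d * y = 0].
Proof.
move=> det0; have [/eqP ab0|ab0] := boolP ((a == 0) && (b == 0)).
  move: ab0 => /eqP/andP[/eqP a0 /eqP b0].
  have [/andP[/eqP c0 /eqP d0]|cd0] := boolP ((c == 0) && (d == 0)).
    by exists 1, 0; split; rewrite ?oner_eq0// ?a0 ?b0 ?c0 ?d0 !mul0r addr0.
  exists d, (- c); split; last by rewrite mulrN mulrC subrr.
    by rewrite oppr_eq0 orbC -negb_and.
  by rewrite a0 b0 !mul0r addr0.
exists b, (- a); split.
- by rewrite oppr_eq0 orbC -negb_and.
- by rewrite mulrN mulrC subrr.
- by rewrite mulrN mulrC (mulrC d) -opprB det0 oppr0.
Qed.

Lemma pos_eigenvector (n11 n12 n21 n22 : R) : n11 * n22 - n12 * n21 = 1 ->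
  2 <= n11 + n22 -> exists c x y, [/\ 0 < c, (x != 0) || (y != 0),
    n11 * x + n12 * y = c * x & n21 * x + n22 * y = c * y].
Proof.
move=> dn t2; pose t := n11 + n22.
have d0 : 0 <= t ^+ 2 - 4 by have : 2 <= t by []; rewrite expr2; nra.
pose c := (t + Num.sqrt (t ^+ 2 - 4)) / 2.
have sq : Num.sqrt (t ^+ 2 - 4) ^+ 2 = t ^+ 2 - 4 by rewrite sqr_sqrtr.
have c0 : 0 < c.
  have := sqrtr_ge0 (t ^+ 2 - 4); have : 2 <= t by [].
  by rewrite /c; lra.
have ch : c ^+ 2 - t * c + 1 = 0.
  rewrite /c; move: sq; set w := Num.sqrt _ => sq.
  have -> : ((t + w) / 2) ^+ 2 - t * ((t + w) / 2) + 1 = (w ^+ 2 - t ^+ 2 + 4) / 4.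
    by field.
  by rewrite sq; field.
have [|x [y [xy0 e1 e2]]] := @kernel2 R (n11 - c) n12 n21 (n22 - c).
  have -> : (n11 - c) * (n22 - c) - n12 * n21 =
    c ^+ 2 - t * c + (n11 * n22 - n12 * n21) by rewrite /t; ring.
  by rewrite dn.
by exists c, x, y; split=> //; lra.
Qed.

Lemma continuous_scale (w : R) (f : R -> R) : continuous f ->
  continuous (fun x => w * f x).
Proof. by move=> cf x; apply: continuousM; [exact: cst_continuous|exact: cf]. Qed.

Lemma lip_continuous (f : R -> R) :
  (forall x, exists C, forall y, `|f y - f x| <= C * `|y - x|) -> continuous f.
Proof.
move=> H x; have [C HC] := H x; apply/cvgrPdist_lt => e e0.
pose B := `|C| + 1; have B0 : 0 < B by rewrite /B; have := normr_ge0 C; lra.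
near=> y.
rewrite distrC; apply: (le_lt_trans (HC y)).
apply: (@le_lt_trans _ _ (B * `|y - x|)).
  by rewrite ler_wpM2r// /B; have := ler_norm C; lra.
rewrite -ltr_pdivlMl// distrC; near: y.
apply/nbhs_ballP; exists (B^-1 * e) => //=.
by rewrite mulr_gt0 ?invr_gt0.
Unshelve. all: by end_near. Qed.

(** Passes from an eigenvector [(x, y)] to its direction [(S, T)], dropping the length factor
    [w]. *)
Lemma proportional_rows (w c x y S T f f' g g' u v : R) : w != 0 ->
  x = w * S -> y = w * T -> f * S + f' * T = u -> g * S + g' * T = v ->
  g * x + g' * y = c * (f * x + f' * y) -> v = c * u.
Proof.
move=> w0 -> -> <- <- H; apply: (mulfI w0).
transitivity (g * (w * S) + g' * (w * T)); first ring.
by rewrite H; ring.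
Qed.

Lemma same_direction (e e' c t t' : R) : 0 < e -> 0 < e' -> 0 < c ->
  e' * sin t' = c * (e * sin t) -> e' * cos t' = c * (e * cos t) ->
  sin (t' - t) = 0 /\ 0 < cos (t' - t).
Proof.
move=> e0 e'0 c0; rewrite sinB cosB.
have := cos2Dsin2 t.
move: (sin t) (cos t) (sin t') (cos t') => S T S' T' ST h1 h2; split.
  apply: (mulfI (lt0r_neq0 e'0)).
  transitivity ((e' * S') * T - (e' * T') * S); first ring.
  by rewrite h1 h2; ring.
rewrite -(pmulr_rgt0 _ e'0).
have -> : e' * (T' * T + S' * S) = c * e * (T ^+ 2 + S ^+ 2).
  transitivity ((e' * T') * T + (e' * S') * S); first ring.
  by rewrite h1 h2; ring.
by rewrite ST mulr1 mulr_gt0.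
Qed.

(** Distinct angles of the same direction differ by at least a full turn, more than the width [pi]
    of the band. *)
Lemma no_full_turn (l A B u : R) : B - u < A - u ->
  l <= B - u <= l + pi -> l <= A - u <= l + pi ->
  sin (A - B) = 0 -> 0 < cos (A - B) -> False.
Proof.
move=> h1 h2 h3 s0 cp.
have h4 : A - B <= pi by lra.
have h5 : 0 < A - B by lra.
move: h4; rewrite le_eqVlt => /predU1P[E0|h4].
  by move: cp; rewrite E0 cospi; lra.
have : 0 < sin (A - B) by apply: sin_gt0_pi; rewrite h5.
by rewrite s0 ltxx.
Qed.

Lemma int_gt0_succ (j : int) : 0 < j -> exists n : nat, j = n.+1%:Z.
Proof. by case: j => [[|n]|n] // _; exists n. Qed.

Lemma int_adj_eq (i j : int) : i < j + 1 -> j < i + 1 -> i = j.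
Proof. by rewrite !ltzD1 => h1 h2; apply/le_anti/andP. Qed.

End quadratic_forms.

(** * Classes of eigenvalues *)

Section eigenvalue_classes.
Context {R : realType} (a b : R) (ip q r s : R -> R).
Hypotheses (ab : a < b) (Lip : L1 a b ip) (Lq : L1 a b q) (Lr : L1 a b r)
  (Ls : L1 a b s)
  (ip0 : ae (fun x => a < x < b -> 0 < ip x))
  (r0 : ae (fun x => a < x < b -> 0 < r x)).
Variables (k11 k12 k21 k22 : R) (detK : k11 * k22 - k12 * k21 = 1).
Variables (k : R) (E kap : R -> R).
Hypotheses (k0 : k != 0) (kap_in : - pi < kap 0 <= 0)
  (kap_ac : abs_continuous 0 pi kap) (kap_pi : kap pi = kap 0 + pi)
  (kap_lt : forall x y, 0 <= x -> x < y -> y <= pi -> kap x < kap y)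
  (kapE : forall al, 0 <= al <= pi -> [/\ 0 < E al,
    k11 * sin al + k12 * cos al = k * E al * sin (kap al) &
    k21 * sin al + k22 * cos al = k * E al * cos (kap al)]).
Variable C : R.
Hypothesis C1 : C ^+ 2 <= 1.
Implicit Types (lam mu al be : R) (n m : nat).

Local Notation F := (F a b ip q r s).
Local Notation lr := (lr a b ip q r s).
Local Notation pot := (pot q r).

Let ableq : a <= b := ltW ab.
Let Lpot lam : L1 a b (pot lam) := L1_pot Lq Lr lam.

(** The directions [pi / 2] and 0 carry the initial data (1, 0) and (0, 1), so these are the entries
    of the fundamental matrix at [b]. *)
Definition f11 lam := psin a b ip s (pot lam) (pi / 2) b.
Definition f21 lam := pcos a b ip s (pot lam) (pi / 2) b.
Definition f12 lam := psin a b ip s (pot lam) 0 b.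
Definition f22 lam := pcos a b ip s (pot lam) 0 b.

Lemma fund_polar lam al :
  f11 lam * sin al + f12 lam * cos al = expR (lr lam al) * sin (F lam al) /\
  f21 lam * sin al + f22 lam * cos al = expR (lr lam al) * cos (F lam al).
Proof.
have h1 := lsolZ (sin al) (lsol_pruefer ableq Lip Ls (Lpot lam) (pi / 2)).
have h2 := lsolZ (cos al) (lsol_pruefer ableq Lip Ls (Lpot lam) 0).
have [||e1 e2] := lsol_polar ableq Lip Ls (Lpot lam) (k := 1) (al := al) (lsolD h1 h2)
  _ _ (ltac:(by rewrite lexx ltW) : a <= b <= b).
- by rewrite !(psin_c ableq Lip Ls (Lpot lam)) sin_pihalf sin0; ring.
- by rewrite !(pcos_c ableq Lip Ls (Lpot lam)) cos_pihalf cos0; ring.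
rewrite mul1r in e1; rewrite mul1r in e2; split.
  transitivity (psin a b ip s (pot lam) al b); last by [].
  by rewrite -e1 /f11 /f12; ring.
transitivity (pcos a b ip s (pot lam) al b); last by [].
by rewrite -e2 /f21 /f22; ring.
Qed.

Lemma fund_det lam : f11 lam * f22 lam - f12 lam * f21 lam = 1.
Proof.
have h1 := lsol_pruefer ableq Lip Ls (Lpot lam) (pi / 2).
have h2 := lsol_pruefer ableq Lip Ls (Lpot lam) 0.
have := lsol_wronskian h1 h2 (ltac:(by rewrite lexx ltW) : a <= b <= b).
rewrite !(psin_c ableq Lip Ls (Lpot lam)) !(pcos_c ableq Lip Ls (Lpot lam)).
rewrite sin_pihalf cos_pihalf sin0 cos0 /f11 /f12 /f21 /f22; lra.
Qed.

(* Entries of [K^-1 Phi], [Phi] being the fundamental matrix at [b]. *)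
Definition m11 lam := k22 * f11 lam - k12 * f21 lam.
Definition m12 lam := k22 * f12 lam - k12 * f22 lam.
Definition m21 lam := k11 * f21 lam - k21 * f11 lam.
Definition m22 lam := k11 * f22 lam - k21 * f12 lam.
Definition D lam := m11 lam + m22 lam.

Lemma det_m lam : m11 lam * m22 lam - m12 lam * m21 lam = 1.
Proof.
transitivity ((k11 * k22 - k12 * k21) *
  (f11 lam * f22 lam - f12 lam * f21 lam)); last by rewrite detK fund_det mulr1.
by rewrite /m11 /m12 /m21 /m22; ring.
Qed.

(* [Phi] turns the direction [(sin al, cos al)] by [F lam al - al], and [K] turns
   it by [kap al - al], up to a half-turn common to all [al]. *)
Definition Delta lam al := F lam al - kap al.

(** The form is the area spanned by the images of the unit vector of direction [al] under [K] and
    under [Phi]; in polar coordinates this is a product of signed lengths and the sine of the angle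
    between them. *)
Lemma form_polar lam al : 0 <= al <= pi ->
  - m21 lam * sin al ^+ 2 + (m11 lam - m22 lam) * (sin al * cos al) +
  m12 lam * cos al ^+ 2 = k * (E al * expR (lr lam al)) * sin (Delta lam al).
Proof.
move=> alpi; have [_ e1 e2] := kapE alpi; have [g1 g2] := fund_polar lam al.
transitivity (
 (k21 * sin al + k22 * cos al) * (f11 lam * sin al + f12 lam * cos al) -
 (k11 * sin al + k12 * cos al) * (f21 lam * sin al + f22 lam * cos al)).
  by rewrite /m11 /m12 /m21 /m22; ring.
by rewrite e1 e2 g1 g2 /Delta sinB; ring.
Qed.

(** Both [F lam] and [kap] increase strictly and gain exactly [pi] over [0, pi]. *)
Lemma Delta_osc lam al be : 0 <= al <= pi -> 0 <= be <= pi ->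
  Delta lam be < Delta lam al + pi.
Proof.
move=> alpi bepi; rewrite /Delta.
have Fpi : F lam pi = F lam 0 + pi.
  have := Th_pi ab Lip Lq Lr Ls lam 0 (ltac:(by rewrite lexx ltW) : a <= b <= b).
  by rewrite add0r.
have inb : a <= b <= b by rewrite lexx ltW.
have FL x y : x <= y -> F lam x <= F lam y.
  by move=> xy; apply: (Th_le ab Lip Lq Lr Ls).
have FLs x y : x < y -> F lam x < F lam y.
  by move=> xy; apply: (Th_lt ab Lip Lq Lr Ls).
have kle x y : 0 <= x -> x <= y -> y <= pi -> kap x <= kap y.
  move=> x0 + ypi; rewrite le_eqVlt => /predU1P[->//|xy].
  exact/ltW/kap_lt.
have /andP[al0 al1] := alpi; have /andP[be0 be1] := bepi.
have [abe|bea|->] := ltgtP al be.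
- have := kap_lt al0 abe be1; have := FL _ _ be1; have := FL _ _ al0; lra.
- have := FLs _ _ bea; have := kle 0 be (lexx _) be0 be1.
  have := kle al pi al0 al1 (lexx _); have := kap_pi; lra.
- by have := @pi_gt0 R; lra.
Qed.

Lemma Delta_lt lam mu al : lam < mu -> Delta lam al < Delta mu al.
Proof. by move=> lm; rewrite ltrD2r; exact: F_lam_lt. Qed.

Lemma Delta_le lam mu al : lam <= mu -> Delta lam al <= Delta mu al.
Proof. by rewrite le_eqVlt => /predU1P[->//|/Delta_lt/ltW]. Qed.

Lemma Delta0_gt0 lam : 0 < Delta lam 0.
Proof.
have : 0 < F lam 0 by apply: F_gt0.
by move: kap_in; rewrite /Delta; lra.
Qed.

Definition Class n lam := D lam = 2 * C /\
  forall al, 0 <= al <= pi -> n%:R * pi <= Delta lam al <= n%:R * pi + pi.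

Lemma form_semidefinite lam : D lam = 2 * C ->
  exists2 t, t != 0 & forall al, 0 <= al <= pi -> 0 <= t * sin (Delta lam al).
Proof.
move=> DC.
have sgn al (w : R) : 0 <= al <= pi ->
    0 <= w * (k * (E al * expR (lr lam al)) * sin (Delta lam al)) ->
    0 <= w * k * sin (Delta lam al).
  move=> alpi; have [E0 _ _] := kapE alpi.
  have -> : w * (k * (E al * expR (lr lam al)) * sin (Delta lam al)) =
    (E al * expR (lr lam al)) * (w * k * sin (Delta lam al)) by ring.
  by rewrite pmulr_rge0// mulr_gt0 ?expR_gt0.
have disc : (m11 lam - m22 lam) ^+ 2 <= 4 * - m21 lam * m12 lam.
  have -> : (m11 lam - m22 lam) ^+ 2 = (2 * C) ^+ 2 - 4 * (m11 lam * m22 lam).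
    by rewrite -DC /D; ring.
  have := det_m lam; move: C1; rewrite exprMn; lra.
have [H|H] := semidefinite disc.
- exists k => // al alpi; rewrite -[k]mul1r; apply: sgn => //.
  by rewrite mul1r -form_polar.
- exists (- k); first by rewrite oppr_eq0.
  move=> al alpi; rewrite -[k]mul1r -mulNr; apply: sgn => //.
  by rewrite mulN1r oppr_ge0 -form_polar.
Qed.

(** The sine of [Delta] keeps one sign and [Delta] oscillates by less than [pi], which confines it
    to one band. The floor at [al = 0] names the band, unless [Delta lam 0] is a multiple of [pi]
    and [Delta] goes below it; then the band underneath is the right one. *)
Lemma Class_exists lam : D lam = 2 * C -> exists n, Class n lam.
Proof.
move=> DC; have [t t0 ht] := form_semidefinite DC.
have pi0 := @pi_gt0 R.
have in0 : 0 <= (0 : R) <= pi by rewrite lexx ltW.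
have := floor_pi (Delta lam 0); set j := Num.floor _ => /andP[j1 j2].
pose d al := Delta lam al - j%:~R * pi.
have osc al : 0 <= al <= pi -> - pi < d al - d 0 < pi.
  move=> alpi; have := Delta_osc lam in0 alpi; have := Delta_osc lam alpi in0.
  rewrite /d; lra.
have [t' t'0 hd] : exists2 t', t' != 0 & forall al, 0 <= al <= pi -> 0 <= t' * sin (d al).
  exists (t * (-1) ^+ `|j|%N); first by rewrite mulf_neq0// signr_eq0.
  move=> al /ht; rewrite -[Delta lam al](subrK (j%:~R * pi)) sinDkpi -/(d al).
  by rewrite mulrA.
have d0 : 0 <= d 0 < pi by rewrite /d; lra.
have [band|nband] := pselect (forall al, 0 <= al <= pi -> 0 <= d al <= pi).
  have j0 : 0 < j + 1.
    have : 0 < (j + 1)%:~R * (pi : R).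
      by rewrite intrD mulrDl mul1r; have := Delta0_gt0 lam; lra.
    by rewrite pmulr_lgt0// ltr0z.
  have [n jn] : exists n : nat, j = n%:Z.
    by have [n jn] := int_gt0_succ j0; exists n; apply: (addIr 1); rewrite jn -addn1 PoszD.
  exists n; split=> // al /band; rewrite /d jn -pmulrn; lra.
have [al alpi nal] : exists2 al, 0 <= al <= pi & ~ (0 <= d al <= pi).
  apply: contrapT => H; apply: nband => al alpi; apply: contrapT => nd.
  by apply: H; exists al.
have := osc al alpi; move: nal => /negP; rewrite negb_and -!ltNge => dal osc_al.
(* From a start inside the open band, leaving it by less than [pi] would change the sign of the
   sine. *)
have d00 : d 0 = 0.
  apply/eqP; case/andP: d0 => d0 d0pi; rewrite eq_le d0 andbT leNgt; apply/negP => d0p.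
  have s0 : 0 < sin (d 0) by rewrite sin_gt0_pi// d0p.
  have t'p : 0 < t'.
    by rewrite lt_neqAle eq_sym t'0/= -(pmulr_lge0 _ s0) hd.
  have : 0 <= sin (d al) by rewrite -(pmulr_rge0 _ t'p) hd.
  have [d_neg|d_pos] := ltP (d al) 0.
    have : 0 < sin (d al + pi) by apply: sin_gt0_pi; lra.
    by rewrite sinDpi; lra.
  have : 0 < sin (d al - pi) by apply: sin_gt0_pi; move: dal; rewrite ltNge d_pos/=; lra.
  by rewrite -[d al](subrK pi) sinDpi subrK; lra.
have dneg : d al < 0 by case/orP: dal => //; lra.
have sal : 0 < - sin (d al) by rewrite -sinDpi; apply: sin_gt0_pi; lra.
have t'n : t' < 0.
  by rewrite lt_neqAle t'0/= -oppr_ge0 -(pmulr_lge0 _ sal) mulrNN hd.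
have band be : 0 <= be <= pi -> - pi <= d be <= 0.
  move=> bepi; have := osc be bepi; rewrite d00 subr0 => /andP[h1 h2].
  rewrite (ltW h1)/= leNgt; apply/negP => dbe.
  have : 0 < sin (d be) by apply: sin_gt0_pi; rewrite dbe.
  by have := hd be bepi; rewrite nmulr_rge0//; lra.
have jgt0 : 0 < j.
  have : 0 < j%:~R * (pi : R) by have := Delta0_gt0 lam; move: d00; rewrite /d; lra.
  by rewrite pmulr_lgt0// ltr0z.
have [n jn] := int_gt0_succ jgt0.
exists n; split=> // be /band; rewrite /d jn -pmulrn -natr1; lra.
Qed.

Lemma Class_sin n lam al : Class n lam -> 0 <= al <= pi ->
  0 <= (-1) ^+ n * sin (Delta lam al).
Proof.
move=> [_ H] /H Hal; rewrite -[Delta lam al](subrK (n%:R * pi)) sinDnpi signrMK.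
by apply: sin_ge0_pi; lra.
Qed.

(** The directions 0 and [pi / 2] evaluate the form to [m12] and [- m21]. The parity of the class
    thus fixes the sense of rotation required by [trace_ratio_ge2]. *)
Lemma Class_sign n lam : Class n lam ->
  0 <= (-1) ^+ n * k * m12 lam /\ (-1) ^+ n * k * m21 lam <= 0.
Proof.
move=> Hc.
have pi0 := @pi_gt0 R.
have in0 : 0 <= (0 : R) <= pi by rewrite lexx ltW.
have inh : 0 <= (pi / 2 : R) <= pi by lra.
have pos al (w : R) : 0 <= al <= pi -> 0 <= k ^+ 2 * (E al * expR w).
  by move=> /kapE[E0 _ _]; rewrite mulr_ge0 ?sqr_ge0// mulr_ge0 ?expR_ge0// ltW.
split.
  have -> : m12 lam = k * (E 0 * expR (lr lam 0)) * sin (Delta lam 0).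
    by rewrite -form_polar// sin0 cos0; ring.
  have -> : (-1) ^+ n * k * (k * (E 0 * expR (lr lam 0)) * sin (Delta lam 0)) =
    k ^+ 2 * (E 0 * expR (lr lam 0)) * ((-1) ^+ n * sin (Delta lam 0)) by ring.
  by rewrite mulr_ge0 ?pos// Class_sin.
rewrite -oppr_ge0.
have -> : m21 lam = - (k * (E (pi / 2) * expR (lr lam (pi / 2))) * sin (Delta lam (pi / 2))).
  by rewrite -form_polar// sin_pihalf cos_pihalf; ring.
have -> : - ((-1) ^+ n * k *
    - (k * (E (pi / 2) * expR (lr lam (pi / 2))) * sin (Delta lam (pi / 2)))) =
  k ^+ 2 * (E (pi / 2) * expR (lr lam (pi / 2))) *
    ((-1) ^+ n * sin (Delta lam (pi / 2))) by ring.
by rewrite mulr_ge0 ?pos// Class_sin.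
Qed.

Lemma Class_lt_neq n lam mu : lam < mu -> Class n lam -> Class n mu -> False.
Proof.
move=> lm cl cm.
have sgn : (0 <= m12 lam /\ m21 lam <= 0 /\ 0 <= m12 mu /\ m21 mu <= 0) \/
    (m12 lam <= 0 /\ 0 <= m21 lam /\ m12 mu <= 0 /\ 0 <= m21 mu).
  have [h1 h2] := Class_sign cl; have [h3 h4] := Class_sign cm.
  have w0 : (-1) ^+ n * k != 0 by rewrite mulf_neq0// signr_eq0.
  move: h1 h2 h3 h4; set w := _ * k in w0 *.
  have [wn|wp|/eqP] := ltgtP w 0; last by rewrite (negbTE w0).
    by rewrite !nmulr_rge0// !nmulr_rle0//; right.
  by rewrite !pmulr_rge0// !pmulr_rle0//; left.
have := trace_ratio_ge2 C1 cl.1 cm.1 (det_m lam) (det_m mu) sgn.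
(* Entries of [Phi(lam)^-1 Phi(mu)]: in the quotient of the two matrices [K^-1 Phi] the factor [K]
   cancels. *)
pose n11 := f22 lam * f11 mu - f12 lam * f21 mu.
pose n12 := f22 lam * f12 mu - f12 lam * f22 mu.
pose n21 := f11 lam * f21 mu - f21 lam * f11 mu.
pose n22 := f11 lam * f22 mu - f21 lam * f12 mu.
have -> : m22 lam * m11 mu - m12 lam * m21 mu - m21 lam * m12 mu + m11 lam * m22 mu
    = n11 + n22.
  transitivity ((k11 * k22 - k12 * k21) * (n11 + n22)); last by rewrite detK mul1r.
  by rewrite /m11 /m12 /m21 /m22 /n11 /n22; ring.
have dN : n11 * n22 - n12 * n21 = 1.
  transitivity ((f11 lam * f22 lam - f12 lam * f21 lam) *
    (f11 mu * f22 mu - f12 mu * f21 mu)); last by rewrite !fund_det mulr1.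
  by rewrite /n11 /n12 /n21 /n22; ring.
move=> /(pos_eigenvector dN)[c [x [y [c0 xy e1 e2]]]].
have g1 : f11 mu * x + f12 mu * y = c * (f11 lam * x + f12 lam * y).
  transitivity ((f11 lam * f22 lam - f12 lam * f21 lam) *
    (f11 mu * x + f12 mu * y)); first by rewrite fund_det mul1r.
  transitivity (f11 lam * (n11 * x + n12 * y) + f12 lam * (n21 * x + n22 * y)).
    by rewrite /n11 /n12 /n21 /n22; ring.
  by rewrite e1 e2; ring.
have g2 : f21 mu * x + f22 mu * y = c * (f21 lam * x + f22 lam * y).
  transitivity ((f11 lam * f22 lam - f12 lam * f21 lam) *
    (f21 mu * x + f22 mu * y)); first by rewrite fund_det mul1r.
  transitivity (f21 lam * (n11 * x + n12 * y) + f22 lam * (n21 * x + n22 * y)).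
    by rewrite /n11 /n12 /n21 /n22; ring.
  by rewrite e1 e2; ring.
(* Along the direction of the eigenvector, [Phi(mu)] is the positive multiple [c] of [Phi(lam)], so
   the two final angles point the same way. *)
have [w [al [w0 al0 ex ey]]] := polar xy.
have alpi : 0 <= al <= pi by lra.
have [p1 p2] := fund_polar lam al; have [p3 p4] := fund_polar mu al.
have h1 := proportional_rows w0 ex ey p1 p3 g1.
have h2 := proportional_rows w0 ex ey p2 p4 g2.
have [s0 cp] := same_direction (expR_gt0 _) (expR_gt0 _) c0 h1 h2.
exact: (no_full_turn (Delta_lt al lm) (cl.2 al alpi) (cm.2 al alpi) s0 cp).
Qed.

Lemma Class_lt i j lam mu : lam < mu -> Class i lam -> Class j mu -> (i < j)%N.
Proof.
move=> lm ci cj.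
have [ij|ji|ij] := ltngtP i j => //; last by rewrite ij in ci; case: (Class_lt_neq lm ci cj).
have in0 : 0 <= (0 : R) <= pi by rewrite lexx pi_ge0.
have := Delta_lt 0 lm; have := ci.2 0 in0; have := cj.2 0 in0.
have : j%:R * pi + pi <= i%:R * (pi : R).
  have -> : j%:R * pi + pi = j.+1%:R * (pi : R) by rewrite -natr1; ring.
  by rewrite ler_pM2r ?pi_gt0// ler_nat.
lra.
Qed.

Lemma Class_uniq n lam mu : Class n lam -> Class n mu -> lam = mu.
Proof.
move=> cl cm; have [/Class_lt_neq|/Class_lt_neq|//] := ltgtP lam mu.
  by case/(_ _ cl cm).
by case/(_ _ cm cl).
Qed.

Lemma Class_adj i j lam : Class i lam -> Class j lam -> (i <= j.+1)%N.
Proof.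
move=> [_ /(_ 0 (introT andP (conj (lexx _) (pi_ge0 R)))) h1]
  [_ /(_ 0 (introT andP (conj (lexx _) (pi_ge0 R)))) h2].
rewrite -(ler_nat R) -(ler_pM2r (pi_gt0 R)) -natr1 mulrDl mul1r; lra.
Qed.

(* In two adjacent classes, [Delta] is a multiple of [pi], so that every direction
   is an eigendirection. *)
Lemma form_zero_scalar lam : (forall al, 0 <= al <= pi -> sin (Delta lam al) = 0) ->
  [/\ m12 lam = 0, m21 lam = 0 & m11 lam = m22 lam].
Proof.
move=> H; have pi0 := @pi_gt0 R.
have in0 : 0 <= (0 : R) <= pi by rewrite lexx ltW.
have inh : 0 <= (pi / 2 : R) <= pi by lra.
have inq : 0 <= (pi / 4 : R) <= pi by lra.
have e1 := form_polar lam in0; rewrite H// sin0 cos0 [in RHS]mulr0 in e1.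
have e2 := form_polar lam inh; rewrite H// sin_pihalf cos_pihalf [in RHS]mulr0 in e2.
have z12 : m12 lam = 0 by rewrite -e1; ring.
have z21 : m21 lam = 0 by apply/eqP; rewrite -oppr_eq0; apply/eqP; rewrite -e2; ring.
have := form_polar lam inq; rewrite H// z12 z21 oppr0 !mul0r mulr0 add0r addr0 => /eqP.
have s4 : 0 < sin (pi / 4 : R) by apply: sin_gt0_pi; lra.
have c4 : 0 < cos (pi / 4 : R) by apply: cos_gt0_pihalf; lra.
have sc : sin (pi / 4 : R) * cos (pi / 4) != 0 by rewrite mulf_neq0// gt_eqF.
by rewrite mulf_eq0 (negbTE sc) orbF subr_eq0 => /eqP.
Qed.

Lemma Class_double i lam : Class i lam -> Class i.+1 lam ->
  [/\ m12 lam = 0, m21 lam = 0 & m11 lam = m22 lam].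
Proof.
move=> [_ h1] [_ h2]; apply: form_zero_scalar => al alpi.
have -> : Delta lam al = i.+1%:R * pi.
  apply/eqP; rewrite eq_le; have := h1 al alpi; have := h2 al alpi.
  by rewrite -natr1 mulrDl mul1r => /andP[-> _] /andP[_ ->].
by rewrite -[_ * _]add0r sinDnpi sin0 mulr0.
Qed.

(** The form vanishes, so [Delta] takes only multiples of [pi] as values; oscillation below [pi]
    makes it constant, on the common edge of two bands. *)
Lemma scalar_double lam : D lam = 2 * C ->
  m12 lam = 0 -> m21 lam = 0 -> m11 lam = m22 lam ->
  exists i, Class i lam /\ Class i.+1 lam.
Proof.
move=> DC z12 z21 e12; have pi0 := @pi_gt0 R.
have in0 : 0 <= (0 : R) <= pi by rewrite lexx ltW.
have sin_zero al : 0 <= al <= pi -> sin (Delta lam al) = 0.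
  move=> alpi; have [E0 _ _] := kapE alpi.
  have := form_polar lam alpi; rewrite z12 z21 e12 oppr0 subrr !mul0r !addr0.
  by move/esym/eqP; rewrite !mulf_eq0 (negbTE k0) (gt_eqF E0) gt_eqF ?expR_gt0//= => /eqP.
set j := Num.floor (Delta lam 0 / pi).
have Dj al : 0 <= al <= pi -> Delta lam al = j%:~R * pi.
  move=> alpi; rewrite (sin_eq0 (sin_zero _ alpi)); congr (_%:~R * _).
  set i := Num.floor (_ / _); apply: int_adj_eq.
    have := Delta_osc lam in0 alpi.
    rewrite (sin_eq0 (sin_zero _ alpi)) (sin_eq0 (sin_zero _ in0)) -/i -/j => h.
    have : i%:~R * pi < (j + 1)%:~R * (pi : R) by rewrite intrD mulrDl mul1r.
    by rewrite ltr_pM2r// ltr_int.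
  have := Delta_osc lam alpi in0.
  rewrite (sin_eq0 (sin_zero _ alpi)) (sin_eq0 (sin_zero _ in0)) -/i -/j => h.
  have : j%:~R * pi < (i + 1)%:~R * (pi : R) by rewrite intrD mulrDl mul1r.
  by rewrite ltr_pM2r// ltr_int.
have j0 : 0 < j.
  by have := Delta0_gt0 lam; rewrite Dj// pmulr_lgt0// ltr0z.
have [n jn] := int_gt0_succ j0.
exists n; split; split=> // al /Dj ->; rewrite jn -pmulrn -natr1; lra.
Qed.

(** At a contact, [al] is an eigendirection of [K^-1 Phi] with an eigenvalue [c] of the sign of
    [(-1) ^+ n * k]; since the determinant is 1, the trace is [c + c^-1]. *)
Lemma D_touch lam al n : 0 <= al <= pi -> Delta lam al = n%:R * pi ->
  2 <= (-1) ^+ n * Num.sg k * D lam.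
Proof.
move=> alpi Dn; have [E0 e1 e2] := kapE alpi; have [g1 g2] := fund_polar lam al.
have FE : F lam al = kap al + n%:R * pi by rewrite -Dn /Delta; ring.
pose c := (-1) ^+ n * expR (lr lam al) / (k * E al).
pose x := sin al; pose y := cos al.
have En : E al != 0 by rewrite gt_eqF.
have h1 : f11 lam * x + f12 lam * y = c * (k11 * x + k12 * y).
  by rewrite g1 e1 FE sinDnpi /c; field; rewrite k0 En.
have h2 : f21 lam * x + f22 lam * y = c * (k21 * x + k22 * y).
  by rewrite g2 e2 FE cosDnpi /c; field; rewrite k0 En.
have d1 : (m11 lam - c) * x + m12 lam * y = 0.
  transitivity (k22 * (f11 lam * x + f12 lam * y) -
    k12 * (f21 lam * x + f22 lam * y) - c * ((k11 * k22 - k12 * k21) * x)).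
    by rewrite detK /m11 /m12; ring.
  by rewrite h1 h2; ring.
have d2 : m21 lam * x + (m22 lam - c) * y = 0.
  transitivity (k11 * (f21 lam * x + f22 lam * y) -
    k21 * (f11 lam * x + f12 lam * y) - c * ((k11 * k22 - k12 * k21) * y)).
    by rewrite detK /m21 /m22; ring.
  by rewrite h1 h2; ring.
have ch : c ^+ 2 - D lam * c + 1 = 0.
  pose X := c ^+ 2 - D lam * c + (m11 lam * m22 lam - m12 lam * m21 lam).
  have Xx : X * x = 0.
    transitivity ((m22 lam - c) * ((m11 lam - c) * x + m12 lam * y) -
      m12 lam * (m21 lam * x + (m22 lam - c) * y)); first by rewrite /X /D; ring.
    by rewrite d1 d2 !mulr0 subr0.
  have Xy : X * y = 0.
    transitivity ((m11 lam - c) * (m21 lam * x + (m22 lam - c) * y) -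
      m21 lam * ((m11 lam - c) * x + m12 lam * y)); first by rewrite /X /D; ring.
    by rewrite d1 d2 !mulr0 subr0.
  have <- : X = c ^+ 2 - D lam * c + 1 by rewrite /X det_m.
  transitivity (X * (y ^+ 2 + x ^+ 2)); first by rewrite cos2Dsin2 mulr1.
  by transitivity (X * y * y + X * x * x); [ring|rewrite Xx Xy !mul0r addr0].
pose t := (-1) ^+ n * Num.sg k.
have t2 : t * t = 1.
  rewrite /t mulrACA -expr2 sqrr_sign mul1r -expr2 sqr_sg k0.
  by [].
have tc : 0 < t * c.
  have -> : t * c = (-1) ^+ n * (-1) ^+ n * (Num.sg k / k) * (expR (lr lam al) / E al).
    by rewrite /t /c; field; rewrite k0 En.
  have sk : 0 < Num.sg k / k.
    have [kn|kp|/eqP] := ltgtP k 0; last by rewrite (negbTE k0).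
      by rewrite ltr0_sg// mulN1r oppr_gt0 invr_lt0.
    by rewrite gtr0_sg// mul1r invr_gt0.
  by rewrite -expr2 sqrr_sign mul1r (mulr_gt0 sk)// divr_gt0 ?expR_gt0.
rewrite -/t -(ler_pM2r tc).
have -> : t * D lam * (t * c) = (t * c) ^+ 2 + 1.
  have -> : t * D lam * (t * c) = t * t * (D lam * c) by ring.
  have -> : (t * c) ^+ 2 = t * t * c ^+ 2 by ring.
  by rewrite t2 !mul1r; move: ch; lra.
rewrite -subr_ge0; have -> : (t * c) ^+ 2 + 1 - 2 * (t * c) = (t * c - 1) ^+ 2 by ring.
exact: sqr_ge0.
Qed.

Lemma Delta_lam_lip lam : exists2 B, 0 <= B & forall mu al,
  `|Delta mu al - Delta lam al| <= B * `|mu - lam|.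
Proof.
have [B B0 H] := Th_lam_lip ab Lip Lq Lr Ls r0 lam; exists B => // mu al.
have -> : Delta mu al - Delta lam al = F mu al - F lam al by rewrite /Delta; ring.
by apply: H; rewrite lexx ltW.
Qed.

Lemma Delta_continuous lam : {within `[0, pi], continuous (Delta lam)}.
Proof.
have [B HB] := F_al_lip ab Lip Lq Lr Ls lam.
have acF : abs_continuous 0 pi (F lam).
  apply: (ac_dom (C := `|B|) (ac_id 0 pi) (ac_id 0 pi)) => x y _ xy _.
  have Fxy : 0 <= F lam y - F lam x.
    by rewrite subr_ge0; apply: (Th_le ab Lip Lq Lr Ls) => //; rewrite lexx ltW.
  rewrite (ger0_norm Fxy); apply: (le_trans (HB _ _ xy)).
  apply: (@le_trans _ _ (`|B| * (y - x))).
    by rewrite ler_wpM2r ?subr_ge0// ler_norm.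
  by rewrite ler_wpM2l// (le_trans (ler_norm _))// lerDl.
apply: ac_continuous; have := acD acF (acZ (-1) kap_ac).
by congr abs_continuous; apply: funext => x; rewrite mulN1r.
Qed.

Lemma Delta_min lam : exists2 al, 0 <= al <= pi &
  forall be, 0 <= be <= pi -> Delta lam al <= Delta lam be.
Proof.
have [al alpi H] := EVT_min (pi_ge0 R) (@Delta_continuous lam).
by exists al; [move: alpi; rewrite in_itv|move=> be bepi; apply: H; rewrite in_itv].
Qed.

Lemma Delta_max lam : exists2 al, 0 <= al <= pi &
  forall be, 0 <= be <= pi -> Delta lam be <= Delta lam al.
Proof.
have [al alpi H] := EVT_max (pi_ge0 R) (@Delta_continuous lam).
by exists al; [move: alpi; rewrite in_itv|move=> be bepi; apply: H; rewrite in_itv].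
Qed.

(* A level [v] above the minimum of [Delta] for one parameter and below it for
   another is the minimum of [Delta] for some parameter in between. *)
Lemma Delta_min_level lam mu v : lam <= mu ->
  (exists2 al, 0 <= al <= pi & Delta lam al <= v) ->
  (forall al, 0 <= al <= pi -> v <= Delta mu al) ->
  exists nu, [/\ lam <= nu, nu <= mu, forall al, 0 <= al <= pi -> v <= Delta nu al &
    exists2 al, 0 <= al <= pi & Delta nu al = v].
Proof.
move=> lm [al0 al0pi low] high.
have ex nu : exists al, 0 <= al <= pi /\
    forall be, 0 <= be <= pi -> Delta nu al <= Delta nu be.
  by have [al alpi H] := Delta_min nu; exists al.
have [g Hg] := choice ex.
pose h nu := Delta nu (g nu).
(* The minimizer [g nu] may jump, but the minimum inherits the Lipschitz bound that is uniform in
   [al]. *)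
have ch : continuous h.
  apply: lip_continuous => x; have [B B0 HB] := Delta_lam_lip x; exists B => y.
  have [gx mx] := Hg x; have [gy my] := Hg y.
  have := HB y (g x); have := HB y (g y); have := mx _ gy; have := my _ gx.
  by rewrite /h !ler_norml; lra.
have mid : Num.min (h lam) (h mu) <= v <= Num.max (h lam) (h mu).
  have [gl ml] := Hg lam; have [gm _] := Hg mu.
  have := ml _ al0pi; have := high _ gm; rewrite ge_min le_max -/(h _) -/(h _).
  by move=> h1 h2; apply/andP; split; apply/orP; [left|right]; lra.
have [nu] := IVT lm (continuous_subspaceT ch) mid.
rewrite in_itv/= => /andP[ln nm] hv; exists nu; have [gn mn] := Hg nu; split=> //.
  by move=> al alpi; rewrite -hv; exact: mn.
by exists (g nu).
Qed.

Lemma Delta_max_level lam mu v : lam <= mu ->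
  (forall al, 0 <= al <= pi -> Delta lam al <= v) ->
  (exists2 al, 0 <= al <= pi & v <= Delta mu al) ->
  exists nu, [/\ lam <= nu, nu <= mu, forall al, 0 <= al <= pi -> Delta nu al <= v &
    exists2 al, 0 <= al <= pi & Delta nu al = v].
Proof.
move=> lm low [al0 al0pi high].
have ex nu : exists al, 0 <= al <= pi /\
    forall be, 0 <= be <= pi -> Delta nu be <= Delta nu al.
  by have [al alpi H] := Delta_max nu; exists al.
have [g Hg] := choice ex.
pose h nu := Delta nu (g nu).
have ch : continuous h.
  apply: lip_continuous => x; have [B B0 HB] := Delta_lam_lip x; exists B => y.
  have [gx mx] := Hg x; have [gy my] := Hg y.
  have := HB y (g x); have := HB y (g y); have := mx _ gy; have := my _ gx.
  by rewrite /h !ler_norml; lra.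
have mid : Num.min (h lam) (h mu) <= v <= Num.max (h lam) (h mu).
  have [gm mm] := Hg mu; have [gl _] := Hg lam.
  have := mm _ al0pi; have := low _ gl; rewrite ge_min le_max -/(h _) -/(h _).
  by move=> h1 h2; apply/andP; split; apply/orP; [left|right]; lra.
have [nu] := IVT lm (continuous_subspaceT ch) mid.
rewrite in_itv/= => /andP[ln nm] hv; exists nu; have [gn mn] := Hg nu; split=> //.
  by move=> al alpi; rewrite -hv; exact: mn.
by exists (g nu).
Qed.

(** Near [al = pi] the lift is close to [kap pi], which is positive, while [F_low] makes [F] small
    there. Monotonicity of both, and the gain [pi] of [F], bound [Delta] elsewhere. *)
Lemma Delta_low : exists lam, (exists2 al, 0 <= al <= pi & Delta lam al < 0) /\
  forall al, 0 <= al <= pi -> Delta lam al < pi.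
Proof.
(* [kap pi] is [3 * eta]; one third is given up to move from [pi] to [pi - e], and [2 * e] costs
   less than another. *)
pose eta := (pi + kap 0) / 3.
have pi0 := @pi_gt0 R.
have eta0 : 0 < eta by move: kap_in; rewrite /eta; lra.
have [dl dl0 H] := ac_unif kap_ac eta0.
pose e := Num.min (dl / 2) (Num.min (eta / 3) (pi / 4)).
have e0 : 0 < e by rewrite /e !lt_min; apply/and3P; split; lra.
have e1 : e <= dl / 2 by rewrite /e ge_min lexx.
have e2 : e <= eta / 3 by rewrite /e !ge_min lexx orbT.
have e3 : e <= pi / 4 by rewrite /e !ge_min lexx !orbT.
have [|lam Hl] := F_low ab Lip Lq Lr Ls r0 e0; first lra.
have in1 : 0 <= pi - e <= pi by lra.
have kap1 : 2 * eta < kap (pi - e).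
  have := H pi (pi - e) ltac:(lra) in1.
  have -> : pi - e - pi = - e by ring.
  rewrite normrN gtr0_norm// => /(_ ltac:(lra)).
  by rewrite ltr_norml; move: kap_pi; rewrite /eta; lra.
have kle x y : 0 <= x -> x <= y -> y <= pi -> kap x <= kap y.
  move=> x0 + ypi; rewrite le_eqVlt => /predU1P[->//|xy].
  exact/ltW/kap_lt.
have inb : a <= b <= b by rewrite lexx ltW.
have FL x y : x <= y -> F lam x <= F lam y.
  by move=> xy; apply: (Th_le ab Lip Lq Lr Ls).
have Fpi : F lam pi = F lam 0 + pi.
  by have := Th_pi ab Lip Lq Lr Ls lam 0 inb; rewrite add0r.
have k0E : - kap 0 = pi - 3 * eta by rewrite /eta; field.
exists lam; split.
  by exists (pi - e) => //; rewrite /Delta; lra.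
move=> al /andP[al0 alpi]; rewrite /Delta.
have [h|h] := leP al (pi - e).
  by have := FL _ _ h; have := kle 0 al (lexx _) al0 alpi; lra.
have := FL _ _ alpi; have := FL 0 (pi - e) ltac:(lra).
have := kle (pi - e) al ltac:(lra) (ltW h) alpi; lra.
Qed.

Lemma D_continuous : continuous D.
Proof.
have cF al : continuous (F^~ al).
  apply: lip_continuous => x; have [B B0 HB] := Th_lam_lip ab Lip Lq Lr Ls r0 x.
  by exists B => y; apply: HB; rewrite lexx ltW.
have cl al : continuous (lr^~ al).
  apply: lip_continuous => x; exact: (lr_lip ab Lip Lq Lr Ls r0).
have ce al : continuous (fun lam => expR (lr lam al)).
  by move=> x; apply: continuous_comp; [exact: cl|exact: continuous_expR].
have cs al : continuous (fun lam => psin a b ip s (pot lam) al b).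
  move=> x; apply: (continuousM (ce al x)).
  by apply: continuous_comp; [exact: cF|exact: continuous_sin].
have cc al : continuous (fun lam => pcos a b ip s (pot lam) al b).
  move=> x; apply: (continuousM (ce al x)).
  by apply: continuous_comp; [exact: cF|exact: continuous_cos].
move=> x; rewrite /D /m11 /m22 /f11 /f12 /f21 /f22.
apply: (@continuousD _ _ _ (fun lam => _) (fun lam => _)).
  by apply: (@continuousB _ _ _ (fun lam => _) (fun lam => _)); apply: continuous_scale.
by apply: (@continuousB _ _ _ (fun lam => _) (fun lam => _)); apply: continuous_scale.
Qed.

(* Between the parameter where [Delta] first exceeds [n pi] everywhere and the one
   where it first reaches [(n + 1) pi], the discriminant runs from one of [2],
   [-2] to the other. *)
Lemma Class_below i n lam : Class i lam -> (n < i)%N -> exists mu, Class n mu.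
Proof.
move=> [_ Hi] ni; have pi0 := @pi_gt0 R.
have in0 : 0 <= (0 : R) <= pi by rewrite lexx ltW.
have [low [[al0 al0pi neg] ltpi]] := Delta_low.
have n0 : 0 <= n%:R * (pi : R) by rewrite mulr_ge0// ltW.
have above al : 0 <= al <= pi -> n.+1%:R * pi <= Delta lam al.
  move=> /Hi/andP[h _]; apply: le_trans h.
  by rewrite ler_pM2r// ler_nat.
have n1 : n.+1%:R * pi = n%:R * pi + pi :> R by rewrite -natr1; ring.
have ll : low <= lam.
  rewrite leNgt; apply/negP => /Delta_lt-/(_ al0).
  have := above _ al0pi; lra.
have [A [lA _ Age [al1 al1pi A1]]] : exists nu, [/\ low <= nu, nu <= lam,
    forall al, 0 <= al <= pi -> n%:R * pi <= Delta nu al &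
    exists2 al, 0 <= al <= pi & Delta nu al = n%:R * pi].
  apply: Delta_min_level => //; first by exists al0 => //; lra.
  by move=> al /above; lra.
have [B [_ _ Ble [al2 al2pi B2]]] : exists nu, [/\ low <= nu, nu <= lam,
    forall al, 0 <= al <= pi -> Delta nu al <= n.+1%:R * pi &
    exists2 al, 0 <= al <= pi & Delta nu al = n.+1%:R * pi].
  apply: Delta_max_level => //; first by move=> al /ltpi; lra.
  by exists 0 => //; exact: above.
(* Otherwise [Delta A] would be [n pi] at [al1] and at least [(n + 1) pi] at [al2], too large an
   oscillation. *)
have AB : A <= B.
  rewrite leNgt; apply/negP => /ltW/Delta_le-/(_ al2).
  have := Delta_osc A al1pi al2pi; lra.
have tA := D_touch al1pi A1; have tB := D_touch al2pi B2.
pose t : R := (-1) ^+ n * Num.sg k.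
have t2 : t ^+ 2 = 1 by rewrite exprMn sqrr_sign mul1r sqr_sg k0.
have CC : -2 <= t * (2 * C) <= 2.
  have : (t * (2 * C)) ^+ 2 <= 2 ^+ 2.
    by rewrite exprMn t2 mul1r exprMn; move: C1; lra.
  rewrite -ler_norml -[leLHS]real_normK ?num_real//.
  by rewrite ler_pXn2r// ?nnegrE.
have cD : continuous (fun x => t * D x).
  exact: continuous_scale D_continuous.
have mid : Num.min (t * D A) (t * D B) <= t * (2 * C) <= Num.max (t * D A) (t * D B).
  move: tA tB; rewrite exprS -/t mulN1r mulNr -/t mulNr => tA tB.
  by rewrite ge_min le_max; apply/andP; split; apply/orP; [right|left]; lra.
have [mu] := IVT AB (continuous_subspaceT cD) mid.
rewrite in_itv/= => /andP[Am mB] Dmu; exists mu; split.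
  have t0 : t != 0 by apply: contra_eq_neq t2 => ->; rewrite expr0n eq_sym oner_eq0.
  exact: (mulfI t0).
move=> al alpi; have := Age _ alpi; have := Ble _ alpi.
by have := Delta_le al Am; have := Delta_le al mB; lra.
Qed.

(** [F] is [Delta + kap], and the lift satisfies [- pi < kap al <= pi]. *)
Lemma Class_angle n lam al : Class n lam -> 0 < al <= pi ->
  n%:R * pi - pi < F lam al <= n%:R * pi + 2 * pi.
Proof.
move=> [_ H] /andP[al0 alpi].
have := H al (introT andP (conj (ltW al0) alpi)); rewrite /Delta => Hal.
have h1 : kap 0 < kap al by apply: kap_lt.
have h2 : kap al <= kap 0 + pi.
  rewrite -kap_pi; move: alpi; rewrite le_eqVlt => /predU1P[->//|alpi].
  by apply/ltW/kap_lt => //; exact: ltW.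
by move: kap_in; lra.
Qed.

End eigenvalue_classes.

(* Every value of [lam] lies in one or two consecutive classes, as many as its
   multiplicity, so that [lam] enumerates the classes in order. *)
Lemma index_in_class (R : realType) (cls : nat -> R -> Prop) (lam : nat -> R) :
  nondecreasing_seq lam ->
  (forall i j x y, x < y -> cls i x -> cls j y -> (i < j)%N) ->
  (forall n x y, cls n x -> cls n y -> x = y) ->
  (forall i j x, cls i x -> cls j x -> (i <= j.+1)%N) ->
  (forall i n x, cls i x -> (n < i)%N -> exists y, cls n y) ->
  (forall n x, cls n x -> exists i, lam i = x) ->
  (forall n x, cls n x -> cls n.+1 x ->
    exists i j, [/\ i <> j, lam i = x & lam j = x]) ->
  (forall i j, i <> j -> lam i = lam j -> exists n, cls n (lam i) /\ cls n.+1 (lam i)) ->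
  (forall i j l, lam i = lam j -> lam j = lam l -> [\/ i = j, j = l | i = l]) ->
  (forall i, exists n, cls n (lam i)) ->
  forall n, cls n (lam n).
Proof.
move=> lam_le c_lt c_uniq c_adj c_below c_ex c_two two_c no3 all_c.
apply: ltn_ind => n IH.
(* The classes do not lag behind the index; the rest of the proof excludes that they run ahead. *)
have [n' nn' cn'] : exists2 n', (n <= n')%N & cls n' (lam n).
  case: n IH => [|m] IH; first by have [n' cn'] := all_c 0%N; exists n'.
  have cm := IH m (ltnSn m).
  have := lam_le m m.+1 (leqnSn m); rewrite le_eqVlt => /predU1P[E|lt].
    (* A repeated value has two classes [j] and [j.+1]. If [m] were the upper one, [lam j] would be
       a third copy of the value. *)
    have mS : m <> m.+1 by lia.
    have [j [cj cj1]] := two_c _ _ mS E.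
    have h1 := c_adj _ _ _ cm cj; have h2 := c_adj _ _ _ cj1 cm.
    have [jm|jm] : j = m \/ m = j.+1 by lia.
      by exists j.+1; [rewrite jm|rewrite -E].
    have jlt : (j < m.+1)%N by lia.
    have cjj := IH j jlt.
    have E2 : lam j = lam m := c_uniq _ _ _ cjj cj.
    by have [] := no3 _ _ _ E2 E; lia.
  have [n' cn'] := all_c m.+1.
  by exists n' => //; exact: c_lt lt cm cn'.
move: nn'; rewrite leq_eqVlt => /predU1P[E|nn']; first by rewrite {1}E.
have [y cy] := c_below _ _ _ cn' nn'.
have [lt|gt|E] := ltgtP y (lam n); last by rewrite -E.
(* The value [y] occurs at an earlier index [k], so it has the classes [k] and [n], which forces
   [n = k.+1] and a double value. Its second index would lie below [k] and give a class too far from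
   [n]. *)
- have [k Ek] := c_ex _ _ cy.
  have kn : (k < n)%N.
    rewrite ltnNge; apply/negP => /lam_le; rewrite Ek => h.
    by have := le_lt_trans h lt; rewrite ltxx.
  have ck := IH k kn; rewrite Ek in ck.
  have nk : n = k.+1 by have := c_adj _ _ _ cy ck; lia.
  rewrite nk in cy.
  have [i [j [ij ei ej]]] := c_two _ _ ck cy.
  have other l : lam l = y -> l <> k -> False.
    move=> el lk.
    have ln : (l < n)%N.
      rewrite ltnNge; apply/negP => /lam_le; rewrite el => h.
      by have := le_lt_trans h lt; rewrite ltxx.
    have cl := IH l ln; rewrite el in cl.
    by have := c_adj _ _ _ cy cl; lia.
  have [ik|/eqP ik] := eqVneq i k; last by case: (other i ei ik).
  by case: (other j ej) => jk; apply: ij; rewrite ik jk.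
- by have := c_lt _ _ _ _ gt cn' cy; lia.
Qed.

Lemma count_window (n m : nat) : (n < m.+2)%N -> (m < n.+2)%N ->
  (n = 0%N -> m = 0%N \/ m = 1%N) /\ ((1 <= n)%N -> [\/ m = n.-1, m = n | m = n.+1]).
Proof.
move=> h1 h2; split=> [n0|n1]; first by lia.
have [h|[h|h]] : m = n.-1 \/ m = n \/ m = n.+1 by lia.
- exact: Or31.
- exact: Or32.
- exact: Or33.
Qed.

(** * Counting zeros by the angle *)

Section zeros.
Context {R : realType} (a b : R) (ip q r s : R -> R).
Hypotheses (ab : a < b) (Lip : L1 a b ip) (Lq : L1 a b q) (Lr : L1 a b r)
  (Ls : L1 a b s) (ip0 : ae (fun x => a < x < b -> 0 < ip x)).

Local Notation F := (F a b ip q r s).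
Local Notation Th := (Th a b ip q r s).

(* The angle increases through the multiples of [pi], hence takes the values
   [pi], ..., [m pi] exactly once each, and no other multiple of [pi]. *)
Lemma angle_zeros lam al : 0 < al <= pi -> exists m : nat,
  zeros_number `[a, b[%classic (fun x => sin (Th lam al x)) m /\
  m%:R * pi < F lam al <= m.+1%:R * pi.
Proof.
move=> /andP[al0 alpi]; have pi0 := @pi_gt0 R.
have cross := Th_cross ab Lip Lq Lr Ls ip0.
have Tha : Th lam al a = al by exact: Th_a.
have F0 : 0 < F lam al by apply: F_gt0 => //; exact: ltW.
have ex : exists m : nat, F lam al <= m.+1%:R * pi.
  exists (Num.bound (F lam al / pi)).
  have := archi_boundP (ltW (divr_gt0 F0 pi0)); rewrite ltr_pdivrMr// => /ltW h.
  by rewrite (le_trans h)// ler_pM2r// ler_nat.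
(* The upper bound on [F] is not strict: when [F] equals [(m + 1) pi] the solution vanishes at [b],
   which the half-open interval leaves out. *)
have [m Fm mmin] := ex_minnP ex; exists m.
have mF : m%:R * pi < F lam al.
  case: m mmin {Fm} => [|m] mmin; first by rewrite mul0r.
  by rewrite ltNge; apply/negP => /mmin; rewrite ltnn.
split; last by rewrite mF.
have level (i : nat) : (i < m)%N -> exists x, a <= x < b /\ Th lam al x = i.+1%:R * pi.
  move=> im.
  have h1 : al <= i.+1%:R * pi.
    by rewrite (le_trans alpi)// ler_peMl ?(ltW pi0)// ler1n.
  have h2 : i.+1%:R * pi < F lam al.
    by apply: le_lt_trans mF; rewrite ler_pM2r// ler_nat.
  have mid : Num.min (Th lam al a) (Th lam al b) <= i.+1%:R * pi <=
      Num.max (Th lam al a) (Th lam al b).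
    rewrite ge_min le_max Tha -/(F lam al); apply/andP; split; apply/orP; [left|right] => //.
    exact: ltW.
  have [x] := IVT (ltW ab) (ac_continuous (Th_acd ab Lip Lq Lr Ls lam al).1) mid.
  rewrite in_itv/= => /andP[ax xb] ThE; exists x; split=> //; rewrite ax lt_neqAle xb andbT.
  by apply/eqP => xE; move: h2; rewrite -ThE xE ltxx.
have uniq x y t : sin t = 0 -> a <= x <= b -> a <= y <= b ->
    Th lam al x = t -> Th lam al y = t -> x = y.
  move=> st axb ayb ex' ey.
  have [xy|yx|//] := ltgtP x y.
    have := cross lam al t x y st ltac:(lra) ltac:(by rewrite ex') ltac:(lra).
    by rewrite ey ltxx.
  have := cross lam al t y x st ltac:(lra) ltac:(by rewrite ey) ltac:(lra).
  by rewrite ex' ltxx.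
have [g Hg] : exists g : nat -> R, forall i, (i < m)%N ->
    a <= g i < b /\ Th lam al (g i) = i.+1%:R * pi.
  have ex' (i : nat) : exists x, (i < m)%N -> a <= x < b /\ Th lam al x = i.+1%:R * pi.
    have [im|mi] := ltnP i m; first by have [x Hx] := level i im; exists x.
    by exists 0.
  by have [g Hg] := choice ex'; exists g.
have sin_n (n : nat) : sin (n%:R * pi : R) = 0.
  by rewrite -[_ * _]add0r sinDnpi sin0 mulr0.
rewrite /zeros_number.
have -> : [set x | `[a, b[%classic x /\ sin (Th lam al x) = 0] = g @` `I_m.
  apply/seteqP; split => [x [/=]|x /= [i im <-]]; last first.
    have [gi Thg] := Hg i im; split; first by rewrite in_itv.
    by rewrite Thg sin_n.
  rewrite in_itv/= => axb sx.
  have Th0 : 0 < Th lam al x.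
    have [ax|xa] := ltP a x; last by rewrite (_ : x = a) ?Tha//; lra.
    by apply: (cross lam al 0 a) => //; rewrite ?sin0 ?Tha//; lra.
  have ThF : Th lam al x < F lam al by apply: (cross lam al _ x) => //; lra.
  have Thx := sin_eq0 sx; set j := Num.floor _ in Thx.
  have j0 : 0 < j by move: Th0; rewrite Thx pmulr_lgt0// ltr0z.
  have [i ji] := int_gt0_succ j0.
  have im : (i < m)%N.
    have : i.+1%:R * pi < m.+1%:R * pi :> R.
      by rewrite [i.+1%:R]pmulrn -ji -Thx; exact: lt_le_trans ThF Fm.
    by rewrite ltr_pM2r// ltr_nat.
  exists i => //; have [gi Thg] := Hg i im.
  apply: (uniq _ _ (i.+1%:R * pi)) => //; try lra.
  by rewrite Thx ji -pmulrn.
apply: inj_card_eq => i j /set_mem/= im /set_mem/= jm E.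
have [_ h1] := Hg i im; have [_ h2] := Hg j jm.
move: h1; rewrite E h2 => /(mulIf (lt0r_neq0 pi0)).
by move/eqP; rewrite eqr_nat => /eqP [].
Qed.

Lemma lsol_zeros n lam u u1 : lsol a b ip s (pot q r lam) u u1 ->
  (u a != 0) || (u1 a != 0) ->
  (forall al, 0 < al <= pi -> n%:R * pi - pi < F lam al <= n%:R * pi + 2 * pi) ->
  zeros_count_claim a b u n.
Proof.
move=> hu u0 HF; have pi0 := @pi_gt0 R.
have [k [al [k0 al0 ex ey]]] := polar u0.
have [m [Z mF]] := angle_zeros lam al0.
exists m.
  move: Z; rewrite /zeros_number.
  suff -> : [set x | `[a, b[%classic x /\ sin (Th lam al x) = 0] =
    [set x | `[a, b[%classic x /\ u x = 0] by [].
  apply/seteqP; split=> x /= [axb]; move: (axb); rewrite in_itv/= => axb' h; split=> //.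
    have [-> _] := lsol_polar (ltW ab) Lip Ls (L1_pot Lq Lr lam) hu ex ey
      (ltac:(lra) : a <= x <= b).
    by rewrite /psin -/(Th lam al x) h !mulr0.
  move: h.
  have [-> _] := lsol_polar (ltW ab) Lip Ls (L1_pot Lq Lr lam) hu ex ey
    (ltac:(lra) : a <= x <= b).
  move/eqP; rewrite /psin -/(Th lam al x) !mulf_eq0 (negbTE k0).
  by rewrite (gt_eqF (expR_gt0 _)) => /eqP.
have := HF al al0.
have e1 : n%:R * pi - pi = (n%:R - 1) * pi :> R by ring.
have e2 : n%:R * pi + 2 * pi = (n.+2)%:R * pi :> R by rewrite -addn2 natrD; ring.
rewrite e1 e2 => /andP[h1 h2]; move: mF => /andP[h3 h4].
have h5 : (n < m.+2)%N.
  rewrite -(ltr_nat R) -addn1 -[m.+1]addn1 !natrD -(ltr_pM2r pi0).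
  have := lt_le_trans h1 h4; rewrite -addn1 natrD; lra.
have h6 : (m < n.+2)%N.
  by rewrite -(ltr_nat R) -(ltr_pM2r pi0); exact: lt_le_trans h3 h2.
exact: count_window.
Qed.

End zeros.

(** * Complex solutions and multiplicities *)

Section complex_solutions.
Context {R : realType} (a b : R) (p q r s ip gq gr gs : R -> R).
Hypotheses (ab : a < b) (Lip : L1 a b ip) (Lq : L1 a b gq) (Lr : L1 a b gr)
  (Ls : L1 a b gs)
  (coef : ae (fun x => a < x < b ->
    [/\ 0 < p x, (p x)^-1 = ip x, q x = gq x, r x = gr x & s x = gs x])).
Implicit Types (lam : R) (y : R -> R[i]) (c : R[i]).

Local Notation pot := (pot gq gr).
Local Notation Re := complex.Re.
Local Notation Im := complex.Im.

Lemma Re_real_mul (x : R) (z : R[i]) : Re (x%:C * z) = x * Re z.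
Proof. by case: z => u v /=; ring. Qed.

Lemma Im_real_mul (x : R) (z : R[i]) : Im (x%:C * z) = x * Im z.
Proof. by case: z => u v /=; ring. Qed.

Lemma ReD (z w : R[i]) : Re (z + w) = Re z + Re w.
Proof. by case: z w => [u v] [u' v']. Qed.

Lemma ImD (z w : R[i]) : Im (z + w) = Im z + Im w.
Proof. by case: z w => [u v] [u' v']. Qed.

Lemma ReN (z : R[i]) : Re (- z) = - Re z.
Proof. by case: z. Qed.

Lemma ImN (z : R[i]) : Im (- z) = - Im z.
Proof. by case: z. Qed.

Lemma complexP (z w : R[i]) : Re z = Re w -> Im z = Im w -> z = w.
Proof. by case: z w => [u v] [u' v'] /= -> ->. Qed.

Lemma ReIm_eq (z w : R[i]) : z = w -> Re z = Re w /\ Im z = Im w.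
Proof. by move->. Qed.

(** Real and imaginary parts decouple because the parameter and the coefficients are real; the
    coefficients are exchanged for integrable representatives. *)
Lemma sl_solution_lsol lam y y1 : sl_solution a b p q r s lam%:C y y1 ->
  lsol a b ip gs (pot lam) (fun x => Re (y x)) (fun x => Re (y1 x)) /\
  lsol a b ip gs (pot lam) (fun x => Im (y x)) (fun x => Im (y1 x)).
Proof.
move=> [[ac1 ac2] [ac3 ac4] d1 d2].
have d1' : ae (fun x => a < x < b ->
    is_derive x 1 (fun t => Re (y t)) (ip x * Re (y1 x) - gs x * Re (y x)) /\
    is_derive x 1 (fun t => Im (y t)) (ip x * Im (y1 x) - gs x * Im (y x))).
  apply: ae2 coef d1 => x cx H axb; have [p0 <- _ _ <-] := cx axb.
  have [|dy [h1 h2] E] := H; first by rewrite /= in_itv.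
  rewrite E !Re_real_mul !Im_real_mul ReD ImD Re_real_mul Im_real_mul !mulKf ?gt_eqF//.
  by rewrite !addrK.
have d2' : ae (fun x => a < x < b ->
    is_derive x 1 (fun t => Re (y1 t)) (gs x * Re (y1 x) + pot lam x * Re (y x)) /\
    is_derive x 1 (fun t => Im (y1 t)) (gs x * Im (y1 x) + pot lam x * Im (y x))).
  apply: ae2 coef d2 => x cx H axb; rewrite /pot; have [p0 _ <- <- <-] := cx axb.
  have [|dy [h1 h2] E] := H; first by rewrite /= in_itv.
  have [] := ReIm_eq E.
  rewrite -(mulrA lam%:C) !(ReD, ImD, Re_real_mul, Im_real_mul, ReN, ImN) => e1 e2.
  have -> : s x * Re (y1 x) + (q x - lam * r x) * Re (y x) = Re dy by lra.
  have -> : s x * Im (y1 x) + (q x - lam * r x) * Im (y x) = Im dy by lra.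
  by [].
split; split; split=> //.
- by apply: ae1 d1' => x H /H[].
- by apply: ae1 d2' => x H /H[].
- by apply: ae1 d1' => x H /H[].
- by apply: ae1 d2' => x H /H[].
Qed.

Lemma lsol_sl_solution lam u u1 v v1 :
  lsol a b ip gs (pot lam) u u1 -> lsol a b ip gs (pot lam) v v1 ->
  sl_solution a b p q r s lam%:C (fun x => u x +i* v x) (fun x => u1 x +i* v1 x).
Proof.
move=> [[au du] [au1 du1]] [[av dv] [av1 dv1]]; split; try by split.
  suff H : ae (fun x => `]a, b[%classic x -> exists2 dy,
      is_cderive x (fun x => u x +i* v x) dy &
      u1 x +i* v1 x = (p x)%:C * (dy + (s x)%:C * (u x +i* v x))) by [].
  apply: ae2 (ae_and coef du) dv => x [cx dux] dvx; rewrite /= in_itv/= => axb.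
  have [p0 pE _ _ sE] := cx axb.
  exists ((ip x * u1 x - gs x * u x) +i* (ip x * v1 x - gs x * v x)).
    by split; [exact: dux|exact: dvx].
  apply: complexP => /=; rewrite -pE -sE; field; rewrite gt_eqF//.
suff H : ae (fun x => `]a, b[%classic x -> exists2 dy1,
    is_cderive x (fun x => u1 x +i* v1 x) dy1 &
    - dy1 + (s x)%:C * (u1 x +i* v1 x) + (q x)%:C * (u x +i* v x)
      = lam%:C * (r x)%:C * (u x +i* v x)) by [].
apply: ae2 (ae_and coef du1) dv1 => x [cx dux] dvx; rewrite /= in_itv/= => axb.
have [p0 _ qE rE sE] := cx axb.
exists ((gs x * u1 x + pot lam x * u x) +i* (gs x * v1 x + pot lam x * v x)).
  by split; [exact: dux|exact: dvx].
by apply: complexP => /=; rewrite /pot -qE -rE -sE; ring.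
Qed.

Local Notation fs lam := (psin a b ip gs (pot lam)).
Local Notation fc lam := (pcos a b ip gs (pot lam)).

Let Lpot lam : L1 a b (pot lam) := L1_pot Lq Lr lam.

Lemma lsol_fund lam u u1 : lsol a b ip gs (pot lam) u u1 ->
  forall x, a <= x <= b ->
  u x = u a * fs lam (pi / 2) x + u1 a * fs lam 0 x /\
  u1 x = u a * fc lam (pi / 2) x + u1 a * fc lam 0 x.
Proof.
move=> hu.
have h1 := lsolZ (u a) (lsol_pruefer (ltW ab) Lip Ls (Lpot lam) (pi / 2)).
have h2 := lsolZ (u1 a) (lsol_pruefer (ltW ab) Lip Ls (Lpot lam) 0).
have e0 : u a = u a * fs lam (pi / 2) a + u1 a * fs lam 0 a.
  by rewrite !(psin_c (ltW ab) Lip Ls (Lpot lam)) sin_pihalf sin0; ring.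
have e1 : u1 a = u a * fc lam (pi / 2) a + u1 a * fc lam 0 a.
  by rewrite !(pcos_c (ltW ab) Lip Ls (Lpot lam)) cos_pihalf cos0; ring.
exact: (lsol_uniq Lip Ls (Lpot lam) hu (lsolD h1 h2) e0 e1).
Qed.

Definition combo lam (c0 c1 : R[i]) x : R[i] :=
  c0 * (fs lam (pi / 2) x)%:C + c1 * (fs lam 0 x)%:C.

Definition combo1 lam (c0 c1 : R[i]) x : R[i] :=
  c0 * (fc lam (pi / 2) x)%:C + c1 * (fc lam 0 x)%:C.

Lemma combo_solution lam c0 c1 :
  sl_solution a b p q r s lam%:C (combo lam c0 c1) (combo1 lam c0 c1).
Proof.
case: c0 c1 => [u0 v0] [u1 v1].
have h1 := lsol_pruefer (ltW ab) Lip Ls (Lpot lam) (pi / 2).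
have h2 := lsol_pruefer (ltW ab) Lip Ls (Lpot lam) 0.
have := lsol_sl_solution (lsolD (lsolZ u0 h1) (lsolZ u1 h2))
  (lsolD (lsolZ v0 h1) (lsolZ v1 h2)).
congr sl_solution; apply: funext => x; apply: complexP; rewrite /combo /combo1 /=; ring.
Qed.

Lemma combo_a lam c0 c1 : combo lam c0 c1 a = c0 /\ combo1 lam c0 c1 a = c1.
Proof.
rewrite /combo /combo1 !(psin_c (ltW ab) Lip Ls (Lpot lam)).
rewrite !(pcos_c (ltW ab) Lip Ls (Lpot lam)) sin_pihalf sin0 cos_pihalf cos0.
by rewrite !mulr1 !mulr0 addr0 add0r.
Qed.

Lemma solution_combo lam y y1 : sl_solution a b p q r s lam%:C y y1 ->
  forall x, a <= x <= b ->
  y x = combo lam (y a) (y1 a) x /\ y1 x = combo1 lam (y a) (y1 a) x.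
Proof.
move=> /sl_solution_lsol[hr hi] x axb.
have [e1 e2] := lsol_fund hr axb; have [e3 e4] := lsol_fund hi axb.
split; apply: complexP; rewrite /combo /combo1 !(mulrC _ (real_complex _ _)).
- by rewrite ReD !Re_real_mul e1; ring.
- by rewrite ImD !Im_real_mul e3; ring.
- by rewrite ReD !Re_real_mul e2; ring.
- by rewrite ImD !Im_real_mul e4; ring.
Qed.

(** Multiplicity counts functions [y] without [y1], so the data must be recovered from [y] alone.
    The value at [a] gives [c0]; for [c1], the solution with data (0, 1) has its angle in (0, pi)
    just after [a] and does not vanish there. *)
Lemma combo_eq0 lam c0 c1 : ae (fun x => a < x < b -> 0 < ip x) ->
  (forall x, a <= x <= b -> combo lam c0 c1 x = 0) -> c0 = 0 /\ c1 = 0.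
Proof.
move=> ip0 H.
have c00 : c0 = 0 by rewrite -(combo_a lam c0 c1).1 H// lexx ltW.
split=> //.
pose th := Th a b ip gq gr gs lam 0.
have acth : abs_continuous a b th by case: (Th_acd ab Lip Lq Lr Ls lam 0).
have tha : th a = 0 by exact: Th_a.
have [dl dl0 Hdl] := ac_unif acth (@pi_gt0 R).
pose x := Num.min b (a + dl / 2).
have xb : x <= b by rewrite ge_min lexx.
have ax : a < x by rewrite lt_min ab/=; lra.
have xdl : x <= a + dl / 2 by rewrite ge_min lexx orbT.
have axb : a <= x <= b by rewrite (ltW ax).
have thx : 0 < th x.
  apply: (Th_cross ab Lip Lq Lr Ls ip0 (x0 := a)) => //; first exact: sin0.
  - by rewrite -/th tha.
  - by rewrite ax.
have := Hdl a x ltac:(by rewrite lexx ltW) axb.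
rewrite tha subr0 !gtr0_norm ?subr_gt0// => /(_ ltac:(lra)) thpi.
have fx : fs lam 0 x != 0.
  rewrite /psin -/(Th a b ip gq gr gs lam 0 x) mulf_neq0 ?gt_eqF ?expR_gt0//.
  by apply: sin_gt0_pi; rewrite thx.
have := H x axb; rewrite /combo c00 mul0r add0r => /eqP.
rewrite mulf_eq0 => /orP[/eqP//|/eqP/ReIm_eq[/= h _]].
by rewrite h eqxx in fx.
Qed.

Lemma boundary_condition (K : 'M[R]_2) (e : R[i]) (y y1 : R -> R[i]) :
  sl_vec y y1 b = (e *: cmatrix K) *m sl_vec y y1 a <->
  y b = e * ((K 0 0)%:C * y a + (K 0 1)%:C * y1 a) /\
  y1 b = e * ((K 1 0)%:C * y a + (K 1 1)%:C * y1 a).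
Proof.
have mE i : ((e *: cmatrix K) *m sl_vec y y1 a) i 0 =
    e * ((K i 0)%:C * y a + (K i 1)%:C * y1 a).
  rewrite mxE !big_ord_recl big_ord0 addr0 !mxE/=.
  by rewrite -!mulrA -mulrDr; congr (_ * (_ * _ + _%:C * _)); congr (K _ _); apply: val_inj.
split=> [E|[E0 E1]].
  have := congr1 (fun A : 'cV[R[i]]_2 => A 0 0) E.
  have := congr1 (fun A : 'cV[R[i]]_2 => A 1 0) E.
  by rewrite !mE !mxE/= => -> ->.
apply/colP => i; rewrite mE mxE.
by case: i => -[|[|i]] // hi /=; [rewrite E0|rewrite E1];
  congr (_ * (_%:C * _ + _%:C * _)); congr (K _ _); apply: val_inj.
Qed.

End complex_solutions.

(** * Eigenvectors of two by two matrices *)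

Section eigenvectors.

(** Multiplication by the inverse of [K], which is its adjugate, turns [Phi v = e K v] into
    [K^-1 Phi v = e v]. *)
Lemma boundary_eigenvector (A : comPzRingType)
    (k11 k12 k21 k22 f11 f12 f21 f22 c0 c1 e : A) :
  k11 * k22 - k12 * k21 = 1 ->
  (c0 * f11 + c1 * f12 = e * (k11 * c0 + k12 * c1) /\
   c0 * f21 + c1 * f22 = e * (k21 * c0 + k22 * c1)) <->
  ((k22 * f11 - k12 * f21) * c0 + (k22 * f12 - k12 * f22) * c1 = e * c0 /\
   (k11 * f21 - k21 * f11) * c0 + (k11 * f22 - k21 * f12) * c1 = e * c1).
Proof.
move=> detK; split=> -[h1 h2].
  split.
    transitivity (k22 * (c0 * f11 + c1 * f12) - k12 * (c0 * f21 + c1 * f22)); first ring.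
    rewrite h1 h2; transitivity ((k11 * k22 - k12 * k21) * (e * c0)); first ring.
    by rewrite detK mul1r.
  transitivity (k11 * (c0 * f21 + c1 * f22) - k21 * (c0 * f11 + c1 * f12)); first ring.
  rewrite h1 h2; transitivity ((k11 * k22 - k12 * k21) * (e * c1)); first ring.
  by rewrite detK mul1r.
split.
  transitivity ((k11 * k22 - k12 * k21) * (c0 * f11 + c1 * f12)); first by rewrite detK mul1r.
  transitivity (k11 * ((k22 * f11 - k12 * f21) * c0 + (k22 * f12 - k12 * f22) * c1) +
    k12 * ((k11 * f21 - k21 * f11) * c0 + (k11 * f22 - k21 * f12) * c1)); first ring.
  by rewrite h1 h2; ring.
transitivity ((k11 * k22 - k12 * k21) * (c0 * f21 + c1 * f22)); first by rewrite detK mul1r.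
transitivity (k21 * ((k22 * f11 - k12 * f21) * c0 + (k22 * f12 - k12 * f22) * c1) +
  k22 * ((k11 * f21 - k21 * f11) * c0 + (k11 * f22 - k21 * f12) * c1)); first ring.
by rewrite h1 h2; ring.
Qed.

Context {R : realType}.

Lemma real_complexBM (x y z w : R) :
  (x * y - z * w)%:C = x%:C * y%:C - z%:C * w%:C :> R[i].
Proof. by rewrite rmorphB !rmorphM. Qed.

(** With determinant 1, the characteristic polynomial at [cexpi g] equals [cexpi g] times
    [2 * cos g - (x11 + x22)]. *)
Lemma cexpi_characteristic (x11 x12 x21 x22 g : R) : x11 * x22 - x12 * x21 = 1 ->
  (x11%:C - cexpi g) * (x22%:C - cexpi g) - x12%:C * x21%:C = 0 <->
  x11 + x22 = 2 * cos g.
Proof.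
move=> dx; have cs := cos2Dsin2 g.
split=> [/ReIm_eq[]|tr].
  rewrite /cexpi /=; move: (cos g) (sin g) cs => C S cs.
  move=> h1 h2.
  have e1 : C * (2 * C - (x11 + x22)) = 0.
    transitivity (C ^+ 2 + S ^+ 2 - 1 + (x11 * x22 - x12 * x21 - (x11 + x22) * C +
      C ^+ 2 - S ^+ 2)); first by rewrite dx; ring.
    by rewrite cs subrr add0r; move: h1; lra.
  have e2 : S * (2 * C - (x11 + x22)) = 0 by move: h2; lra.
  apply/esym/subr0_eq; transitivity ((C ^+ 2 + S ^+ 2) * (2 * C - (x11 + x22))).
    by rewrite cs mul1r.
  transitivity (C * (C * (2 * C - (x11 + x22))) + S * (S * (2 * C - (x11 + x22)))); first ring.
  by rewrite e1 e2 !mulr0 addr0.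
apply: complexP; rewrite /cexpi /=; move: (cos g) (sin g) cs tr => C S cs tr.
  transitivity ((x11 * x22 - x12 * x21) - (x11 + x22) * C + 2 * C ^+ 2 - (C ^+ 2 + S ^+ 2)).
    by ring.
  by rewrite dx tr cs; ring.
transitivity (- (x11 + x22) * S + 2 * C * S); first ring.
by rewrite tr; ring.
Qed.

Lemma cexpi_scalar (x11 x12 x21 x22 g : R) : x11 * x22 - x12 * x21 = 1 ->
  x11 + x22 = 2 * cos g -> x12 = 0 -> x21 = 0 -> x11 = x22 -> cexpi g = x11%:C.
Proof.
move=> dx tr e12 e21 e; have x1 : x11 = cos g by move: tr; rewrite -e; lra.
have s2 : sin g ^+ 2 = 0.
  by rewrite sin2cos2 -x1; move: dx; rewrite e12 -e mul0r; lra.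
have s0 : sin g = 0 by apply/eqP; rewrite -sqrf_eq0 s2.
by rewrite /cexpi s0 -x1.
Qed.

Lemma kernel_char (A : fieldType) (y11 y12 y21 y22 e c0 c1 : A) :
  (c0 != 0) || (c1 != 0) ->
  y11 * c0 + y12 * c1 = e * c0 -> y21 * c0 + y22 * c1 = e * c1 ->
  (y11 - e) * (y22 - e) - y12 * y21 = 0.
Proof.
move=> c h1 h2; set X := _ - _.
have X0 : X * c0 = 0.
  transitivity ((y22 - e) * (y11 * c0 + y12 * c1 - e * c0) -
    y12 * (y21 * c0 + y22 * c1 - e * c1)); first by rewrite /X; ring.
  by rewrite h1 h2 !subrr !mulr0 subrr.
have X1 : X * c1 = 0.
  transitivity ((y11 - e) * (y21 * c0 + y22 * c1 - e * c1) -
    y21 * (y11 * c0 + y12 * c1 - e * c0)); first by rewrite /X; ring.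
  by rewrite h1 h2 !subrr !mulr0 subrr.
case/orP: c => c.
  by apply/eqP; move/eqP: X0; rewrite mulf_eq0 (negbTE c) orbF.
by apply/eqP; move/eqP: X1; rewrite mulf_eq0 (negbTE c) orbF.
Qed.

Lemma cramer2 (A : fieldType) (u v c0 c1 d0 d1 : A) : c0 * d1 - c1 * d0 != 0 ->
  u * c0 + v * c1 = 0 -> u * d0 + v * d1 = 0 -> u = 0 /\ v = 0.
Proof.
move=> det h1 h2; split; apply: (mulfI det); rewrite mulr0.
  transitivity (d1 * (u * c0 + v * c1) - c1 * (u * d0 + v * d1)); first ring.
  by rewrite h1 h2 !mulr0 subrr.
transitivity (c0 * (u * d0 + v * d1) - d0 * (u * c0 + v * c1)); first ring.
by rewrite h1 h2 !mulr0 subrr.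
Qed.

Lemma sum_delta (A : nzRingType) k (i : 'I_k) (x : A) (g : 'I_k -> A) :
  \sum_(l < k) (x * (l == i)%:R) * g l = x * g i.
Proof.
rewrite (bigD1 i)//= eqxx mulr1 big1 ?addr0// => l /negbTE ->.
by rewrite mulr0 mul0r.
Qed.

Lemma det_mx2 (A : comNzRingType) (K : 'M[A]_2) :
  \det K = K 0 0 * K 1 1 - K 0 1 * K 1 0.
Proof.
rewrite (expand_det_row _ ord0) !big_ord_recl big_ord0 addr0 /cofactor !det_mx11 !mxE.
rewrite /= expr0 mul1r expr1 mulN1r mulrN.
by congr (K _ _ * K _ _ - K _ _ * K _ _); apply: val_inj.
Qed.

End eigenvectors.

(** * Eigenspaces of the boundary value problem *)

Section boundary_value_problem.
Context {R : realType} (a b : R) (p q r s ip gq gr gs : R -> R).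
Hypotheses (ab : a < b) (Lip : L1 a b ip) (Lq : L1 a b gq) (Lr : L1 a b gr)
  (Ls : L1 a b gs)
  (coef : ae (fun x => a < x < b ->
    [/\ 0 < p x, (p x)^-1 = ip x, q x = gq x, r x = gr x & s x = gs x]))
  (ip0 : ae (fun x => a < x < b -> 0 < ip x))
  (r0 : ae (fun x => a < x < b -> 0 < gr x)).
Variables (K : 'M[R]_2) (g : R).
Hypothesis detK : \det K = 1.
Implicit Types (lam : R) (c d : R[i]) (k : nat).

Let dK : K 0 0 * K 1 1 - K 0 1 * K 1 0 = 1.
Proof. by rewrite -det_mx2. Qed.

Local Notation e := (cexpi g).
Local Notation M := (e *: cmatrix K).
Local Notation M11 := (m11 a b ip gq gr gs (K 0 1) (K 1 1)).
Local Notation M12 := (m12 a b ip gq gr gs (K 0 1) (K 1 1)).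
Local Notation M21 := (m21 a b ip gq gr gs (K 0 0) (K 1 0)).
Local Notation M22 := (m22 a b ip gq gr gs (K 0 0) (K 1 0)).
Local Notation y_ := (combo a b ip gq gr gs).

Let detM lam : M11 lam * M22 lam - M12 lam * M21 lam = 1.
Proof. exact: det_m. Qed.

Definition eigvec lam c d :=
  (M11 lam)%:C * c + (M12 lam)%:C * d = e * c /\
  (M21 lam)%:C * c + (M22 lam)%:C * d = e * d.

Lemma combo_boundary lam c d :
  sl_vec (y_ lam c d) (combo1 a b ip gq gr gs lam c d) b =
    M *m sl_vec (y_ lam c d) (combo1 a b ip gq gr gs lam c d) a <->
  eigvec lam c d.
Proof.
have [ea e1a] := combo_a ab Lip Lq Lr Ls lam c d.
have dKC : (K 0 0)%:C * (K 1 1)%:C - (K 0 1)%:C * (K 1 0)%:C = 1 :> R[i].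
  by rewrite -real_complexBM dK.
rewrite boundary_condition ea e1a /eigvec /m11 /m12 /m21 /m22 !real_complexBM.
exact: boundary_eigenvector dKC.
Qed.

Lemma solution_eigvec lam y y1 : sl_solution a b p q r s lam%:C y y1 ->
  sl_vec y y1 b = M *m sl_vec y y1 a -> eigvec lam (y a) (y1 a).
Proof.
move=> hy bc; have H := solution_combo ab Lip Lq Lr Ls coef hy.
have inb : a <= b <= b by rewrite lexx ltW.
apply/combo_boundary.
have [ea e1a] := combo_a ab Lip Lq Lr Ls lam (y a) (y1 a).
have [eb e1b] := H b inb.
by move/boundary_condition: bc => bc; apply/boundary_condition; rewrite ea e1a -eb -e1b.
Qed.

Lemma eigenspace_combo lam y : sl_eigenspace a b p q r s M lam%:C y ->
  exists c d, eigvec lam c d /\ forall x, a <= x <= b -> y x = y_ lam c d x.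
Proof.
move=> [y1 hy bc]; exists (y a), (y1 a); split; first exact: solution_eigvec.
by move=> x /(solution_combo ab Lip Lq Lr Ls coef hy)[].
Qed.

Lemma combo_eigenspace lam c d : eigvec lam c d ->
  sl_eigenspace a b p q r s M lam%:C (y_ lam c d).
Proof.
move=> /combo_boundary bc; exists (combo1 a b ip gq gr gs lam c d) => //.
exact: combo_solution.
Qed.

Lemma eigvec_trace lam c d : (c != 0) || (d != 0) -> eigvec lam c d ->
  M11 lam + M22 lam = 2 * cos g.
Proof.
by move=> cd [h1 h2]; apply/(cexpi_characteristic _ (detM lam)); exact: kernel_char cd h1 h2.
Qed.

Lemma eigvec_exists lam : M11 lam + M22 lam = 2 * cos g ->
  exists c d, ((c != 0) || (d != 0)) /\ eigvec lam c d.
Proof.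
move=> /(cexpi_characteristic _ (detM lam))/kernel2[c [d [cd h1 h2]]].
exists c, d; split=> //; split; apply/subr0_eq.
  by rewrite -[RHS]h1; ring.
by rewrite -[RHS]h2; ring.
Qed.

Section basis.
Variables (lam : R) (k : nat) (f : 'I_k -> R -> R[i]).
Hypotheses (fE : forall i, sl_eigenspace a b p q r s M lam%:C (f i))
  (f_free : forall c : 'I_k -> R[i],
    (forall x, `[a, b]%classic x -> \sum_(i < k) c i * f i x = 0) ->
    forall i, c i = 0)
  (f_span : forall y, sl_eigenspace a b p q r s M lam%:C y ->
    exists c : 'I_k -> R[i],
    forall x, `[a, b]%classic x -> y x = \sum_(i < k) c i * f i x).

Let in_ab x : `[a, b]%classic x -> a <= x <= b.
Proof. by rewrite /= in_itv. Qed.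

(** Solutions depend linearly on their data at [a], so a relation between the data is one between
    the functions. Multiplicities become a matter of vectors in the complex plane. *)
Lemma basis_coordinates : exists C0 C1 : 'I_k -> R[i],
  (forall i, eigvec lam (C0 i) (C1 i)) /\
  forall w : 'I_k -> R[i], \sum_(i < k) w i * C0 i = 0 ->
    \sum_(i < k) w i * C1 i = 0 -> forall i, w i = 0.
Proof.
have ex i : exists cd : R[i] * R[i], eigvec lam cd.1 cd.2 /\
    forall x, a <= x <= b -> f i x = y_ lam cd.1 cd.2 x.
  by have [c [d [h1 h2]]] := eigenspace_combo (fE i); exists (c, d).
have [cd Hcd] := choice ex.
exists (fun i => (cd i).1), (fun i => (cd i).2); split; first by move=> i; have [] := Hcd i.
move=> w w0 w1; apply: f_free => x /in_ab axb.
rewrite (eq_bigr (fun i => w i * (cd i).1 * (psin a b ip gs (pot gq gr lam) (pi / 2) x)%:C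
   + w i * (cd i).2 * (psin a b ip gs (pot gq gr lam) 0 x)%:C)).
  by rewrite big_split/= -!mulr_suml w0 w1 !mul0r addr0.
by move=> i _; have [_ ->//] := Hcd i; rewrite /combo; ring.
Qed.

Lemma basis_pos : M11 lam + M22 lam = 2 * cos g -> (0 < k)%N.
Proof.
move=> /eigvec_exists[c [d [cd ev]]]; rewrite lt0n; apply/eqP => k0.
have [w Hw] := f_span (combo_eigenspace ev).
have [c0 d0] : c = 0 /\ d = 0.
  apply: (combo_eq0 ab Lip Lq Lr Ls ip0 (lam := lam)) => x axb.
  by rewrite Hw/= ?in_itv//; apply: big1 => i; move: (ltn_ord i); rewrite {2}k0.
by move: cd; rewrite c0 d0 eqxx.
Qed.

Lemma basis_double : M11 lam + M22 lam = 2 * cos g -> M12 lam = 0 ->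
  M21 lam = 0 -> M11 lam = M22 lam -> (1 < k)%N.
Proof.
move=> tr e12 e21 ee; have k0 := basis_pos tr.
rewrite ltn_neqAle k0 andbT; apply/eqP => k1.
have scal := cexpi_scalar (detM lam) tr e12 e21 ee.
have ev c d : eigvec lam c d.
  by rewrite /eigvec e12 e21 -ee scal rmorph0 !mul0r addr0 add0r.
pose i0 := Ordinal k0.
have all0 i : i = i0 by apply: val_inj; have := ltn_ord i; rewrite -{2}k1 ltnS leqn0 => /eqP.
have one (w : 'I_k -> R[i]) x : \sum_(i < k) w i * f i x = w i0 * f i0 x.
  rewrite (bigD1 i0)//= big1 ?addr0// => i.
  by rewrite (all0 i) eqxx.
have [u Hu] := f_span (combo_eigenspace (ev 1 0)).
have [v Hv] := f_span (combo_eigenspace (ev 0 1)).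
(* Both unit data would give multiples, [u] and [v] times, of the single basis function, so the
   combination with data [v] and [- u] vanishes. *)
have [h1 h2] : v i0 = 0 /\ - u i0 = 0.
  apply: (combo_eq0 ab Lip Lq Lr Ls ip0 (lam := lam)) => x axb.
  have := Hu x; have := Hv x; rewrite /= in_itv/= => /(_ axb) + /(_ axb).
  rewrite !one /combo !mul1r !mul0r addr0 add0r => -> ->; ring.
have [] : (1 : R[i]) = 0 /\ (0 : R[i]) = 0.
  apply: (combo_eq0 ab Lip Lq Lr Ls ip0 (lam := lam)) => x axb.
  rewrite Hu ?one /= ?in_itv//.
  by move/eqP: h2; rewrite oppr_eq0 => /eqP ->; rewrite mul0r.
by move/eqP; rewrite oner_eq0.
Qed.

Lemma basis_trace : (0 < k)%N -> M11 lam + M22 lam = 2 * cos g.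
Proof.
move=> k0; have [C0 [C1 [ev free]]] := basis_coordinates.
pose i0 := Ordinal k0; apply: (eigvec_trace _ (ev i0)).
apply: contraT; rewrite negb_or !negbK => /andP[/eqP z0 /eqP z1].
have := free (fun l => 1 * (l == i0)%:R); rewrite !sum_delta z0 z1 !mulr0.
by move=> /(_ erefl erefl i0)/eqP; rewrite eqxx mulr1 oner_eq0.
Qed.

Lemma basis_det (C0 C1 : 'I_k -> R[i]) :
  (forall w : 'I_k -> R[i], \sum_(i < k) w i * C0 i = 0 ->
    \sum_(i < k) w i * C1 i = 0 -> forall i, w i = 0) ->
  forall i j, i != j -> C0 i * C1 j - C0 j * C1 i != 0.
Proof.
move=> free i j ij; apply/eqP => det0.
have [x [y [xy h1 h2]]] := kernel2 det0.
have := free (fun l => x * (l == i)%:R + y * (l == j)%:R).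
under eq_bigr do rewrite mulrDl; rewrite big_split/= !sum_delta.
under eq_bigr do rewrite mulrDl; rewrite big_split/= !sum_delta.
rewrite (mulrC x) (mulrC y) h1 (mulrC x) (mulrC y) h2 => /(_ erefl erefl) H.
have := H i; rewrite eqxx (negbTE ij) mulr1 mulr0 addr0 => x0.
have := H j; rewrite eqxx eq_sym (negbTE ij) mulr1 mulr0 add0r => y0.
by move: xy; rewrite x0 y0 eqxx.
Qed.

Lemma basis_scalar : (1 < k)%N ->
  [/\ M12 lam = 0, M21 lam = 0 & M11 lam = M22 lam].
Proof.
move=> k1; have [C0 [C1 [ev free]]] := basis_coordinates.
pose i0 := Ordinal (ltnW k1); pose i1 := Ordinal k1.
have det : C0 i0 * C1 i1 - C1 i0 * C0 i1 != 0.
  by rewrite (mulrC (C1 i0)); apply: (basis_det free).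
have [a1 a2] := ev i0; have [b1 b2] := ev i1.
have [u1 u2] : (M11 lam)%:C - e = 0 /\ (M12 lam)%:C = 0 :> R[i].
  apply: (cramer2 det); first by rewrite mulrBl addrAC a1 subrr.
  by rewrite mulrBl addrAC b1 subrr.
have [v1 v2] : (M21 lam)%:C = 0 :> R[i] /\ (M22 lam)%:C - e = 0.
  apply: (cramer2 det); first by rewrite mulrBl addrA a2 subrr.
  by rewrite mulrBl addrA b2 subrr.
split; first by have [] := ReIm_eq u2.
  by have [] := ReIm_eq v1.
have : (M11 lam)%:C = (M22 lam)%:C :> R[i] by rewrite (subr0_eq u1) (subr0_eq v2).
by move/ReIm_eq => [].
Qed.

Lemma basis_le2 : (k <= 2)%N.
Proof.
rewrite leqNgt; apply/negP => k2.
have [C0 [C1 [ev free]]] := basis_coordinates.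
pose i0 := Ordinal (ltnW (ltnW k2)); pose i1 := Ordinal (ltnW k2); pose i2 := Ordinal k2.
(* The minors are the coefficients of a linear relation between three plane vectors; the last one is
   nonzero by [basis_det]. *)
pose x := C0 i1 * C1 i2 - C0 i2 * C1 i1.
pose y := C0 i2 * C1 i0 - C0 i0 * C1 i2.
pose z := C0 i0 * C1 i1 - C0 i1 * C1 i0.
have := free (fun l => x * (l == i0)%:R + y * (l == i1)%:R + z * (l == i2)%:R).
under eq_bigr do rewrite 2!mulrDl; rewrite 2!big_split/= !sum_delta.
under eq_bigr do rewrite 2!mulrDl; rewrite 2!big_split/= !sum_delta.
have -> : x * C0 i0 + y * C0 i1 + z * C0 i2 = 0 by rewrite /x /y /z; ring.
have -> : x * C1 i0 + y * C1 i1 + z * C1 i2 = 0 by rewrite /x /y /z; ring.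
move=> /(_ erefl erefl i2); rewrite eqxx /= !mulr0 !add0r mulr1 => z0.
by have /negP := basis_det free (isT : i0 != i1); apply; rewrite -/z z0.
Qed.

End basis.

End boundary_value_problem.

(** * Index sets with few elements *)

Section enumeration.
Context (S : set nat) (k : nat).
Hypothesis Sk : (S #= `I_k)%card.

Lemma card_II_pos : (0 < k)%N -> exists i, S i.
Proof.
move=> k0; have [f [_ _ fs]] := card_set_bijP Sk.
by have [i Si _] := fs 0%N k0; exists i.
Qed.

Lemma card_II_two : (1 < k)%N -> exists i j, [/\ i <> j, S i & S j].
Proof.
move=> k1; have [f [_ _ fs]] := card_set_bijP Sk.
have [i Si fi] := fs 0%N (ltnW k1); have [j Sj fj] := fs 1%N k1.
by exists i, j; split=> // ij; move: fi; rewrite ij fj.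
Qed.

Lemma two_card_II i j : i <> j -> S i -> S j -> (1 < k)%N.
Proof.
move=> ij Si Sj; have [f [fS fi _]] := card_set_bijP Sk.
have ik : (f i < k)%N by exact: (fS i Si).
have jk : (f j < k)%N by exact: (fS j Sj).
have : f i <> f j by move=> E; apply: ij; apply: fi E; exact: mem_set.
by lia.
Qed.

Lemma card_II_le2 i j l : (k <= 2)%N -> S i -> S j -> S l -> [\/ i = j, j = l | i = l].
Proof.
move=> k2 Si Sj Sl; have [f [fS fi _]] := card_set_bijP Sk.
have inj x y : S x -> S y -> f x = f y -> x = y.
  by move=> Sx Sy; apply: fi; exact: mem_set.
have ik : (f i < k)%N by exact: (fS i Si).
have jk : (f j < k)%N by exact: (fS j Sj).
have lk : (f l < k)%N by exact: (fS l Sl).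
have [E|[E|E]] : f i = f j \/ f j = f l \/ f i = f l by lia.
- by apply: Or31; exact: inj E.
- by apply: Or32; exact: inj E.
- by apply: Or33; exact: inj E.
Qed.

End enumeration.

(** After division by [w] the left side is real, so the imaginary part [sin g * c] of the right side
    vanishes. One row is enough: the other coordinate follows by exchanging the roles of [c] and
    [d]. *)
Lemma real_eigenvector {R : realType} (x1 x2 g c d : R) (w : R[i]) :
  sin g != 0 -> w != 0 ->
  x1%:C * (w * c%:C) + x2%:C * (w * d%:C) = cexpi g * (w * c%:C) -> c = 0.
Proof.
move=> sg w0 h.
have : x1%:C * c%:C + x2%:C * d%:C = cexpi g * c%:C.
  apply: (mulfI w0); transitivity (x1%:C * (w * c%:C) + x2%:C * (w * d%:C)); first ring.
  by rewrite h; ring.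
move/ReIm_eq => [_ /=]; rewrite !(mulr0, mul0r, addr0, add0r) => /esym/eqP.
by rewrite mulf_eq0 (negbTE sg) => /eqP.
Qed.

(** * Numbering of the eigenvalues and zeros of eigenfunctions *)

Section oscillation.
Context {R : realType} (a b : R) (p q r s ip gq gr gs : R -> R).
Hypotheses (ab : a < b) (Lip : L1 a b ip) (Lq : L1 a b gq) (Lr : L1 a b gr)
  (Ls : L1 a b gs)
  (coef : ae (fun x => a < x < b ->
    [/\ 0 < p x, (p x)^-1 = ip x, q x = gq x, r x = gr x & s x = gs x]))
  (ip0 : ae (fun x => a < x < b -> 0 < ip x))
  (r0 : ae (fun x => a < x < b -> 0 < gr x)).
Variables (K : 'M[R]_2) (g : R) (lam : nat -> R).
Hypotheses (detK : \det K = 1)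
  (lamE : eigenvalue_sequence a b p q r s (cexpi g *: cmatrix K) lam).

Local Notation pot := (pot gq gr).

Lemma eigenvalue_zeros n u u1 : lsol a b ip gs (pot (lam n)) u u1 ->
  (u a != 0) || (u1 a != 0) -> zeros_count_claim a b u n.
Proof.
have dK : K 0 0 * K 1 1 - K 0 1 * K 1 0 = 1 by rewrite -det_mx2.
have [k [E [kap [k0 kap_in kap_ac kap_pi [kap_lt kapE]]]]] := boundary_angle dK.
have C1 : cos g ^+ 2 <= 1 by rewrite -[leRHS](cos2Dsin2 g) lerDl sqr_ge0.
pose cls := Class a b ip gq gr gs (K 0 0) (K 0 1) (K 1 0) (K 1 1) kap (cos g).
have [lam_le _ lam_mult] := lamE.
(* Translates multiplicities into the matrix [K^-1 Phi]: at least one occurrence means trace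
   [2 * cos g], two occurrences mean a scalar matrix. *)
have mult x : exists k, [/\ ([set n | lam n = x] #= `I_k)%card, (k <= 2)%N,
    (0 < k)%N <-> D a b ip gq gr gs (K 0 0) (K 0 1) (K 1 0) (K 1 1) x = 2 * cos g,
    D a b ip gq gr gs (K 0 0) (K 0 1) (K 1 0) (K 1 1) x = 2 * cos g ->
      m12 a b ip gq gr gs (K 0 1) (K 1 1) x = 0 ->
      m21 a b ip gq gr gs (K 0 0) (K 1 0) x = 0 ->
      m11 a b ip gq gr gs (K 0 1) (K 1 1) x = m22 a b ip gq gr gs (K 0 0) (K 1 0) x ->
      (1 < k)%N &
    (1 < k)%N -> [/\ m12 a b ip gq gr gs (K 0 1) (K 1 1) x = 0,
      m21 a b ip gq gr gs (K 0 0) (K 1 0) x = 0 &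
      m11 a b ip gq gr gs (K 0 1) (K 1 1) x = m22 a b ip gq gr gs (K 0 0) (K 1 0) x]].
  have [m [f [fE f_free f_span]] card] := lam_mult x%:C.
  exists m; split.
  - suff <- : [set n | (lam n)%:C = x%:C] = [set n | lam n = x] by [].
    by apply/seteqP; split=> i /=; [move/ReIm_eq => []|move->].
  - exact: (basis_le2 ab Lip Lq Lr Ls coef detK fE f_free).
  - split; first exact: (basis_trace ab Lip Lq Lr Ls coef detK fE f_free).
    exact: (basis_pos ab Lip Lq Lr Ls coef ip0 detK f_span).
  - exact: (basis_double ab Lip Lq Lr Ls coef ip0 detK f_span).
  - exact: (basis_scalar ab Lip Lq Lr Ls coef detK fE f_free).
have lam_cls : forall n, cls n (lam n).
  apply: index_in_class => //.
  - move=> i j x y; exact: (Class_lt ab Lip Lq Lr Ls ip0 r0 dK k0 kapE C1).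
  - move=> i x y; exact: (Class_uniq ab Lip Lq Lr Ls ip0 r0 dK k0 kapE C1).
  - by move=> i j x; apply: Class_adj.
  - move=> i m x; exact: (Class_below ab Lip Lq Lr Ls ip0 r0 dK k0 kap_in kap_ac kap_pi kap_lt
      kapE C1).
  - move=> m x [Dx _]; have [l [card _ [_ pos] _ _]] := mult x.
    by apply: (card_II_pos card); exact: pos.
  - move=> m x c1 c2; have [l [card _ _ dbl _]] := mult x.
    apply: (card_II_two card).
    have [e1 e2 e3] := Class_double ab Lip Lq Lr Ls kapE c1 c2.
    by apply: dbl => //; exact: c1.1.
  - move=> i j ij Eij; have [l [card _ pos _ scal]] := mult (lam i).
    have l1 := two_card_II card ij (erefl _) (esym Eij).
    have [e1 e2 e3] := scal l1.
    apply: (scalar_double ab Lip Lq Lr Ls ip0 k0 kap_in kap_pi kap_lt kapE) => //.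
    by apply/pos; exact: ltnW.
  - move=> i j l Eij Ejl; have [m [card m2 _ _ _]] := mult (lam i).
    by apply: (card_II_le2 card m2) => //=; rewrite ?Eij ?Ejl.
  - move=> i; have [l [card _ pos _ _]] := mult (lam i).
    apply: (Class_exists ab Lip Lq Lr Ls ip0 dK k0 kap_in kap_pi kap_lt kapE C1).
    apply/pos; rewrite lt0n; apply/eqP => l0.
    have := card; rewrite l0 II0 card_eq0 => /eqP S0.
    by have : [set n | lam n = lam i] i by []; rewrite S0.
move=> hu u0; apply: (lsol_zeros ab Lip Lq Lr Ls ip0 hu u0) => al al0.
exact: (Class_angle kap_in kap_pi kap_lt (lam_cls n)).
Qed.

Lemma real_eigenfunction_zeros n (y : R -> R) :
  eigenfunction a b p q r s (cexpi g *: cmatrix K) (lam n)%:C (fun x => (y x)%:C) ->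
  zeros_count_claim a b y n.
Proof.
move=> [[y1 hy _] [x]]; rewrite /= in_itv/= => axb yx.
have [hu _] := sl_solution_lsol coef hy.
apply: (eigenvalue_zeros hu); apply: contraT; rewrite negb_or !negbK => /andP[/eqP u0 /eqP u10].
have [/= yx0 _] := lsol_uniq0 Lip Ls (L1_pot Lq Lr (lam n)) hu u0 u10 axb.
by rewrite yx0 eqxx in yx.
Qed.

Lemma complex_eigenfunction_zeros n (y : R -> R[i]) : sin g != 0 ->
  eigenfunction a b p q r s (cexpi g *: cmatrix K) (lam n)%:C y ->
  [/\ zeros_count_claim a b (fun x => complex.Re (y x)) n,
      zeros_count_claim a b (fun x => complex.Im (y x)) n &
      forall x, `[a, b]%classic x -> y x <> 0].
Proof.
move=> sg [[y1 hy bc] [x]]; rewrite /= in_itv/= => axb yx.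
have ev := solution_eigvec ab Lip Lq Lr Ls coef detK hy bc.
have [hu hv] := sl_solution_lsol coef hy.
(* Used with [w] equal to [i] and 1, when the real or imaginary parts of the data vanish, and with
   [1 + i t] at a common zero. *)
have ndir w (c d : R) : w != 0 -> y a = w * c%:C -> y1 a = w * d%:C -> False.
  move=> w0 ea e1a; move: ev; rewrite ea e1a => -[h1 h2].
  have c0 := real_eigenvector sg w0 h1.
  have d0 : d = 0 by apply: (real_eigenvector sg w0); rewrite addrC; exact: h2.
  have [yx0 _] := solution_combo ab Lip Lq Lr Ls coef hy axb.
  by move: yx; rewrite yx0 ea e1a c0 d0 /combo !rmorph0 !mulr0 !mul0r addr0 eqxx.
have u0 : (complex.Re (y a) != 0) || (complex.Re (y1 a) != 0).
  apply: contraT; rewrite negb_or !negbK => /andP[/eqP ea /eqP e1a].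
  have w0 : (0 +i* 1 : R[i]) != 0 by apply/eqP => -[/eqP]; rewrite oner_eq0.
  by case: (ndir (0 +i* 1) (complex.Im (y a)) (complex.Im (y1 a)) w0);
    apply: complexP => /=; rewrite ?ea ?e1a; ring.
have v0 : (complex.Im (y a) != 0) || (complex.Im (y1 a) != 0).
  apply: contraT; rewrite negb_or !negbK => /andP[/eqP ea /eqP e1a].
  by case: (ndir 1 (complex.Re (y a)) (complex.Re (y1 a)) (oner_neq0 _));
    apply: complexP => /=; rewrite ?ea ?e1a; ring.
split; [exact: eigenvalue_zeros hu u0|exact: eigenvalue_zeros hv v0|].
move=> z; rewrite /= in_itv/= => azb /ReIm_eq[/= uz vz].
have := lsol_wronskian hu hv azb; rewrite uz vz mulr0 mul0r subrr => /esym/subr0_eq W.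
(* A vanishing Wronskian at [a] makes the imaginary data proportional to the real data, which are
   nonzero. *)
have [t [e0 e1]] : exists t, complex.Im (y a) = t * complex.Re (y a) /\
    complex.Im (y1 a) = t * complex.Re (y1 a).
  case/orP: u0 => ne.
    exists (complex.Im (y a) / complex.Re (y a)); split; first by rewrite divfK.
    by apply: (mulfI ne); rewrite -W; field.
  exists (complex.Im (y1 a) / complex.Re (y1 a)); split; last by rewrite divfK.
  by apply: (mulfI ne); rewrite W; field.
have w0 : (1 +i* t : R[i]) != 0 by apply/eqP => -[/eqP]; rewrite oner_eq0.
by case: (ndir (1 +i* t) (complex.Re (y a)) (complex.Re (y1 a)) w0);
  apply: complexP => /=; rewrite ?e0 ?e1; ring.
Qed.

End oscillation.

Theorem theorem6p1 (R : realType) (a b : R) (p q r s : R -> R)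
  (ab : a < b)
  (p_L1 : in_L1 `]a, b[%classic (fun x => (p x)^-1))
  (q_L1 : in_L1 `]a, b[%classic q)
  (r_L1 : in_L1 `]a, b[%classic r)
  (s_L1 : in_L1 `]a, b[%classic s)
  (p_gt0 : {ae @lebesgue_measure R, forall x, `]a, b[%classic x -> 0 < p x})
  (r_gt0 : {ae @lebesgue_measure R, forall x, `]a, b[%classic x -> 0 < r x}) :
  (forall (K : 'M[R]_2) (lam : nat -> R), \det K = 1 ->
    eigenvalue_sequence a b p q r s (cmatrix K) lam ->
    forall (n : nat) (psi : R -> R),
      eigenfunction a b p q r s (cmatrix K) (lam n)%:C
        (fun x => (psi x)%:C) ->
      zeros_count_claim a b psi n)
  /\
  (forall (K : 'M[R]_2) (gamma : R) (lam : nat -> R), \det K = 1 ->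
    0 < gamma < pi \/ - pi < gamma < 0 ->
    eigenvalue_sequence a b p q r s (cexpi gamma *: cmatrix K) lam ->
    forall (n : nat) (psi : R -> R[i]),
      eigenfunction a b p q r s (cexpi gamma *: cmatrix K) (lam n)%:C psi ->
      [/\ zeros_count_claim a b (fun x => complex.Re (psi x)) n,
          zeros_count_claim a b (fun x => complex.Im (psi x)) n &
          forall x, `[a, b]%classic x -> psi x <> 0]).
Proof.
have [ip Lip ipE] := p_L1; have [gq Lq qE] := q_L1.
have [gr Lr rE] := r_L1; have [gs Ls sE] := s_L1.
have coef : ae (fun x => a < x < b ->
    [/\ 0 < p x, (p x)^-1 = ip x, q x = gq x, r x = gr x & s x = gs x]).
  apply: ae2 (ae_and (ae_and p_gt0 ipE) qE) (ae_and rE sE).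
  move=> x [[h1 h2] h3] [h4 h5] axb.
  have xab : `]a, b[%classic x by rewrite /= in_itv.
  by split; [exact: h1|exact: h2|exact: h3|exact: h4|exact: h5].
have ip0 : ae (fun x => a < x < b -> 0 < ip x).
  by apply: ae1 coef => x H /H[p0 <- _ _ _]; rewrite invr_gt0.
have r0 : ae (fun x => a < x < b -> 0 < gr x).
  apply: ae2 coef r_gt0 => x H h axb; have [_ _ _ <- _] := H axb.
  by apply: h; rewrite /= in_itv.
split=> [K lam detK|K gamma lam detK gammaE] lamE n psi.
  have K0 : cmatrix K = cexpi 0 *: cmatrix K by rewrite /cexpi cos0 sin0 scale1r.
  rewrite K0 in lamE * => psiE.
  exact: (real_eigenfunction_zeros ab Lip Lq Lr Ls coef ip0 r0 detK lamE psiE).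
apply: (complex_eigenfunction_zeros ab Lip Lq Lr Ls coef ip0 r0 detK lamE).
case: gammaE => [/sin_gt0_pi/gt_eqF ->//|/andP[g1 g2]].
by rewrite -[gamma]opprK sinN oppr_eq0 gt_eqF// sin_gt0_pi// oppr_gt0 g2 ltrNl.
Qed.
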